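(* Let $\theta$ be irrational and let $\varphi$ be the rotation $z\mapsto e^{2i\pi\theta}z$ of the closed unit disk $\mathbb{D}$. Define the map $q$ by $\rho\circ\xi_r\mapsto(\rho,r)\in\widehat{\mathcal{A}_\theta}\times(0,1]$ for $\rho\in\widehat{\mathcal{A}_\theta}$, $r\in(0,1]$, and $\pi_\omega\mapsto\omega\in\mathbb{T}$ for $\omega\in\mathbb{T}$. Then $q$ is a homeomorphism from the spectrum of $C(\mathbb{D})\rtimes_\varphi\mathbb{Z}$ onto the disjoint union $\mathbb{T}\cup(\widehat{\mathcal{A}_\theta}\times(0,1])$ when the latter is endowed with the topology whose closed sets are those of the form $\mathbb{T}\cup(\widehat{\mathcal{A}_\theta}\times F)$ or $Y\cup(\widehat{\mathcal{A}_\theta}\times X)$, where $F$ is relatively closed in $(0,1]$, $X$ is a compact subset of $(0,1]$ and $Y$ is closed in $\mathbb{T}$.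
   Context: $\mathbb{D}=\{z\in\mathbb{C}:|z|\le 1\}$, $\mathbb{T}=\{|z|=1\}$. For a homeomorphism $\varphi$ of a compact space $X$, $C(X)\rtimes_\varphi\mathbb{Z}$ is the universal C*-algebra generated by $C(X)$ and a unitary $U_\varphi$ with $U_\varphi^*fU_\varphi=f\circ\varphi$ for all $f\in C(X)$. $\mathcal{A}_\theta$ is the universal C*-algebra generated by two unitaries $U,V$ with $VU=e^{2i\pi\theta}UV$, and $\widehat{\mathcal{A}_\theta}$ is its spectrum (set of unitary equivalence classes of irreducible representations). The spectrum of a C*-algebra carries the hull-kernel (Jacobson) topology. For $r\in[0,1]$, $\Gamma_r$ is the circle of center $0$ and radius $r$ and $\xi_r$ is the quotient map from $C(\mathbb{D})\rtimes_\varphi\mathbb{Z}$ onto $C(\Gamma_r)\rtimes_\varphi\mathbb{Z}$ induced by restriction; for $r>0$ the latter is identified with $\mathcal{A}_\theta$ (canonical unitary $\mapsto U$, function $z\mapsto rV$), and for $r=0$ with $C(\mathbb{T})$ (canonical unitary $\mapsto$ the function $z$). For $\omega\in\mathbb{T}$, $\pi_\omega=\nu_\omega\circ\xi_0$ with $\nu_\omega(f)=f(\omega)$. Every irreducible representation of $C(\mathbb{D})\rtimes_\varphi\mathbb{Z}$ is, up to unitary equivalence, of exactly one of the forms $\rho\circ\xi_r$ ($r\in(0,1]$, $\rho\in\widehat{\mathcal{A}_\theta}$) or $\pi_\omega$ ($\omega\in\mathbb{T}$), with $(\rho,r)$, resp. $\omega$, uniquely determined. *)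

(* Defs.v *)
(* Every C*-algebra below is unital and nonzero, and *-homomorphisms preserve
   the unit. *)
From HB Require Import structures.
From mathcomp Require Import all_boot all_order all_algebra.
From mathcomp Require Import all_classical all_reals all_analysis.
From mathcomp Require Import complex.
Set Implicit Arguments.
Unset Strict Implicit.
Unset Printing Implicit Defensive.
Import Order.TTheory GRing.Theory Num.Theory.
Import numFieldNormedType.Exports.
Local Open Scope classical_set_scope.
Local Open Scope ring_scope.

(* R[i] seen as an abstract numClosedFieldType, so that the topology and the
   norm that the library puts on a numFieldType are found on it. *)
Definition cplx (R : realType) : numClosedFieldType := R[i].

HB.mixin Record isStarAlgebra (R : realType) A of GRing.Algebra (cplx R) A := {
  star : A -> A ;
  starD : forall x y, star (x + y) = star x + star y ;
  starZ : forall (k : cplx R) x, star (k *: x) = k^* *: star x ;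
  starM : forall x y, star (x * y) = star y * star x ;
  starK : involutive star }.

#[short(type="starAlgType")]
HB.structure Definition StarAlgebra (R : realType) :=
  {A of isStarAlgebra R A & GRing.Algebra (cplx R) A}.

(* The norm is not taken from CompleteNormedModule: no structure can extend both
   a ring and a library normed module, because NumDomain would lack the
   corresponding join. *)
HB.mixin Record isCStarAlgebra (R : realType) A of StarAlgebra R A := {
  cnorm : A -> R ;
  cnorm_eq0 : forall x, cnorm x = 0 -> x = 0 ;
  cnormD : forall x y, cnorm (x + y) <= cnorm x + cnorm y ;
  cnormZ : forall (k : cplx R) x,
    (cnorm (k *: x))%:C%C = `|k| * (cnorm x)%:C%C :> cplx R ;
  cnormM : forall x y, cnorm (x * y) <= cnorm x * cnorm y ;
  cnorm_star : forall x, cnorm (star x * x) = cnorm x ^+ 2 ;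
  cnorm_complete : forall u : nat -> A,
    (forall e, 0 < e -> exists N, forall m n, (N <= m)%N -> (N <= n)%N ->
       cnorm (u m - u n) < e) ->
    exists l, (fun n => cnorm (u n - l)) @ \oo --> 0 }.

#[short(type="cstarAlgType")]
HB.structure Definition CStarAlgebra (R : realType) :=
  {A of isCStarAlgebra R A & StarAlgebra R A}.

HB.mixin Record isHilbert (R : realType) H
    of CompleteNormedModule (cplx R) H := {
  dot : H -> H -> cplx R ;
  dotP : forall (k : cplx R) x y z, dot (k *: x + y) z = k * dot x z + dot y z ;
  dotC : forall x y, dot y x = (dot x y)^* ;
  dot_norm : forall x : H, dot x x = `|x| ^+ 2 }.

#[short(type="hilbertType")]
HB.structure Definition Hilbert (R : realType) :=
  {H of isHilbert R H & CompleteNormedModule (cplx R) H}.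

(* The *-algebra C(X).  It is only used as the source of *-homomorphisms into
   C*-algebras and as the target of a *-isomorphism, for which the *-algebra
   structure suffices. *)
Definition cfun (R : realType) (X : ptopologicalType) :=
  continuousType X (cplx R).

Section CFun.
Context (R : realType) (X : ptopologicalType).
Implicit Types f g h : cfun R X.

HB.instance Definition _ := Choice.on (cfun R X).

Fact cfun0_cts : continuous (fun _ : X => 0 : cplx R).
Proof. by move=> x; exact: cvg_cst. Qed.
Fact cfun1_cts : continuous (fun _ : X => 1 : cplx R).
Proof. by move=> x; exact: cvg_cst. Qed.
Fact cfunN_cts f : continuous (fun x => - f x).
Proof. by move=> x; apply: cvgN; exact: cts_fun. Qed.
Fact cfunD_cts f g : continuous (fun x => f x + g x).
Proof. by move=> x; apply: cvgD; exact: cts_fun. Qed.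
Fact cfunM_cts f g : continuous (fun x => f x * g x).
Proof. by move=> x; apply: cvgM; exact: cts_fun. Qed.
Fact cfunZ_cts (k : cplx R) f : continuous (fun x => k * f x).
Proof. by move=> x; apply: cvgM; [exact: cvg_cst|exact: cts_fun]. Qed.
Fact cfunS_cts f : continuous (fun x => (f x)^*).
Proof.
move=> x; apply/cvgrPdist_lt => e e0.
have /cvgrPdist_lt/(_ e e0) := @cts_fun _ _ f x.
by apply: filterS => y; rewrite -rmorphB norm_conjC.
Qed.

Definition cfun0 : cfun R X := mkcts cfun0_cts.
Definition cfun1 : cfun R X := mkcts cfun1_cts.
Definition cfunN f : cfun R X := mkcts (@cfunN_cts f).
Definition cfunD f g : cfun R X := mkcts (@cfunD_cts f g).
Definition cfunM f g : cfun R X := mkcts (@cfunM_cts f g).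
Definition cfunZ k f : cfun R X := mkcts (@cfunZ_cts k f).
Definition cfunS f : cfun R X := mkcts (@cfunS_cts f).

Fact cfunDA : associative cfunD.
Proof. by move=> f g h; apply/continuousEP => x /=; exact: addrA. Qed.
Fact cfunDC : commutative cfunD.
Proof. by move=> f g; apply/continuousEP => x /=; exact: addrC. Qed.
Fact cfun0D : left_id cfun0 cfunD.
Proof. by move=> f; apply/continuousEP => x /=; exact: add0r. Qed.
Fact cfunND : left_inverse cfun0 cfunN cfunD.
Proof. by move=> f; apply/continuousEP => x /=; exact: addNr. Qed.

HB.instance Definition _ :=
  GRing.isZmodule.Build (cfun R X) cfunDA cfunDC cfun0D cfunND.

Fact cfunMA : associative cfunM.
Proof. by move=> f g h; apply/continuousEP => x /=; exact: mulrA. Qed.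
Fact cfun1M : left_id cfun1 cfunM.
Proof. by move=> f; apply/continuousEP => x /=; exact: mul1r. Qed.
Fact cfunM1 : right_id cfun1 cfunM.
Proof. by move=> f; apply/continuousEP => x /=; exact: mulr1. Qed.
Fact cfunMDl : left_distributive cfunM cfunD.
Proof. by move=> f g h; apply/continuousEP => x /=; exact: mulrDl. Qed.
Fact cfunMDr : right_distributive cfunM cfunD.
Proof. by move=> f g h; apply/continuousEP => x /=; exact: mulrDr. Qed.
Fact cfun1_neq0 : cfun1 != 0.
Proof.
by apply/eqP => /continuousEP /(_ point) /= /eqP; rewrite oner_eq0.
Qed.

HB.instance Definition _ := GRing.Zmodule_isNzRing.Build (cfun R X)
  cfunMA cfun1M cfunM1 cfunMDl cfunMDr cfun1_neq0.

Fact cfunZA k l f : cfunZ k (cfunZ l f) = cfunZ (k * l) f.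
Proof. by apply/continuousEP => x /=; exact: mulrA. Qed.
Fact cfun1Z : left_id 1 cfunZ.
Proof. by move=> f; apply/continuousEP => x /=; exact: mul1r. Qed.
Fact cfunZDr : right_distributive cfunZ +%R.
Proof. by move=> k f g; apply/continuousEP => x /=; exact: mulrDr. Qed.
Fact cfunZDl f : {morph cfunZ^~ f : k l / k + l}.
Proof. by move=> k l; apply/continuousEP => x /=; exact: mulrDl. Qed.

HB.instance Definition _ := GRing.Zmodule_isLmodule.Build (cplx R) (cfun R X)
  cfunZA cfun1Z cfunZDr cfunZDl.

Fact cfunZAl (k : cplx R) f g : k *: (f * g) = k *: f * g.
Proof. by apply/continuousEP => x /=; exact: mulrA. Qed.
HB.instance Definition _ :=
  GRing.Lmodule_isLalgebra.Build (cplx R) (cfun R X) cfunZAl.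

Fact cfunZAr (k : cplx R) f g : k *: (f * g) = f * (k *: g).
Proof. by apply/continuousEP => x /=; exact: mulrCA. Qed.
HB.instance Definition _ :=
  GRing.Lalgebra_isAlgebra.Build (cplx R) (cfun R X) cfunZAr.

Fact cfunSD f g : cfunS (f + g) = cfunS f + cfunS g.
Proof. by apply/continuousEP => x /=; exact: rmorphD. Qed.
Fact cfunSZ (k : cplx R) f : cfunS (k *: f) = k^* *: cfunS f.
Proof. by apply/continuousEP => x /=; exact: rmorphM. Qed.
Fact cfunSM f g : cfunS (f * g) = cfunS g * cfunS f.
Proof.
by apply/continuousEP => x /=; apply: etrans (mulrC _ _); exact: rmorphM.
Qed.
Fact cfunSK : involutive cfunS.
Proof. by move=> f; apply/continuousEP => x /=; exact: conjCK. Qed.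

HB.instance Definition _ :=
  isStarAlgebra.Build R (cfun R X) cfunSD cfunSZ cfunSM cfunSK.

End CFun.

Definition starhom (R : realType) (A B : starAlgType R) (f : A -> B) :=
  [/\ linear f, monoid_morphism f & {morph f : x / star x}].

Structure starEpi (R : realType) (A B : starAlgType R) := StarEpi {
  starEpi_fun :> A -> B ;
  starEpi_hom : starhom starEpi_fun ;
  starEpi_surj : forall b, exists a, starEpi_fun a = b }.

Section StarEpiComp.
Context (R : realType) (A B C : starAlgType R).
Context (g : starEpi B C) (f : starEpi A B).

Fact starEpi_comp_hom : starhom (g \o f).
Proof.
have [gL [g1 gM] gS] := starEpi_hom g; have [fL [f1 fM] fS] := starEpi_hom f.
split=> [k x y|| x] /=; first by rewrite fL gL.
- by split=> [|x y] /=; [rewrite f1 g1 | rewrite fM gM].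
- by rewrite fS gS.
Qed.

Fact starEpi_comp_surj c : exists a, (g \o f) a = c.
Proof.
have [b <-] := starEpi_surj g c; have [a <-] := starEpi_surj f b.
by exists a.
Qed.

Definition starEpi_comp : starEpi A C :=
  StarEpi starEpi_comp_hom starEpi_comp_surj.
End StarEpiComp.

Section Representations.
Context (R : realType).

(* For a C*-algebra the continuity of each pi a is automatic. *)
Definition representation (A : starAlgType R) (H : hilbertType R)
    (pi : A -> H -> H) :=
  [/\ forall a, linear (pi a) /\ continuous (pi a),
      forall (k : cplx R) a b x, pi (k *: a + b) x = k *: pi a x + pi b x,
      forall a b x, pi (a * b) x = pi a (pi b x)
    & forall a x y, dot (pi a x) y = dot x (pi (star a) y)].

Definition closed_subspace (H : hilbertType R) (W : set H) :=
  [/\ W 0, forall (k : cplx R) x y, W x -> W y -> W (k *: x + y) & closed W].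

Definition irreducible (A : starAlgType R) (H : hilbertType R)
    (pi : A -> H -> H) :=
  (exists a x, pi a x <> 0) /\
  forall W : set H, closed_subspace W -> (forall a x, W x -> W (pi a x)) ->
    W = [set 0] \/ W = setT.

Record irrep (A : starAlgType R) := Irrep {
  irrep_space : hilbertType R ;
  irrep_act :> A -> irrep_space -> irrep_space ;
  irrepP : representation irrep_act ;
  irrep_irr : irreducible irrep_act }.

Definition unitary_equiv (A : starAlgType R) (p q : irrep A) :=
  exists W : irrep_space p -> irrep_space q,
    [/\ linear W, forall x y, dot (W x) (W y) = dot x y,
        forall y, exists x, W x = y
      & forall a x, W (p a x) = q a (W x)].

(* The spectrum, as the type of equivalence classes.  It lives in a universe
   too large for the structures and sets of the library, hence the hand-made
   topologies below. *)
Definition spectrum (A : starAlgType R) :=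
  {S : irrep A -> Prop | exists p, S = unitary_equiv p}.

Definition spec_class (A : starAlgType R) (p : irrep A) : spectrum A :=
  exist _ (unitary_equiv p) (ex_intro _ p erefl).

Section PullBack.
Context (A B : starAlgType R) (f : starEpi A B) (p : irrep B).

Fact irrep_pull_rep : representation (fun a x => p (f a) x).
Proof.
have [fL [_ fM] fS] := starEpi_hom f; have [pC pL pM pS] := irrepP p.
by split=> [a|k a b x|a b x|a x y] //; rewrite ?fL ?fM ?fS ?pL ?pM ?pS.
Qed.

Fact irrep_pull_irr : irreducible (fun a x => p (f a) x).
Proof.
have [[b [x pbx]] pI] := irrep_irr p.
have fS := starEpi_surj f; split.
  by have [a fab] := fS b; exists a, x; rewrite fab.
by move=> W Wc Wi; apply: pI => // c y Wy; have [a <-] := fS c; exact: Wi.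
Qed.

Definition irrep_pull : irrep A := Irrep irrep_pull_rep irrep_pull_irr.
End PullBack.

End Representations.

Definition cline (R : realType) : Type := cplx R.

Section CLine.
Context (R : realType).

HB.instance Definition _ := NormedModule.copy (cline R) ((cplx R)^o).

Fact cline_Re (z : R[i]) : `|complex.Re z|%:C%C <= `|z|.
Proof. exact: normc_ge_Re. Qed.
Fact cline_Im (z : R[i]) : `|complex.Im z|%:C%C <= `|z|.
Proof.
have -> : complex.Im z = complex.Re (- (z * 'i%C)) by rewrite raddfN /= ReiNIm opprK.
apply: le_trans (normc_ge_Re _) _.
rewrite normrN normrM [`|'i%C|]normc_def /= expr0n /= add0r expr1n sqrtr1.
by rewrite mulr1.
Qed.

Fact cline_complete (F : set_system (cline R)) :
  ProperFilter F -> cauchy F -> cvg F.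
Proof.
move=> FF /cauchyP Fc.
have part (g : R[i] -> R) (gB : {morph g : x y / x - y})
    (gle : forall z, `|g z|%:C%C <= `|z|) : cvg ((g : cline R -> R) @ F).
  apply: R_complete; apply: cauchy_exP => e e0.
  have e0C : 0 < e%:C%C :> cplx R by rewrite ltcR.
  have [x Fx] := Fc _ e0C; exists (g x).
  suff: F ((g : cline R -> R) @^-1` ball (g x) e) by [].
  apply: filterS Fx => y xy.
  have {}xy : `|(x : cplx R) - (y : cplx R)| < e%:C%C by [].
  suff : `|g x - g y| < e by [].
  by rewrite -gB -ltcR; apply: le_lt_trans xy; exact: gle.
have /cvg_ex[a Fa] := part _ (raddfB _) cline_Re.
have /cvg_ex[b Fb] := part _ (raddfB _) cline_Im.
apply/cvg_ex; exists ((a +i* b)%C : cline R).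
apply/cvgrPdist_lt => e e0.
have eE : (complex.Re e)%:C%C = e by apply: RRe_real; exact: gtr0_real.
have r0 : 0 < complex.Re e / 2.
  by rewrite divr_gt0// -ltcR eE.
move/cvgrPdist_lt/(_ _ r0) : Fa => Fa; move/cvgrPdist_lt/(_ _ r0) : Fb => Fb.
near=> z.
have za : `|a - complex.Re z| < complex.Re e / 2 by near: z.
have zb : `|b - complex.Im z| < complex.Re e / 2 by near: z.
have -> : (a +i* b)%C - z = (a - complex.Re z)%:C%C + 'i%C * (b - complex.Im z)%:C%C :> R[i].
  rewrite [z in LHS]complexE [(a +i* b)%C]complexE /= !rmorphB /=.
  by rewrite mulrBr opprD addrACA.
rewrite -eE; apply: le_lt_trans (ler_normD _ _) _.
have -> : complex.Re e = complex.Re e / 2 + complex.Re e / 2 by rewrite -splitr.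
rewrite [X in _ < X]rmorphD /=; apply: ltrD.
  by rewrite normc_def /= expr0n /= addr0 sqrtr_sqr ltcR.
rewrite normrM [`|'i%C|]normc_def /= expr0n /= add0r expr1n sqrtr1 mul1r.
by rewrite normc_def /= expr0n /= addr0 sqrtr_sqr ltcR.
Unshelve. all: by end_near. Qed.

HB.instance Definition _ := Uniform_isComplete.Build (cline R) cline_complete.

Definition cline_dot (x y : cline R) : cplx R := (x : cplx R) * (y : cplx R)^*.

Fact cline_dotP (k : cplx R) (x y z : cline R) :
  cline_dot (k *: x + y) z = k * cline_dot x z + cline_dot y z.
Proof. by rewrite /cline_dot mulrDl mulrA. Qed.
Fact cline_dotC (x y : cline R) : cline_dot y x = (cline_dot x y)^*.
Proof.
rewrite /cline_dot [RHS]rmorphM /=.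
by rewrite [X in _ = _ * X](@conjCK (cplx R)) mulrC.
Qed.
Fact cline_dot_norm (x : cline R) : cline_dot x x = `|x| ^+ 2.
Proof. by rewrite /cline_dot -normCK. Qed.

HB.instance Definition _ :=
  isHilbert.Build R (cline R) cline_dotP cline_dotC cline_dot_norm.
End CLine.

(* The evaluation nu_x : f |-> f(x), seen as an irreducible representation. *)
Section Evaluation.
Context (R : realType) (X : ptopologicalType) (x : X).

Definition eval_act (f : cfun R X) (v : cline R) : cline R :=
  (f x : cplx R) *: v.

Fact eval_rep : representation eval_act.
Proof.
split=> [f|k f g v|f g v|f v w].
- split=> [k v w|]; last exact: scaler_continuous.
  by rewrite /eval_act scalerDr !scalerA mulrC.
- by rewrite /eval_act scalerDl scalerA.
- by rewrite /eval_act scalerA.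
- rewrite /dot /= /cline_dot [X in _ = _ * X]rmorphM /=.
  by rewrite conjCK mulrCA mulrA.
Qed.

Fact eval_irr : irreducible eval_act.
Proof.
split.
  by exists 1, (1 : cplx R); rewrite /eval_act scale1r; apply/eqP/oner_neq0.
move=> W [W0 WL _] _.
have [[v [Wv v0]]|W1] := pselect (exists v, W v /\ v <> 0); [right|left].
  apply/seteqP; split=> // w _.
  have -> : w = ((w : cplx R) / v) *: v + 0.
    by rewrite addr0 /GRing.scale /= divfK //; exact/eqP.
  exact: WL.
apply/seteqP; split=> [v Wv|v ->//] /=.
by apply: contrapT => v0; apply: W1; exists v.
Qed.

Definition eval_irrep : irrep (cfun R X) := Irrep eval_rep eval_irr.
End Evaluation.

Record topology (X : Type) := Topology {
  tclosed : (X -> Prop) -> Prop ;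
  tclosed0 : tclosed (fun=> False) ;
  tclosedT : tclosed (fun=> True) ;
  tclosedU : forall S T, tclosed S -> tclosed T ->
    tclosed (fun x => S x \/ T x) ;
  tclosedI : forall P : (X -> Prop) -> Prop, (forall S, P S -> tclosed S) ->
    tclosed (fun x => forall S, P S -> S x) }.

Definition homeomorphism (X Y : Type) (tX : topology X) (tY : topology Y)
    (q : X -> Y) :=
  bijective q /\
  forall S : Y -> Prop, tclosed tY S <-> tclosed tX (fun x => S (q x)).

Fact linear_at0 (R : realType) (V W : hilbertType R) (f : V -> W) :
  linear f -> f 0 = 0.
Proof.
by move=> /(_ (-1) 0 0); rewrite !scaleN1r oppr0 addr0 addNr.
Qed.

Section Jacobson.
Context (R : realType) (A : starAlgType R).

Definition spec_ker (c : spectrum A) : set A :=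
  [set a | forall p, sval c p -> forall x, p a x = 0].

Definition kernel (S : spectrum A -> Prop) : set A :=
  [set a | forall c, S c -> spec_ker c a].

Definition hull (I : set A) : spectrum A -> Prop :=
  fun c => I `<=` spec_ker c.

Definition hk_closed (S : spectrum A -> Prop) :=
  forall c, hull (kernel S) c -> S c.

Fact spec_kerP (c : spectrum A) :
  exists p : irrep A, forall a, spec_ker c a <-> forall x, p a x = 0.
Proof.
case: c => S [p Sp]; exists p => a; split=> [|pa q].
  apply; rewrite /= Sp; exists id; split=> // y; by exists y.
rewrite /= Sp => -[W [Wl _ Ws Wa]] y.
have [x <-] := Ws y; rewrite -Wa pa.
exact: linear_at0.
Qed.

Fact hk_closed0 : hk_closed (fun=> False).
Proof.
move=> c cI; have [p pP] := spec_kerP c.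
have [[a [x ax]] _] := irrep_irr p.
by apply: ax; apply: (pP a).1; apply: cI.
Qed.

Fact hk_closedT : hk_closed (fun=> True).
Proof. exact: (fun _ _ => I). Qed.

Fact hk_closedI (P : (spectrum A -> Prop) -> Prop) :
  (forall S, P S -> hk_closed S) -> hk_closed (fun c => forall S, P S -> S c).
Proof.
move=> Pcl c cI S PS; apply: (Pcl S PS) => a Sa; apply: cI => d dP.
by apply: Sa; apply: dP.
Qed.

Fact hk_closedU S T : hk_closed S -> hk_closed T ->
  hk_closed (fun c => S c \/ T c).
Proof.
move=> Scl Tcl c cI; apply: contrapT => /not_orP[Sc Tc].
have [p pP] := spec_kerP c.
have nin U : hk_closed U -> ~ U c ->
    exists b, kernel U b /\ exists x, p b x <> 0.
  move=> Ucl Uc; apply: contrapT => nb; apply: Uc; apply: Ucl => b Ub.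
  apply: (pP b).2 => x; apply: contrapT => bx; apply: nb; exists b; split=> //.
  by exists x.
have [b [Sb [y0 by0]]] := nin S Scl Sc.
have [a [Ta [x0 ax0]]] := nin T Tcl Tc.
have [pC pL pM pS] := irrepP p; have [_ pI] := irrep_irr p.
pose W := [set y | forall d, p b (p d y) = 0].
have p0 e : p e 0 = 0 by exact: (linear_at0 (pC e).1).
have [| |W0|WT] := pI W.
- split=> [d|k x y Wx Wy d|]; first by rewrite !p0.
  + by rewrite (pC d).1 (pC b).1 Wx Wy scaler0 addr0.
  + have -> : W = \bigcap_(d in [set: A]) ((p b \o p d) @^-1` [set 0]).
      by apply/seteqP; split=> y /= Wy d *; exact: Wy.
    apply: closed_bigI => d _; apply: preimage_closed; last first.
      exact/accessible_closed_set1/hausdorff_accessible/norm_hausdorff.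
    by move=> y _; apply: continuous_comp; [exact: (pC d).2|exact: (pC b).2].
- by move=> e x Wx d; rewrite -[p d _]pM; exact: Wx.
- suff : W (p a x0) by rewrite W0.
  move=> d; rewrite -!pM; move: x0 {ax0}; apply: (pP _).1; apply: cI => e [Se|Te] q eq x.
    have [qC _ qM _] := irrepP q.
    by rewrite -mulrA qM (Sb e Se q eq).
  have [qC _ qM _] := irrepP q.
  rewrite qM (Ta e Te q eq).
  exact: (linear_at0 (qC (b * d)).1).
- have : W y0 by rewrite WT.
  by move=> /(_ 1); rewrite -pM mulr1.
Qed.

Definition jacobson : topology (spectrum A) :=
  Topology hk_closed0 hk_closedT hk_closedU hk_closedI.
End Jacobson.

Definition to_set (T : Type) (K : set T) (z : T) (Kz : K z) : K :=
  exist _ z (mem_set Kz).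

Section Spaces.
Context (R : realType).

Definition I01 : set R := [set r | 0 <= r <= 1].
Definition oc01 : set R := [set r | 0 < r <= 1].

Fact I01_0 : I01 0. Proof. by rewrite /I01 /= lexx ler01. Qed.
Fact I01_1 : I01 1. Proof. by rewrite /I01 /= lexx ler01. Qed.
Fact oc01_I01 (r : oc01) : I01 (set_val r).
Proof. by have /andP[/ltW r0 r1] := set_valP r; apply/andP. Qed.

Definition zero01 : I01 := to_set I01_0.
Definition one01 : I01 := to_set I01_1.
Definition of_oc01 (r : oc01) : I01 := to_set (oc01_I01 r).

Definition disk_set : set (cplx R) := [set z | `|z| <= 1].
Definition circle_set (r : I01) : set (cplx R) :=
  [set z | `|z| = (set_val r)%:C%C].

Definition disk : Type := disk_set.
Definition circle (r : I01) : Type := circle_set r.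

Fact disk0 : disk_set 0. Proof. by rewrite /disk_set /= normr0. Qed.
Fact circle_pt r : circle_set r (set_val r)%:C%C.
Proof.
have /andP[r0 _] := set_valP r.
by rewrite /circle_set /= ger0_norm // lecR.
Qed.
Fact circle_disk r : circle_set r `<=` disk_set.
Proof.
have /andP[_ r1] := set_valP r.
by move=> z; rewrite /circle_set /disk_set /= => ->; rewrite lecR.
Qed.

HB.instance Definition _ := Topological.on disk.
HB.instance Definition _ := isPointed.Build disk (to_set disk0).
HB.instance Definition _ r := Topological.on (circle r).
HB.instance Definition _ r :=
  isPointed.Build (circle r) (to_set (circle_pt r)).

Fact set_val_cts (K : set (cplx R)) : continuous (set_val : K -> cplx R).
Proof. exact: initial_continuous. Qed.

Fact lift_cts (X : topologicalType) (K : set (cplx R)) (f : X -> K) :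
  continuous (set_val \o f) -> continuous f.
Proof. exact: continuous_comp_initial. Qed.

Definition circle_incl r : continuousType (circle r) disk :=
  mkcts (@lift_cts (circle r) disk_set
    (fun z => to_set (@circle_disk r _ (set_valP z)))
    (@set_val_cts (circle_set r))).

Definition circle_coord r : cfun R (circle r) :=
  mkcts (@set_val_cts (circle_set r)).

(* e^{2 i pi t} *)
Definition expi (t : R) : cplx R := (cos (2 * pi * t) +i* sin (2 * pi * t))%C.

Fact norm_expi t : `|expi t| = 1.
Proof. by rewrite normc_def /= cos2Dsin2 sqrtr1. Qed.

Fact disk_rot t z : disk_set z -> disk_set (expi t * z).
Proof. by rewrite /disk_set /= normrM norm_expi mul1r. Qed.
Fact circle_rot r t z : circle_set r z -> circle_set r (expi t * z).
Proof. by rewrite /circle_set /= normrM norm_expi mul1r. Qed.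

Fact rot_cts (K : set (cplx R)) t (HK : forall z, K z -> K (expi t * z)) :
  continuous (fun z : K => to_set (HK _ (set_valP z))).
Proof.
apply: lift_cts => z.
exact: (@cvgM (cplx R) K (nbhs z) _ (cst (expi t)) set_val (expi t)
  (set_val z) (cvg_cst _) (@set_val_cts K z)).
Qed.

Definition rot_disk t : continuousType disk disk :=
  mkcts (@rot_cts disk_set t (@disk_rot t)).
Definition rot_circle r t : continuousType (circle r) (circle r) :=
  mkcts (@rot_cts (circle_set r) t (@circle_rot r t)).

End Spaces.
Arguments I01 : clear implicits.
Arguments oc01 : clear implicits.
Arguments disk_set : clear implicits.

Definition cfun_comp (R : realType) (X Y : ptopologicalType) (f : cfun R Y)
  (phi : continuousType X Y) : cfun R X := f \o phi.

Section Universal.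
Context (R : realType).

Definition unitary (A : starAlgType R) (u : A) :=
  star u * u = 1 /\ u * star u = 1.

Definition covariant (X : ptopologicalType) (phi : continuousType X X)
    (A : cstarAlgType R) (i : cfun R X -> A) (u : A) :=
  [/\ starhom i, unitary u
    & forall f, star u * i f * u = i (cfun_comp f phi)].

(* C(X) x|_phi Z and A_t with their canonical generators, specified by their
   universal properties among unital C*-algebras. *)
Record crossedProduct (X : ptopologicalType) (phi : continuousType X X) :=
  CrossedProduct {
    cp_alg :> cstarAlgType R ;
    cp_fun : cfun R X -> cp_alg ;
    cp_unitary : cp_alg ;
    cp_cov : covariant phi cp_fun cp_unitary ;
    cp_univ : forall (B : cstarAlgType R) (j : cfun R X -> B) (w : B),
      covariant phi j w ->
      exists! h : cp_alg -> B,
        [/\ starhom h, forall f, h (cp_fun f) = j f & h cp_unitary = w] }.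

Definition rotation_pair (t : R) (A : cstarAlgType R) (u v : A) :=
  [/\ unitary u, unitary v & v * u = expi t *: (u * v)].

Record rotationAlgebra (t : R) := RotationAlgebra {
  ra_alg :> cstarAlgType R ;
  ra_U : ra_alg ;
  ra_V : ra_alg ;
  ra_rel : rotation_pair t ra_U ra_V ;
  ra_univ : forall (B : cstarAlgType R) (u v : B), rotation_pair t u v ->
    exists! h : ra_alg -> B, [/\ starhom h, h ra_U = u & h ra_V = v] }.

End Universal.

Section Target.
Context (R : realType) (S : Type).

(* T + S * ]0, 1], to be used with S the spectrum of A_theta. *)
Definition target : Type := (circle (one01 R) + S * oc01 R)%type.

Definition target_set (Y : set (circle (one01 R))) (F : set (oc01 R)) :
    target -> Prop :=
  fun x => match x with inl w => Y w | inr (_, r) => F r end.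

Definition target_closed (T : target -> Prop) :=
  (exists F, closed F /\ T = target_set setT F) \/
  (exists Y X, [/\ closed Y, compact X & T = target_set Y X]).

Fact target_closed0 : target_closed (fun=> False).
Proof.
right; exists set0, set0; split; [exact: closed0|exact: compact0|].
by apply/funext => -[w|[s r]].
Qed.

Fact target_closedT : target_closed (fun=> True).
Proof.
left; exists setT; split; first exact: closedT.
by apply/funext => -[w|[s r]].
Qed.

Fact oc01_hausdorff : hausdorff_space (oc01 R).
Proof.
move=> p q pq; apply: val_inj; apply: (@Rhausdorff R) => U V Up Vq.
have vc : continuous (set_val : oc01 R -> R) by exact: initial_continuous.
have [r [Ur Vr]] := pq _ _ (vc p _ Up) (vc q _ Vq).
by exists (set_val r).
Qed.

Fact target_closedU A B : target_closed A -> target_closed B ->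
  target_closed (fun x => A x \/ B x).
Proof.
have cc X : compact X -> closed X := compact_closed oc01_hausdorff.
move=> [[F [Fc ->]]|[Y [X [Yc Xc ->]]]] [[G [Gc ->]]|[Z [W [Zc Wc ->]]]].
- left; exists (F `|` G); split; first exact: closedU.
  by apply/funext => -[w|[s r]] //=; rewrite propeqE; tauto.
- left; exists (F `|` W); split; first by apply: closedU => //; exact: cc.
  by apply/funext => -[w|[s r]] //=; rewrite propeqE; tauto.
- left; exists (X `|` G); split; first by apply: closedU => //; exact: cc.
  by apply/funext => -[w|[s r]] //=; rewrite propeqE; tauto.
- right; exists (Y `|` Z), (X `|` W); split; [exact: closedU|exact: compactU|].
  by apply/funext => -[w|[s r]] //=; rewrite propeqE; tauto.
Qed.

Fact target_closedI (P : (target -> Prop) -> Prop) :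
  (forall A, P A -> target_closed A) ->
  target_closed (fun x => forall A, P A -> A x).
Proof.
move=> Pcl.
pose form A Y F := [/\ P A, closed Y, closed F & A = target_set Y F].
pose Y0 := [set w | forall A Y F, form A Y F -> Y w].
pose F0 := [set r | forall A Y F, form A Y F -> F r].
have cc X : compact X -> closed X := compact_closed oc01_hausdorff.
have PF A : P A -> exists Y F, form A Y F.
  move=> PA; case: (Pcl A PA) => [[F [Fc AE]]|[Y [X [Yc Xc AE]]]].
    by exists setT, F; split=> //; exact: closedT.
  by exists Y, X; split=> //; exact: (cc X).
have E : (fun x => forall A, P A -> A x) = target_set Y0 F0.
  apply/funext => x; rewrite propeqE; split=> [xP|].
    case: x xP => [w|[s r]] xP A Y F [PA _ _ AE];
      by have := xP A PA; rewrite AE.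
  move=> x0 A PA; have [Y [F AF]] := PF A PA; have [_ _ _ ->] := AF.
  by case: x x0 => [w|[s r]] /(_ _ _ _ AF).
have F0c : closed F0.
  have -> : F0 = \bigcap_(F in [set F | exists A Y, form A Y F]) F.
    apply/seteqP; split=> [r rF F [A [Y AF]]|r rF A Y F AF].
      exact: rF AF.
    by apply: rF; exists A, Y.
  by apply: closed_bigI => F [A [Y []]].
have Y0c : closed Y0.
  have -> : Y0 = \bigcap_(Y in [set Y | exists A F, form A Y F]) Y.
    apply/seteqP; split=> [w wY Y [A [F AF]]|w wY A Y F AF].
      exact: wY AF.
    by apply: wY; exists A, F.
  by apply: closed_bigI => Y [A [F []]].
rewrite E.
have [[A [PA [Y [X [Yc Xc AE]]]]]|nc] := pselect (exists A, P A /\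
    exists Y X, [/\ closed Y, compact X & A = target_set Y X]).
  right; exists Y0, F0; split=> //; apply: (subclosed_compact F0c Xc) => r rF.
  by apply: (rF A Y X); split=> //; exact: (cc X).
left; exists F0; split=> //; rewrite (_ : Y0 = setT) //; apply/seteqP; split=> // w _.
move=> A Y F [PA _ _ AE]; have [[G [_ AG]]|c] := Pcl A PA.
  have : A (inl w) by rewrite AG.
  by rewrite AE.
by case: nc; exists A; split.
Qed.

Definition target_topology : topology target :=
  Topology target_closed0 target_closedT target_closedU target_closedI.

End Target.

(* Main.v *)
Require Import Defs.
From HB Require Import structures.
From mathcomp Require Import all_boot all_order all_algebra.
From mathcomp Require Import all_classical all_reals all_analysis.
From mathcomp Require Import complex ring lra.
Set Implicit Arguments.
Unset Strict Implicit.
Unset Printing Implicit Defensive.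
Import Order.TTheory GRing.Theory Num.Theory.
Import numFieldNormedType.Exports.
Local Open Scope classical_set_scope.
Local Open Scope ring_scope.

(** The crossed product [A] of the disk is a field of C*-algebras over the radii
    [r] in [0, 1], with fibre [Atheta] for [0 < r] and the functions on the circle
    for [r = 0].  The statement describes how these fibres are glued.

    Classification.  Functions of [|z|] are central in [A], so an irreducible
    representation [p] sends them to scalars, given by evaluation at a radius [r]
    ([irrep_radius], from [prime_character]: a product of two functions is killed
    only if a factor is).  A function vanishing on the circle of radius [r] is small
    near it and is killed too ([irrep_vanish]).  Functions on that circle extend to
    the disk, so that the universal property of the crossed product of the circle
    makes [p] factor through the restriction map ([restriction_kernel]).  For this
    the bounded operators on a Hilbert space are made into a C*-algebra.  Over
    [r = 0], irreducible representations of a function algebra are evaluations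
    ([cfun_irrep_eval]).

    Kernels.  For irrational [theta] the algebra [Atheta] is simple
    ([rotationAlgebra_simple]), so that all classes over a positive radius [r] have
    the same kernel, that of the map [radius_hom r] from [A] to [Atheta].  Simplicity
    is a Fejer argument.  Conjugation by the powers of [V] multiplies [U^m V^n] by the
    powers of [e^(2 i pi theta m)], and weighted averages of these conjugates are
    contractive multipliers of the Fourier coefficients ([multiplier_contractive]).
    They give both the Cesaro means, which converge to the element, and the bound of
    a Fourier coefficient by the norm of the image under any *-homomorphism.

    Topology.  The norm of [radius_hom s a] is continuous in [s]: all the fibres are
    identified by scaling the circles, and the universal property of [Atheta] shows
    that the given identifications are compatible with it ([alpha_scale]); this
    replaces the density of polynomials in the function algebras.  When [s] tends to
    [0], the limit is the image of [a] under the fibre over [0], embedded in [Atheta]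
    by sending [z] to [U]; this embedding is faithful, because its kernel is an ideal
    of functions invariant under rotation ([zero_fibre_faithful]).  Hence an element
    killed over a set of radii is killed over its closure, and over the whole circle
    at [r = 0] if the set accumulates at [0] ([target_closed_hk]).  Conversely, tent
    functions of [|z|] and lifts of functions on the circle separate a point from the
    closed sets of the target ([hk_closed_target]).

    Two tools are used throughout.  A closed *-subalgebra containing the generators
    of a universal algebra is the whole of it ([crossedProduct_ind],
    [rotationAlgebra_ind]).  *-homomorphisms are contractive
    ([starhom_contractive]). *)

(** * Norms and *-homomorphisms *)

Section RealNorm.
Context (R : realType).

Definition rnorm (V : normedZmodType (cplx R)) (x : V) : R := complex.Re `|x|.

Lemma rnormE (V : normedZmodType (cplx R)) (x : V) : (rnorm x)%:C%C = `|x|.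
Proof. by rewrite /rnorm RRe_real// ger0_real. Qed.

Lemma rnorm_ge0 (V : normedZmodType (cplx R)) (x : V) : 0 <= rnorm x.
Proof. by rewrite -lecR rnormE; exact: normr_ge0. Qed.

Lemma rnorm_eq0 (V : normedZmodType (cplx R)) (x : V) : rnorm x = 0 -> x = 0.
Proof. by move=> x0; apply/eqP; rewrite -normr_eq0 -rnormE x0. Qed.

Lemma rnorm0 (V : normedZmodType (cplx R)) : rnorm (0 : V) = 0.
Proof. by rewrite /rnorm normr0. Qed.

Lemma rnormD (V : normedZmodType (cplx R)) (x y : V) :
  rnorm (x + y) <= rnorm x + rnorm y.
Proof. by rewrite -lecR rmorphD /= !rnormE ler_normD. Qed.

Lemma rnormN (V : normedZmodType (cplx R)) (x : V) : rnorm (- x) = rnorm x.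
Proof. by rewrite /rnorm normrN. Qed.

Lemma rnormBC (V : normedZmodType (cplx R)) (x y : V) :
  rnorm (x - y) = rnorm (y - x).
Proof. by rewrite /rnorm distrC. Qed.

Lemma rnormZ (V : normedModType (cplx R)) (k : cplx R) (x : V) :
  rnorm (k *: x) = rnorm k * rnorm x.
Proof.
apply: (@complexI R); rewrite rmorphM /= !rnormE; exact: normrZ.
Qed.

Lemma rnormM (k l : cplx R) : rnorm (k * l) = rnorm k * rnorm l.
Proof. by apply: (@complexI R); rewrite rmorphM /= !rnormE; exact: normrM. Qed.

Lemma rnorm1 : rnorm (1 : cplx R) = 1.
Proof. by rewrite /rnorm normr1. Qed.

Lemma rnorm_real (r : R) : rnorm (r%:C%C : cplx R) = `|r|.
Proof.
apply: (@complexI R); rewrite rnormE.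
by rewrite normc_def /= expr0n /= addr0 sqrtr_sqr.
Qed.

Lemma conjC_real (r : R) : (r%:C%C : cplx R)^* = r%:C%C.
Proof. by apply/eqP; rewrite eq_complex /= oppr0 !eqxx. Qed.

Lemma conjC_i : ('i%C : cplx R)^* = - 'i%C.
Proof. by apply/eqP; rewrite eq_complex /= oppr0 !eqxx. Qed.

Lemma rnorm_conj (k : cplx R) : rnorm k^* = rnorm k.
Proof. by rewrite /rnorm norm_conjC. Qed.

Lemma rnorm_unit (k : cplx R) : rnorm k = 1 -> k * k^* = 1.
Proof. by move=> k1; rewrite -normCK -rnormE k1 expr1n. Qed.

End RealNorm.

Section Exp.
Context (R : realType).

Lemma le_of_eps (x y : R) : (forall e, 0 < e -> x <= y + e) -> x <= y.
Proof. by move=> H; apply/ler_addgt0Pr. Qed.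

Lemma expr_small (r e : R) : 0 <= r < 1 -> 0 < e ->
  exists N, forall n, (N <= n)%N -> r ^+ n < e.
Proof.
move=> /andP[r0 r1] e0.
have /cvgrPdist_lt/(_ e e0)[N _ H] := @cvg_expr R r ltac:(by rewrite ger0_norm).
exists N => n Nn; have := H n Nn; rewrite sub0r normrN ger0_norm //.
exact: exprn_ge0.
Qed.
End Exp.

Section StarBasics.
Context (R : realType) (A : starAlgType R).
Implicit Types x y : A.

Lemma star0 : star (0 : A) = 0.
Proof. by have := starZ 0 (0 : A); rewrite scale0r conjC0 scale0r. Qed.
Lemma starN x : star (- x) = - star x.
Proof. by rewrite -scaleN1r starZ rmorphN1 scaleN1r. Qed.
Lemma starB x y : star (x - y) = star x - star y.
Proof. by rewrite starD starN. Qed.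
Lemma star1 : star (1 : A) = 1.
Proof. by have := starM 1 (star (1 : A)); rewrite mul1r starK mul1r. Qed.

Lemma unitary_star (u : A) : unitary u -> unitary (star u).
Proof. by case=> u1 u2; split; rewrite starK. Qed.

Lemma unitaryM (u v : A) : unitary u -> unitary v -> unitary (u * v).
Proof.
move=> [u1 u2] [v1 v2]; split; rewrite starM.
  by rewrite mulrA -[_ * _ * u]mulrA u1 mulr1 v1.
by rewrite mulrA -[u * v * _]mulrA v2 mulr1 u2.
Qed.

Lemma unitary1 : unitary (1 : A).
Proof. by split; rewrite star1 mulr1. Qed.

Lemma unitaryX (u : A) n : unitary u -> unitary (u ^+ n).
Proof.
by move=> uu; elim: n => [|n IH]; [exact: unitary1|rewrite exprS; exact: unitaryM].
Qed.

Lemma unitaryZ (k : cplx R) (u : A) : rnorm k = 1 -> unitary u -> unitary (k *: u).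
Proof.
move=> k1 [u1 u2]; split; rewrite starZ -scalerAl -scalerAr scalerA.
  by rewrite u1 mulrC rnorm_unit // scale1r.
by rewrite u2 rnorm_unit // scale1r.
Qed.
End StarBasics.

Section StarHomBasics.
Context (R : realType) (A B : starAlgType R) (h : A -> B) (hh : starhom h).

Lemma starhomD x y : h (x + y) = h x + h y.
Proof. by case: hh => /(_ 1 x y); rewrite !scale1r. Qed.
Lemma starhom0 : h 0 = 0.
Proof. by apply: (addrI (h 0)); rewrite -starhomD !addr0. Qed.
Lemma starhomZ k x : h (k *: x) = k *: h x.
Proof. by case: hh => /(_ k x 0); rewrite starhom0 !addr0. Qed.
Lemma starhomN x : h (- x) = - h x.
Proof. by rewrite -scaleN1r starhomZ scaleN1r. Qed.
Lemma starhomB x y : h (x - y) = h x - h y.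
Proof. by rewrite starhomD starhomN. Qed.
Lemma starhom1 : h 1 = 1.
Proof. by case: hh => _ []. Qed.
Lemma starhomM x y : h (x * y) = h x * h y.
Proof. by case: hh => _ []. Qed.
Lemma starhomX x n : h (x ^+ n) = h x ^+ n.
Proof.
by elim: n => [|n IH]; rewrite ?expr0 ?starhom1// !exprS starhomM IH.
Qed.
Lemma starhomS x : h (star x) = star (h x).
Proof. by case: hh. Qed.
Lemma starhom_sum (I : Type) (r : seq I) (F : I -> A) :
  h (\sum_(i <- r) F i) = \sum_(i <- r) h (F i).
Proof. exact: (big_morph _ starhomD starhom0). Qed.
Lemma starhom_unitary x : unitary x -> unitary (h x).
Proof. by case=> x1 x2; split; rewrite -starhomS -starhomM ?x1 ?x2 starhom1. Qed.
End StarHomBasics.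

Lemma starhom_comp (R : realType) (A B C : starAlgType R) (g : B -> C)
  (f : A -> B) : starhom g -> starhom f -> starhom (g \o f).
Proof.
move=> gh fh; split=> [k x y|| x] /=; first by rewrite !(starhomD fh, starhomD gh,
    starhomZ fh, starhomZ gh).
- by split=> [|x y] /=; rewrite ?(starhom1 fh) ?(starhom1 gh) ?(starhomM fh)
    ?(starhomM gh).
- by rewrite (starhomS fh) (starhomS gh).
Qed.

Section CStarBasics.
Context (R : realType) (A : cstarAlgType R).
Implicit Types x y : A.

Lemma cnormZr (k : cplx R) x : cnorm (k *: x) = rnorm k * cnorm x.
Proof. by apply: (@complexI R); rewrite cnormZ rmorphM /= rnormE. Qed.

Lemma cnorm0 : cnorm (0 : A) = 0.
Proof. by rewrite -(scale0r (0 : A)) cnormZr rnorm0 mul0r. Qed.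

Lemma cnormN x : cnorm (- x) = cnorm x.
Proof. by rewrite -scaleN1r cnormZr rnormN rnorm1 mul1r. Qed.

Lemma cnormBC x y : cnorm (x - y) = cnorm (y - x).
Proof. by rewrite -cnormN opprB. Qed.

Lemma cnorm_ge0 x : 0 <= cnorm x.
Proof.
have := cnormD x (- x); rewrite subrr cnorm0 cnormN -mulr2n.
by rewrite pmulrn_lge0.
Qed.

Lemma cnormB x y : cnorm (x - y) <= cnorm x + cnorm y.
Proof. by rewrite -(cnormN y) cnormD. Qed.

Lemma cnorm_split y x z : cnorm (x - z) <= cnorm (x - y) + cnorm (y - z).
Proof. by have := cnormD (x - y) (y - z); rewrite addrA subrK. Qed.

Lemma cnorm_sum (I : Type) (r : seq I) (F : I -> A) :
  cnorm (\sum_(i <- r) F i) <= \sum_(i <- r) cnorm (F i).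
Proof.
elim: r => [|i r IH]; first by rewrite !big_nil cnorm0.
by rewrite !big_cons (le_trans (cnormD _ _))// lerD2l.
Qed.

Lemma cnorm_small0 x : (forall e, 0 < e -> cnorm x <= e) -> x = 0.
Proof.
move=> H; apply: cnorm_eq0; apply/eqP; rewrite eq_le cnorm_ge0 andbT.
by apply: le_of_eps => e e0; rewrite add0r; exact: H.
Qed.

Lemma cnormS x : cnorm (star x) = cnorm x.
Proof.
suff H y : cnorm y <= cnorm (star y).
  by apply/eqP; rewrite eq_le H andbT -[in X in _ <= X](starK x) H.
have [y0|y0] := eqVneq (cnorm y) 0; first by rewrite y0 cnorm_ge0.
have yp : 0 < cnorm y by rewrite lt_def y0 cnorm_ge0.
rewrite -(ler_pM2r yp) -expr2 -cnorm_star; exact: cnormM.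
Qed.

Lemma cnorm1 : cnorm (1 : A) = 1.
Proof.
have := cnorm_star (1 : A); rewrite star1 mulr1 expr2 => /eqP.
rewrite -subr_eq0 -{1}[cnorm 1]mulr1 -mulrBr mulf_eq0 subr_eq0 =>
    /orP[/eqP/cnorm_eq0/eqP|/eqP//].
by rewrite oner_eq0.
Qed.

Lemma cnorm_unitary (u : A) : unitary u -> cnorm u = 1.
Proof.
move=> [u1 _]; have := cnorm_star u; rewrite u1 cnorm1 => /esym/eqP.
rewrite sqrf_eq1 => /orP[/eqP//|/eqP uN].
by have := cnorm_ge0 u; rewrite uN lerNr oppr0 ler10.
Qed.

Lemma cnorm_unitaryl (u x : A) : unitary u -> cnorm (u * x) = cnorm x.
Proof.
move=> uu; apply/eqP; rewrite eq_le; apply/andP; split.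
  by rewrite (le_trans (cnormM _ _))// cnorm_unitary// mul1r.
have {1}-> : x = star u * (u * x) by rewrite mulrA uu.1 mul1r.
rewrite (le_trans (cnormM _ _))// cnorm_unitary ?mul1r//.
exact: unitary_star.
Qed.

Lemma cnorm_unitaryr (u x : A) : unitary u -> cnorm (x * u) = cnorm x.
Proof.
move=> uu; rewrite -cnormS starM cnorm_unitaryl ?cnormS//.
exact: unitary_star.
Qed.

(** Limits of sequences, in the epsilon form in which completeness is stated. *)
Definition clim (u : nat -> A) (l : A) :=
  forall e, 0 < e -> exists N, forall n, (N <= n)%N -> cnorm (u n - l) < e.

Lemma cauchy_clim (u : nat -> A) :
  (forall e, 0 < e -> exists N, forall m n, (N <= m)%N -> (N <= n)%N ->
       cnorm (u m - u n) < e) -> exists l, clim u l.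
Proof.
move=> /cnorm_complete[l ul]; exists l => e e0.
have /cvgrPdist_lt/(_ e e0)[N _ H] := ul.
by exists N => n Nn; have := H n Nn; rewrite sub0r normrN ger0_norm ?cnorm_ge0.
Qed.

Lemma clim_uniq (u : nat -> A) l l' : clim u l -> clim u l' -> l = l'.
Proof.
move=> ul ul'; apply/eqP; rewrite -subr_eq0; apply/eqP/cnorm_small0 => e e0.
have e2 : 0 < e / 2 by rewrite divr_gt0.
have [N HN] := ul _ e2; have [M HM] := ul' _ e2.
have := HN _ (leq_maxl N M); have := HM _ (leq_maxr N M).
have := cnorm_split (u (maxn N M)) l l'; rewrite (cnormBC l (u _)); lra.
Qed.

Lemma clim_le (u : nat -> A) l x M : clim u l ->
  (forall n, cnorm (x - u n) <= M) -> cnorm (x - l) <= M.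
Proof.
move=> ul uM; apply: le_of_eps => e e0; have [N HN] := ul _ e0.
have := HN _ (leqnn N); have := uM N; have := cnorm_split (u N) x l; lra.
Qed.
End CStarBasics.

(** * Square roots and contractivity *)

Section SquareRoot.
Context (R : realType) (A : cstarAlgType R) (t : A).
Context (t1 : cnorm t < 1).

Local Notation half := ((2^-1)%:C%C : cplx R).

Fixpoint sqrt_iter n : A :=
  if n is n'.+1 then half *: (t + sqrt_iter n' * sqrt_iter n') else 0.

Local Notation w := sqrt_iter.

Lemma half_norm (x : A) : cnorm (half *: x) = cnorm x / 2.
Proof. by rewrite cnormZr rnorm_real ger0_norm ?invr_ge0// mulrC. Qed.

Lemma half_double (x : A) : half *: (x + x) = x.
Proof.
rewrite scalerDr -scalerDl -[X in X *: _](rmorphD (@real_complex R)) /=.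
have -> : 2^-1 + 2^-1 = 1 :> R by field.
exact: scale1r.
Qed.

Lemma sqrt_iter_comm z n : z * t = t * z -> z * w n = w n * z.
Proof.
move=> zt; elim: n => [|n IH] /=; first by rewrite mulr0 mul0r.
by rewrite -scalerAr -scalerAl mulrDr mulrDl zt mulrA IH -mulrA IH mulrA.
Qed.

Lemma sqrt_iter_comm2 n m : w n * w m = w m * w n.
Proof. by apply: sqrt_iter_comm; symmetry; exact: sqrt_iter_comm. Qed.

Lemma sqrt_iter_star n : star t = t -> star (w n) = w n.
Proof.
move=> tS; elim: n => [|n IH] /=; first exact: star0.
rewrite starZ starD starM IH tS; by rewrite conjC_real.
Qed.

Lemma sqrt_iter_norm n : cnorm (w n) <= cnorm t.
Proof.
have t0 := cnorm_ge0 t.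
elim: n => [|n IH] /=; first by rewrite cnorm0.
rewrite half_norm ler_pdivrMr//.
have w0 := cnorm_ge0 (w n).
have w1 : cnorm (w n) <= 1 by have := t1; lra.
have : cnorm (w n) * cnorm (w n) <= cnorm t by nra.
have := cnormD t (w n * w n); have := cnormM (w n) (w n); lra.
Qed.

Lemma sqrt_iter_cauchy n k : cnorm (w (n + k) - w n) <= cnorm t ^+ n.
Proof.
have t0 := cnorm_ge0 t.
elim: n => [|n IH].
  by rewrite subr0 expr0 (le_trans (sqrt_iter_norm _))// ltW.
rewrite addSn /= -scalerBr half_norm ler_pdivrMr// opprD addrACA subrr add0r.
have -> : w (n + k) * w (n + k) - w n * w n =
    (w (n + k) - w n) * (w (n + k) + w n).
  rewrite mulrDr !mulrBl (sqrt_iter_comm2 n (n + k)) addrA subrK.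
  by [].
rewrite (le_trans (cnormM _ _))// exprS mulrAC mulrC.
apply: ler_pM; rewrite ?cnorm_ge0//.
rewrite mulr_natr mulr2n (le_trans (cnormD _ _))//.
by apply: lerD; exact: sqrt_iter_norm.
Qed.

(** The binomial series of [sqrt (1 - t)] is replaced by the fixed point [w] of
    [w |-> (t + w^2) / 2], which is a contraction of the ball of radius [|t|]
    on elements commuting with each other: then [(1 - w)^2 = 1 - t]. *)
Lemma sqrt_one_minus : star t = t ->
  exists y, [/\ star y = y, y * y = 1 - t
    & forall z, z * t = t * z -> z * y = y * z].
Proof.
move=> tS; have t0 := cnorm_ge0 t.
have t01 : 0 <= cnorm t < 1 by apply/andP.
have [l wl] : exists l, clim w l.
  apply: cauchy_clim => e e0.
  have [N HN] := expr_small t01 (divr_gt0 e0 (ltr0n _ 2)).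
  exists N => m n Nm Nn.
  have := sqrt_iter_cauchy N (m - N); have := sqrt_iter_cauchy N (n - N).
  rewrite !subnKC//; have := HN _ (leqnn N).
  have := cnorm_split (w N) (w m) (w n); rewrite (cnormBC (w N) (w n)).
  by move: (cnorm t ^+ N) => b; lra.
have lt k : cnorm (w k - l) <= cnorm t ^+ k.
  apply: (clim_le (u := fun n => w (k + n))) => [e /wl[N HN]|n].
    by exists N => n Nn; apply: HN; exact: leq_trans (leq_addl _ _).
  by rewrite cnormBC sqrt_iter_cauchy.
have small (x : A) (M : R) : 0 < M -> (forall n, cnorm x <= M * cnorm t ^+ n) -> x = 0.
  move=> M0 H; apply: cnorm_small0 => e e0.
  have [N /(_ _ (leqnn N)) HN] := expr_small t01 (divr_gt0 e0 M0).
  apply: (le_trans (H N)); rewrite ltr_pdivlMr// mulrC in HN; exact: ltW.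
have l1 : cnorm l <= 1.
  have := lt 0; rewrite /= sub0r cnormN expr0; exact.
have lS : star l = l.
  apply/eqP; rewrite -subr_eq0; apply/eqP/(small _ 2) => // n.
  have -> : star l - l = (w n - l) - star (w n - l).
    by rewrite starB sqrt_iter_star// opprB [RHS]addrC addrA subrK.
  have := cnormB (w n - l) (star (w n - l)); rewrite cnormS; have := lt n; lra.
have lcomm z : z * t = t * z -> z * l = l * z.
  move=> zt; apply/eqP; rewrite -subr_eq0; apply/eqP/(small _ (2 * cnorm z + 1)) =>
      [|n].
    by have := cnorm_ge0 z; lra.
  have -> : z * l - l * z = (w n - l) * z - z * (w n - l).
    by rewrite mulrBl mulrBr (sqrt_iter_comm n zt) opprB [RHS]addrC addrA subrK.
  apply: (le_trans (cnormB _ _)).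
  have := cnormM (w n - l) z; have := cnormM z (w n - l).
  have := lt n; have := cnorm_ge0 z; have := exprn_ge0 n t0.
  have := cnorm_ge0 (w n - l); nra.
have lE : l = half *: (t + l * l).
  apply/eqP; rewrite -subr_eq0; apply/eqP/(small _ 3) => // n.
  have -> : l - half *: (t + l * l) =
      half *: ((w n - l) * w n + l * (w n - l)) - (w n.+1 - l).
    rewrite /= mulrBl mulrBr addrA subrK opprB addrCA -scalerBr -scalerN.
    by congr (_ + _ *: _); rewrite !opprD [RHS]addrC addrA subrK.
  apply: (le_trans (cnormB _ _)); rewrite half_norm.
  have := cnormD ((w n - l) * w n) (l * (w n - l)).
  have := cnormM (w n - l) (w n); have := cnormM l (w n - l).
  have := lt n; have := lt n.+1; rewrite exprS; have := exprn_ge0 n t0.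
  have := sqrt_iter_norm n; have := cnorm_ge0 (w n - l); have := cnorm_ge0 (w n).
  set a := cnorm (w n - l); set b := cnorm t ^+ n; set c := cnorm (w n).
  set d := cnorm l in l1 *.
  move=> c0 a0 ct b0 S1 ab M1 M2 D.
  have : a * c <= b by nra.
  have : d * a <= b by nra.
  have : cnorm t * b <= b by nra.
  lra.
exists (1 - l); split.
- by rewrite starB star1 lS.
- rewrite mulrBl mul1r mulrBr mulr1.
  have lE2 : l + l = t + l * l by rewrite -[RHS]half_double scalerDr -lE.
  apply/eqP; rewrite -subr_eq0; apply/eqP.
  have -> : 1 - l - (l - l * l) - (1 - t) = (t + l * l) - (l + l).
    by rewrite !opprB [LHS]addrC addrA [t - 1 + _]addrA subrK addrACA -opprD.
  by rewrite -lE2 subrr.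
- by move=> z zt; rewrite mulrBl mulrBr mul1r mulr1 lcomm.
Qed.

End SquareRoot.

Section Contractive.
Context (R : realType).

(** Here [x + i y] is unitary, hence so is its image, and [h x] is the real part
    of that image. *)
Lemma starhom_real_part (A : starAlgType R) (B : cstarAlgType R) (h : A -> B)
    (hh : starhom h) (x y : A) :
  star x = x -> star y = y -> x * y = y * x -> x * x + y * y = 1 ->
  cnorm (h x) <= 1.
Proof.
move=> xS yS xy xy1.
pose u : A := x + ('i%C : cplx R) *: y.
have ii : ('i%C : cplx R) * 'i%C = -1 by rewrite -expr2; exact: sqr_i.
have uS : star u = x - ('i%C : cplx R) *: y.
  by rewrite starD starZ xS yS conjC_i scaleNr.
have uu : unitary u.
  split; rewrite uS /u !(mulrBl, mulrDl, mulrDr, mulrBr, mulrN) -!(scalerAr,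
      scalerAl) ?scalerN !scalerA ii.
    by rewrite scaleN1r opprD opprK xy addrA [x * x + _ - _]addrK xy1.
  by rewrite scaleN1r opprK xy addrA subrK xy1.
have -> : h x = (2^-1)%:C%C *: (h u + star (h u)).
  rewrite -(starhomS hh) -(starhomD hh) uS /u addrACA subrr addr0.
  by rewrite (starhomD hh) half_double.
rewrite half_norm ler_pdivrMr// mul1r (le_trans (cnormD _ _))//.
by rewrite cnormS cnorm_unitary//; exact: starhom_unitary.
Qed.

(** After scaling, [x = a* a] has norm less than [1], so that [1 - x^2] has a
    self-adjoint square root commuting with [x].  No spectral theory enters. *)
Lemma starhom_contractive (A B : cstarAlgType R) (h : A -> B) (hh : starhom h)
  (a : A) : cnorm (h a) <= cnorm a.
Proof.
suff H c : cnorm a ^+ 2 < c -> cnorm (h a) ^+ 2 <= c.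
  rewrite -(ler_pXn2r (ltn0Sn 1)) ?nnegrE ?cnorm_ge0//.
  by apply: le_of_eps => e e0; apply: H; rewrite ltrDl.
move=> ac; have c0 : 0 < c by apply: le_lt_trans ac; exact: sqr_ge0.
pose x := (c^-1)%:C%C *: (star a * a) : A.
have xS : star x = x.
  by rewrite starZ starM starK conjC_real.
have xN : cnorm x < 1.
  rewrite cnormZr rnorm_real ger0_norm ?invr_ge0 ?ltW// cnorm_star.
  by rewrite mulrC ltr_pdivrMr// mul1r.
have xxS : star (x * x) = x * x by rewrite starM xS.
have xxN : cnorm (x * x) < 1.
  by have := cnormM x x; have := cnorm_ge0 x; nra.
have [y [yS yy yc]] := sqrt_one_minus xxN xxS.
have := starhom_real_part hh xS yS (yc x (mulrA _ _ _)) _.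
rewrite yy addrC subrK => /(_ erefl).
rewrite (starhomZ hh) (starhomM hh) (starhomS hh) cnormZr cnorm_star.
rewrite rnorm_real ger0_norm ?invr_ge0; last exact: ltW.
by rewrite mulrC ler_pdivrMr// mul1r.
Qed.

End Contractive.

(** * Closed *-subalgebras *)

Definition closed_star_subalgebra (R : realType) (A : cstarAlgType R)
    (P : set A) :=
  [/\ P 1,
      forall (k : cplx R) x y, P x -> P y -> P (k *: x + y),
      forall x y, P x -> P y -> P (x * y),
      forall x, P x -> P (star x)
    & forall x, (forall e, 0 < e -> exists2 y, P y & cnorm (x - y) < e) -> P x].

Section SubCStar.
Context (R : realType) (A : cstarAlgType R) (P : set A).
Context (PP : closed_star_subalgebra P).

(** [PP] is an argument so that the structures below can be found by
    unification. *)
Definition sub_cstar of closed_star_subalgebra P : Type := P.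
Local Notation S := (sub_cstar PP).

HB.instance Definition _ := Choice.on S.

Implicit Types x y z : S.
Local Notation v := (set_val : S -> A).

Lemma sub_cstar_val x : P (v x). Proof. exact: set_valP. Qed.

Definition sub_cstar_mk (a : A) (Pa : P a) : S := to_set Pa.

Lemma sub_cstar_inj x y : v x = v y -> x = y. Proof. exact: val_inj. Qed.

Fact sub_cstar_P0 : P 0.
Proof.
by have [P1 PL _ _ _] := PP; have := PL (-1) _ _ P1 P1; rewrite scaleN1r addNr.
Qed.
Fact sub_cstar_PD a b : P a -> P b -> P (a + b).
Proof. by have [_ PL _ _ _] := PP => *; rewrite -[a]scale1r; exact: PL. Qed.
Fact sub_cstar_PZ k a : P a -> P (k *: a).
Proof.
have [_ PL _ _ _] := PP => *; rewrite -[_ *: _]addr0.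
by apply: PL => //; exact: sub_cstar_P0.
Qed.
Fact sub_cstar_PN a : P a -> P (- a).
Proof. by rewrite -scaleN1r; exact: sub_cstar_PZ. Qed.
Fact sub_cstar_P1 : P 1. Proof. by case: PP. Qed.
Fact sub_cstar_PM a b : P a -> P b -> P (a * b).
Proof. by have [_ _ + _ _] := PP; apply. Qed.
Fact sub_cstar_PS a : P a -> P (star a).
Proof. by have [_ _ _ + _] := PP; apply. Qed.

Let zero : S := sub_cstar_mk sub_cstar_P0.
Let one : S := sub_cstar_mk sub_cstar_P1.
Let add x y : S := sub_cstar_mk (sub_cstar_PD (sub_cstar_val x) (sub_cstar_val y)).
Let opp x : S := sub_cstar_mk (sub_cstar_PN (sub_cstar_val x)).
Let mul x y : S := sub_cstar_mk (sub_cstar_PM (sub_cstar_val x) (sub_cstar_val y)).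
Let scl k x : S := sub_cstar_mk (sub_cstar_PZ k (sub_cstar_val x)).
Let str x : S := sub_cstar_mk (sub_cstar_PS (sub_cstar_val x)).
Let nrm x : R := cnorm (v x).

Fact sub_addA : associative add.
Proof. by move=> x y z; apply: sub_cstar_inj; exact: addrA. Qed.
Fact sub_addC : commutative add.
Proof. by move=> x y; apply: sub_cstar_inj; exact: addrC. Qed.
Fact sub_add0 : left_id zero add.
Proof. by move=> x; apply: sub_cstar_inj; exact: add0r. Qed.
Fact sub_addN : left_inverse zero opp add.
Proof. by move=> x; apply: sub_cstar_inj; exact: addNr. Qed.
HB.instance Definition _ :=
  GRing.isZmodule.Build S sub_addA sub_addC sub_add0 sub_addN.

Fact sub_mulA : associative mul.
Proof. by move=> x y z; apply: sub_cstar_inj; exact: mulrA. Qed.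
Fact sub_mul1 : left_id one mul.
Proof. by move=> x; apply: sub_cstar_inj; exact: mul1r. Qed.
Fact sub_mulr1 : right_id one mul.
Proof. by move=> x; apply: sub_cstar_inj; exact: mulr1. Qed.
Fact sub_mulDl : left_distributive mul +%R.
Proof. by move=> x y z; apply: sub_cstar_inj; exact: mulrDl. Qed.
Fact sub_mulDr : right_distributive mul +%R.
Proof. by move=> x y z; apply: sub_cstar_inj; exact: mulrDr. Qed.
Fact sub_1neq0 : one != 0.
Proof.
apply/eqP => /(congr1 v) /= /eqP; rewrite [X in X == _](_ : _ = 1)//.
by rewrite [X in _ == X](_ : _ = 0)// oner_eq0.
Qed.
HB.instance Definition _ := GRing.Zmodule_isNzRing.Build S
  sub_mulA sub_mul1 sub_mulr1 sub_mulDl sub_mulDr sub_1neq0.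

Fact sub_sclA k l x : scl k (scl l x) = scl (k * l) x.
Proof. by apply: sub_cstar_inj; exact: scalerA. Qed.
Fact sub_scl1 : left_id 1 scl.
Proof. by move=> x; apply: sub_cstar_inj; exact: scale1r. Qed.
Fact sub_sclDr : right_distributive scl +%R.
Proof. by move=> k x y; apply: sub_cstar_inj; exact: scalerDr. Qed.
Fact sub_sclDl x : {morph scl^~ x : k l / k + l}.
Proof. by move=> k l; apply: sub_cstar_inj; exact: scalerDl. Qed.
HB.instance Definition _ := GRing.Zmodule_isLmodule.Build (cplx R) S
  sub_sclA sub_scl1 sub_sclDr sub_sclDl.

Fact sub_sclAl (k : cplx R) x y : k *: (x * y) = k *: x * y.
Proof. by apply: sub_cstar_inj; exact: scalerAl. Qed.
HB.instance Definition _ :=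
  GRing.Lmodule_isLalgebra.Build (cplx R) S sub_sclAl.
Fact sub_sclAr (k : cplx R) x y : k *: (x * y) = x * (k *: y).
Proof. by apply: sub_cstar_inj; exact: scalerAr. Qed.
HB.instance Definition _ :=
  GRing.Lalgebra_isAlgebra.Build (cplx R) S sub_sclAr.

Fact sub_strD x y : str (x + y) = str x + str y.
Proof. by apply: sub_cstar_inj; exact: starD. Qed.
Fact sub_strZ (k : cplx R) x : str (k *: x) = k^* *: str x.
Proof. by apply: sub_cstar_inj; exact: starZ. Qed.
Fact sub_strM x y : str (x * y) = str y * str x.
Proof. by apply: sub_cstar_inj; exact: starM. Qed.
Fact sub_strK : involutive str.
Proof. by move=> x; apply: sub_cstar_inj; exact: starK. Qed.
HB.instance Definition _ :=
  isStarAlgebra.Build R S sub_strD sub_strZ sub_strM sub_strK.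

Fact sub_nrm0 x : nrm x = 0 -> x = 0.
Proof. by move=> /cnorm_eq0 x0; apply: sub_cstar_inj; exact: x0. Qed.
Fact sub_nrmD x y : nrm (x + y) <= nrm x + nrm y.
Proof. exact: cnormD. Qed.
Fact sub_nrmZ (k : cplx R) x :
  (nrm (k *: x))%:C%C = `|k| * (nrm x)%:C%C :> cplx R.
Proof. exact: cnormZ. Qed.
Fact sub_nrmM x y : nrm (x * y) <= nrm x * nrm y.
Proof. exact: cnormM. Qed.
Fact sub_nrm_star x : nrm (star x * x) = nrm x ^+ 2.
Proof. exact: cnorm_star. Qed.
Fact sub_nrm_complete (u : nat -> S) :
  (forall e, 0 < e -> exists N, forall m n, (N <= m)%N -> (N <= n)%N ->
       nrm (u m - u n) < e) ->
  exists l, (fun n => nrm (u n - l)) @ \oo --> 0.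
Proof.
move=> uc; have [l ul] := cnorm_complete (v \o u) uc.
have Pl : P l.
  have [_ _ _ _] := PP; apply => e e0.
  have /cvgrPdist_lt/(_ e e0)[N _ H] := ul.
  exists (v (u N)); first exact: sub_cstar_val.
  have := H N (leqnn N); rewrite sub0r normrN ger0_norm ?cnorm_ge0//.
  by rewrite cnormBC.
by exists (sub_cstar_mk Pl).
Qed.
HB.instance Definition _ := isCStarAlgebra.Build R S
  sub_nrm0 sub_nrmD sub_nrmZ sub_nrmM sub_nrm_star sub_nrm_complete.

Lemma sub_cstar_unitary x : unitary (v x) -> unitary x.
Proof. by case=> x1 x2; split; apply: sub_cstar_inj. Qed.

End SubCStar.

Section Generation.
Context (R : realType).

(** The universal property, applied to the C*-algebra [P], retracts the crossed
    product onto [P]; the retraction is the identity by uniqueness. *)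
Lemma crossedProduct_ind (X : ptopologicalType) (phi : continuousType X X)
    (A : crossedProduct R phi) (P : set A) :
  closed_star_subalgebra P -> (forall f, P (cp_fun A f)) -> P (cp_unitary A) ->
  forall a, P a.
Proof.
move=> PP Pf Pu a.
have [iS uU cov] := cp_cov A.
pose j f : sub_cstar PP := sub_cstar_mk PP (Pf f).
pose w : sub_cstar PP := sub_cstar_mk PP Pu.
have jw : covariant phi j w.
  split=> [||f]; last by apply: sub_cstar_inj; exact: cov.
    split=> [k f g||f]; first by apply: sub_cstar_inj; case: iS => + _ _; apply.
      by split=> [|f g]; apply: sub_cstar_inj; [exact: starhom1|exact: starhomM].
    by apply: sub_cstar_inj; exact: starhomS.
  exact: sub_cstar_unitary.
have [h [[hS hf hu] _]] := cp_univ A jw.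
have [g [_ gU]] := cp_univ A (cp_cov A).
have : g = (set_val : sub_cstar PP -> A) \o h.
  apply: gU; split=> [|f|] /=; rewrite ?hf ?hu//.
  exact: starhom_comp.
rewrite (gU id)//.
by move=> /(congr1 (fun k : A -> A => k a)) /= ->; exact: sub_cstar_val.
Qed.

Lemma rotationAlgebra_ind (t : R) (A : rotationAlgebra t) (P : set A) :
  closed_star_subalgebra P -> P (ra_U A) -> P (ra_V A) -> forall a, P a.
Proof.
move=> PP PU PV a; have [U1 V1 VU] := ra_rel A.
pose u : sub_cstar PP := sub_cstar_mk PP PU.
pose w : sub_cstar PP := sub_cstar_mk PP PV.
have uw : rotation_pair t u w.
  by split; [exact: sub_cstar_unitary..|apply: sub_cstar_inj].
have [h [[hS hf hu] _]] := ra_univ A uw.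
have [g [_ gU]] := ra_univ A (ra_rel A).
have : g = (set_val : sub_cstar PP -> A) \o h.
  apply: gU; split=> /=; rewrite ?hf ?hu//.
  exact: starhom_comp.
rewrite (gU id)//.
by move=> /(congr1 (fun k : A -> A => k a)) /= ->; exact: sub_cstar_val.
Qed.

End Generation.

Section HomExt.
Context (R : realType).

Lemma covariant_comp (X : ptopologicalType) (phi : continuousType X X)
    (A B : cstarAlgType R) (j : cfun R X -> A) (u : A) (h : A -> B) :
  covariant phi j u -> starhom h -> covariant phi (h \o j) (h u).
Proof.
move=> [jh uu ju] hh; split=> [||f /=]; [exact: starhom_comp|exact: starhom_unitary|].
by rewrite -ju !(starhomM hh) (starhomS hh).
Qed.

(** Both maps are the one that the universal property attaches to the same
    covariant pair. *)
Lemma crossedProduct_ext (X : ptopologicalType) (phi : continuousType X X)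
    (A : crossedProduct R phi) (B : cstarAlgType R) (h1 h2 : A -> B) :
  starhom h1 -> starhom h2 -> (forall f, h1 (cp_fun A f) = h2 (cp_fun A f)) ->
  h1 (cp_unitary A) = h2 (cp_unitary A) -> forall a, h1 a = h2 a.
Proof.
move=> H1 H2 Hf Hu a.
have [h [_ hU]] := cp_univ A (covariant_comp (cp_cov A) H1).
by rewrite -(hU h1)// -(hU h2)//; split=> // f /=; rewrite -Hf.
Qed.

Lemma rotation_pair_comp (t : R) (A B : cstarAlgType R) (u v : A) (h : A -> B) :
  rotation_pair t u v -> starhom h -> rotation_pair t (h u) (h v).
Proof.
move=> [uu vv uv] hh; split; [exact: starhom_unitary..|].
by rewrite -(starhomM hh) uv (starhomZ hh) (starhomM hh).
Qed.

Lemma rotationAlgebra_ext (t : R) (A : rotationAlgebra t) (B : cstarAlgType R)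
    (h1 h2 : A -> B) :
  starhom h1 -> starhom h2 -> h1 (ra_U A) = h2 (ra_U A) ->
  h1 (ra_V A) = h2 (ra_V A) -> forall a, h1 a = h2 a.
Proof.
move=> H1 H2 HU HV a.
have [h [_ hU]] := ra_univ A (rotation_pair_comp (ra_rel A) H1).
by rewrite -(hU h1)// -(hU h2).
Qed.
End HomExt.

Lemma closure_star_subalgebra (R : realType) (A : cstarAlgType R) (Q : set A) :
  Q 1 -> (forall (k : cplx R) x y, Q x -> Q y -> Q (k *: x + y)) ->
  (forall x y, Q x -> Q y -> Q (x * y)) -> (forall x, Q x -> Q (star x)) ->
  closed_star_subalgebra
    [set a | forall e, 0 < e -> exists2 q, Q q & cnorm (a - q) < e].
Proof.
move=> Q1 QL QM QS; split=> /=.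
- by move=> e e0; exists 1; rewrite // subrr cnorm0.
- move=> k x y Qx Qy e e0.
  have k1 : 0 < rnorm k + 1 by have := rnorm_ge0 k; lra.
  have [x' Qx' xx'] := Qx _ (divr_gt0 (divr_gt0 e0 (ltr0n _ 2)) k1).
  have [y' Qy' yy'] := Qy _ (divr_gt0 e0 (ltr0n _ 2)).
  exists (k *: x' + y'); first exact: QL.
  have -> : k *: x + y - (k *: x' + y') = k *: (x - x') + (y - y').
    by rewrite scalerBr opprD addrACA.
  apply: (le_lt_trans (cnormD _ _)); rewrite cnormZr.
  move: xx'; rewrite ltr_pdivlMr//; have := cnorm_ge0 (x - x'); nra.
- move=> x y Qx Qy e e0.
  have y1 : 0 < cnorm y + 1 by have := cnorm_ge0 y; lra.
  have [x' Qx' xx'] := Qx _ (divr_gt0 (divr_gt0 e0 (ltr0n _ 2)) y1).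
  have x1 : 0 < cnorm x' + 1 by have := cnorm_ge0 x'; lra.
  have [y' Qy' yy'] := Qy _ (divr_gt0 (divr_gt0 e0 (ltr0n _ 2)) x1).
  exists (x' * y'); first exact: QM.
  have -> : x * y - x' * y' = (x - x') * y + x' * (y - y').
    by rewrite mulrBl mulrBr addrA subrK.
  apply: (le_lt_trans (cnormD _ _)).
  have := cnormM (x - x') y; have := cnormM x' (y - y').
  move: xx' yy'; rewrite !ltr_pdivlMr//.
  have := cnorm_ge0 (x - x'); have := cnorm_ge0 (y - y'); nra.
- move=> x Qx e /Qx[x' Qx' xx']; exists (star x'); first exact: QS.
  by rewrite -starB cnormS.
- move=> x Qx e e0.
  have [y Qy xy] := Qx _ (divr_gt0 e0 (ltr0n _ 2)).
  have [z Qz yz] := Qy _ (divr_gt0 e0 (ltr0n _ 2)).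
  by exists z => //; have := cnorm_split y x z; lra.
Qed.

(** * Operators on a Hilbert space *)

Section HilbertBasics.
Context (R : realType) (H : hilbertType R).
Implicit Types x y z : H.

Lemma dotDl x y z : dot (x + y) z = dot x z + dot y z.
Proof. by have := dotP 1 x y z; rewrite scale1r mul1r. Qed.
Lemma dot0l z : dot (0 : H) z = 0.
Proof. by apply: (addrI (dot 0 z)); rewrite -dotDl !addr0. Qed.
Lemma dotZl (k : cplx R) x z : dot (k *: x) z = k * dot x z.
Proof. by have := dotP k x 0 z; rewrite dot0l !addr0. Qed.
Lemma dotNl x z : dot (- x) z = - dot x z.
Proof. by rewrite -scaleN1r dotZl mulN1r. Qed.
Lemma dotBl x y z : dot (x - y) z = dot x z - dot y z.
Proof. by rewrite dotDl dotNl. Qed.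
Lemma dotDr z x y : dot z (x + y) = dot z x + dot z y.
Proof. by rewrite (dotC (x + y)) dotDl rmorphD (dotC x) (dotC y). Qed.
Lemma dotZr z (k : cplx R) x : dot z (k *: x) = k^* * dot z x.
Proof. by rewrite (dotC (_ *: _)) dotZl rmorphM (dotC x). Qed.
Lemma dotNr z x : dot z (- x) = - dot z x.
Proof. by rewrite (dotC (- x)) dotNl rmorphN (dotC x). Qed.
Lemma dotBr z x y : dot z (x - y) = dot z x - dot z y.
Proof. by rewrite dotDr dotNr. Qed.
Lemma dot0r z : dot z (0 : H) = 0.
Proof. by rewrite (dotC 0) dot0l conjC0. Qed.

Lemma dot_rnorm x : dot x x = (rnorm x ^+ 2)%:C%C.
Proof. by rewrite dot_norm -rnormE rmorphXn. Qed.

Lemma dot_inj x : (forall z, dot z x = 0) -> x = 0.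
Proof.
move=> /(_ x); rewrite dot_norm => /eqP; rewrite expf_eq0 /= => /eqP x0.
by apply/eqP; rewrite -normr_eq0 x0.
Qed.

Lemma cauchy_schwarz x y : rnorm (dot x y) <= rnorm x * rnorm y.
Proof.
have [->|y0] := eqVneq y 0; first by rewrite dot0r !rnorm0 mulr0.
have ny : 0 < `|y| by rewrite normr_gt0.
rewrite -lecR rmorphM /= !rnormE.
rewrite -(@ler_pXn2r _ 2) ?nnegrE ?mulr_ge0 ?normr_ge0//.
pose n := dot y y; have nE : n = `|y| ^+ 2 by exact: dot_norm.
have n0 : 0 < n by rewrite nE exprn_gt0.
pose d := dot x y.
have dnC : (d / n)^* = d^* / n.
  rewrite rmorphM; congr (_ * _); apply: conj_Creal.
  by apply: gtr0_real; rewrite invr_gt0.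
have : 0 <= dot (x - (d / n) *: y) (x - (d / n) *: y) by rewrite dot_norm exprn_ge0.
rewrite dotBl dotZl !dotBr !dotZr -/d -/n (dotC x y) -/d.
rewrite dnC -[X in _ - _ * X](_ : 0 = _); last first.
  by rewrite mulfVK ?subrr// gt_eqF.
rewrite mulr0 subr0 subr_ge0 mulrAC ler_pdivrMr//.
by rewrite mulrC -normCK dot_norm nE exprMn.
Qed.

(** The norm of [H] takes its values in [cplx R]; here epsilon is real. *)
Definition hlim (u : nat -> H) (l : H) :=
  forall e : R, 0 < e -> exists N, forall n, (N <= n)%N -> rnorm (u n - l) < e.

Lemma cauchy_hlim (u : nat -> H) :
  (forall e : R, 0 < e -> exists N, forall m n, (N <= m)%N -> (N <= n)%N ->
       rnorm (u m - u n) < e) -> exists l, hlim u l.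
Proof.
move=> uc; have : cvg (u @ \oo).
  apply: cauchy_cvg; apply/cauchyP => e e0.
  have eE : (complex.Re e)%:C%C = e by apply: RRe_real; exact: gtr0_real.
  have e0' : 0 < complex.Re e by rewrite -ltcR eE.
  have [N HN] := uc _ e0'; exists (u N); exists N => // n /= Nn.
  by rewrite -ball_normE /= -eE -rnormE ltcR; apply: HN.
move=> /cvg_ex[l ul]; exists l => e e0.
have e0C : 0 < e%:C%C :> cplx R by rewrite ltcR.
move/cvgrPdist_lt/(_ _ e0C) : ul => [N _ HN]; exists N => n Nn.
by have := HN n Nn; rewrite -rnormE ltcR rnormBC.
Qed.

Lemma rnorm_small0 (V : normedZmodType (cplx R)) (x : V) :
  (forall e, 0 < e -> rnorm x <= e) -> x = 0.
Proof.
move=> xe; apply: rnorm_eq0; apply/eqP; rewrite eq_le rnorm_ge0 andbT.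
by apply: le_of_eps => e e0; rewrite add0r; exact: xe.
Qed.

Lemma rnorm_split (V : normedZmodType (cplx R)) (y x z : V) :
  rnorm (x - z) <= rnorm (x - y) + rnorm (y - z).
Proof. by have := rnormD (x - y) (y - z); rewrite addrA subrK. Qed.

Definition bounded_by (T : H -> H) (M : R) :=
  forall x, rnorm (T x) <= M * rnorm x.

Lemma continuous_bounded_by (T : H -> H) : linear T -> continuous T ->
  exists2 M, 0 <= M & bounded_by T M.
Proof.
move=> Tl Tc.
pose T' : {linear H -> H} := HB.pack T (GRing.isLinear.Build _ _ _ _ T Tl).
have /linear_boundedP : bounded_near T' (nbhs (0 : H)).
  exact/linear_bounded_continuous.
move=> /pinfty_ex_gt0[M M0 HM].
have ME : (complex.Re M)%:C%C = M by apply: RRe_real; exact: gtr0_real.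
exists (complex.Re M); first by apply/ltW; rewrite -ltcR ME.
by move=> x; rewrite -lecR rmorphM /= !rnormE ME; exact: HM.
Qed.

End HilbertBasics.

Section Operators.
Context (R : realType) (H : hilbertType R) (e0 : H) (e0P : e0 <> 0).

(** Operators are given together with their adjoint: this makes the involution
    a swap, without any appeal to the representation of functionals. *)
Definition adjointable : set ((H -> H) * (H -> H)) :=
  [set T | [/\ linear T.1, linear T.2, exists M, bounded_by T.1 M,
     exists M, bounded_by T.2 M & forall x y, dot (T.1 x) y = dot x (T.2 y)]].

Definition operators of e0 <> 0 : Type := adjointable.
Local Notation L := (operators e0P).
HB.instance Definition _ := Choice.on L.

Definition opr (T : L) : H -> H := (set_val T).1.
Definition adj (T : L) : H -> H := (set_val T).2.
Implicit Types S T : L.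

Lemma opr_linear T : linear (opr T). Proof. by case: (set_valP T). Qed.
Lemma adj_linear T : linear (adj T). Proof. by case: (set_valP T). Qed.
Lemma opr_bounded T : exists M, bounded_by (opr T) M.
Proof. by case: (set_valP T). Qed.
Lemma adj_bounded T : exists M, bounded_by (adj T) M.
Proof. by case: (set_valP T). Qed.
Lemma opr_adj T x y : dot (opr T x) y = dot x (adj T y).
Proof. by have [_ _ _ _] := set_valP T; apply. Qed.
Lemma adj_opr T x y : dot (adj T x) y = dot x (opr T y).
Proof. by rewrite (dotC y) -opr_adj (dotC _ x). Qed.

Lemma opr_ext S T : (forall x, opr S x = opr T x) -> S = T.
Proof.
move=> ST; apply: val_inj; rewrite [LHS]surjective_pairing [RHS]surjective_pairing.
congr pair; apply/funext => x; first exact: ST.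
apply/eqP; rewrite -subr_eq0; apply/eqP/dot_inj => z.
by rewrite dotBr -[X in X - _]opr_adj -[X in _ - X]opr_adj ST subrr.
Qed.

Lemma bounded_by_max T : exists M,
  [/\ 0 <= M, bounded_by (opr T) M & bounded_by (adj T) M].
Proof.
have [M HM] := opr_bounded T; have [N HN] := adj_bounded T.
exists (Num.max 0 (Num.max M N)); split=> [|x|x]; first by rewrite le_max lexx.
  apply: (le_trans (HM x)); rewrite ler_wpM2r ?rnorm_ge0//.
  by rewrite !le_max lexx orbT.
apply: (le_trans (HN x)); rewrite ler_wpM2r ?rnorm_ge0//.
by rewrite !le_max lexx !orbT.
Qed.

Fact opr_0P : adjointable (fun=> 0, fun=> 0).
Proof.
split=> /= [k x y|k x y|||x y]; rewrite ?scaler0 ?addr0 ?dot0l ?dot0r//;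
by exists 0 => x; rewrite rnorm0 mul0r.
Qed.
Fact opr_1P : adjointable (id, id).
Proof. by split=> //=; exists 1 => x; rewrite mul1r. Qed.
Fact opr_DP S T : adjointable (fun x => opr S x + opr T x, fun x => adj S x + adj T x).
Proof.
split=> /= [k x y|k x y|||x y].
- by rewrite !opr_linear scalerDr addrACA.
- by rewrite !adj_linear scalerDr addrACA.
- have [M HM] := opr_bounded S; have [N HN] := opr_bounded T; exists (M + N) => x.
  by rewrite mulrDl (le_trans (rnormD _ _))// lerD.
- have [M HM] := adj_bounded S; have [N HN] := adj_bounded T; exists (M + N) => x.
  by rewrite mulrDl (le_trans (rnormD _ _))// lerD.
- by rewrite dotDl dotDr !opr_adj.
Qed.
Fact opr_ZP k T : adjointable (fun x => k *: opr T x, fun x => k^* *: adj T x).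
Proof.
split=> /= [l x y|l x y|||x y].
- by rewrite !opr_linear scalerDr !scalerA mulrC.
- by rewrite !adj_linear scalerDr !scalerA mulrC.
- have [M HM] := opr_bounded T; exists (rnorm k * M) => x.
  by rewrite rnormZ -mulrA ler_wpM2l ?rnorm_ge0.
- have [M HM] := adj_bounded T; exists (rnorm k * M) => x.
  by rewrite rnormZ rnorm_conj -mulrA ler_wpM2l ?rnorm_ge0.
- by rewrite dotZl dotZr conjCK opr_adj.
Qed.
Fact opr_MP S T : adjointable (opr S \o opr T, adj T \o adj S).
Proof.
have [M [M0 HM HM']] := bounded_by_max S; have [N [N0 HN HN']] := bounded_by_max T.
split=> /= [l x y|l x y|||x y].
- by rewrite /comp !opr_linear.
- by rewrite /comp !adj_linear.
- by exists (M * N) => x; rewrite -mulrA (le_trans (HM _))// ler_wpM2l.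
- by exists (N * M) => x; rewrite -mulrA (le_trans (HN' _))// ler_wpM2l.
- by rewrite /comp !opr_adj.
Qed.
Fact opr_SP T : adjointable (adj T, opr T).
Proof.
split=> /=; [exact: adj_linear|exact: opr_linear|exact: adj_bounded|
  exact: opr_bounded|exact: adj_opr].
Qed.
Fact opr_NP T : adjointable (fun x => - opr T x, fun x => - adj T x).
Proof.
have := opr_ZP (-1) T; rewrite rmorphN1.
by under eq_fun do rewrite scaleN1r; under [X in (_, X)]eq_fun do rewrite scaleN1r.
Qed.

Let zero : L := to_set opr_0P.
Let one : L := to_set opr_1P.
Let add S T : L := to_set (opr_DP S T).
Let opp T : L := to_set (opr_NP T).
Let mul S T : L := to_set (opr_MP S T).
Let scl k T : L := to_set (opr_ZP k T).
Let str T : L := to_set (opr_SP T).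

Fact opr_addA : associative add.
Proof. by move=> x y z; apply: opr_ext => w; exact: addrA. Qed.
Fact opr_addC : commutative add.
Proof. by move=> x y; apply: opr_ext => w; exact: addrC. Qed.
Fact opr_add0 : left_id zero add.
Proof. by move=> x; apply: opr_ext => w; exact: add0r. Qed.
Fact opr_addN : left_inverse zero opp add.
Proof. by move=> x; apply: opr_ext => w; exact: addNr. Qed.
HB.instance Definition _ :=
  GRing.isZmodule.Build L opr_addA opr_addC opr_add0 opr_addN.

Fact opr_mulA : associative mul.
Proof. by move=> x y z; apply: opr_ext. Qed.
Fact opr_mul1 : left_id one mul.
Proof. by move=> x; apply: opr_ext. Qed.
Fact opr_mulr1 : right_id one mul.
Proof. by move=> x; apply: opr_ext. Qed.
Fact opr_mulDl : left_distributive mul +%R.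
Proof. by move=> x y z; apply: opr_ext. Qed.
Fact opr_linearD T x y : opr T (x + y) = opr T x + opr T y.
Proof. by have := opr_linear T 1 x y; rewrite !scale1r. Qed.
Fact opr_mulDr : right_distributive mul +%R.
Proof. by move=> x y z; apply: opr_ext => w; exact: opr_linearD. Qed.
Fact opr_1neq0 : one != 0.
Proof. by apply/eqP => /(congr1 (fun T => opr T e0)); exact: e0P. Qed.
HB.instance Definition _ := GRing.Zmodule_isNzRing.Build L
  opr_mulA opr_mul1 opr_mulr1 opr_mulDl opr_mulDr opr_1neq0.

Fact opr_sclA k l x : scl k (scl l x) = scl (k * l) x.
Proof. by apply: opr_ext => w; exact: scalerA. Qed.
Fact opr_scl1 : left_id 1 scl.
Proof. by move=> x; apply: opr_ext => w; exact: scale1r. Qed.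
Fact opr_sclDr : right_distributive scl +%R.
Proof. by move=> k x y; apply: opr_ext => w; exact: scalerDr. Qed.
Fact opr_sclDl x : {morph scl^~ x : k l / k + l}.
Proof. by move=> k l; apply: opr_ext => w; exact: scalerDl. Qed.
HB.instance Definition _ := GRing.Zmodule_isLmodule.Build (cplx R) L
  opr_sclA opr_scl1 opr_sclDr opr_sclDl.

Fact opr_sclAl (k : cplx R) S T : k *: (S * T) = k *: S * T.
Proof. by apply: opr_ext. Qed.
HB.instance Definition _ :=
  GRing.Lmodule_isLalgebra.Build (cplx R) L opr_sclAl.
Fact opr_linearZ T k x : opr T (k *: x) = k *: opr T x.
Proof.
have T0 : opr T 0 = 0 by apply: (addrI (opr T 0)); rewrite -opr_linearD !addr0.
by have := opr_linear T k x 0; rewrite T0 !addr0.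
Qed.
Fact opr_sclAr (k : cplx R) S T : k *: (S * T) = S * (k *: T).
Proof. by apply: opr_ext => w; rewrite [RHS]opr_linearZ. Qed.
HB.instance Definition _ :=
  GRing.Lalgebra_isAlgebra.Build (cplx R) L opr_sclAr.

Fact opr_strD S T : str (S + T) = str S + str T.
Proof. by apply: opr_ext. Qed.
Fact opr_strZ (k : cplx R) T : str (k *: T) = k^* *: str T.
Proof. by apply: opr_ext. Qed.
Fact opr_strM S T : str (S * T) = str T * str S.
Proof. by apply: opr_ext. Qed.
Fact opr_strK : involutive str.
Proof. by move=> T; apply: opr_ext. Qed.
HB.instance Definition _ :=
  isStarAlgebra.Build R L opr_strD opr_strZ opr_strM opr_strK.

Definition opnorm T : R := inf [set M | 0 <= M /\ bounded_by (opr T) M].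

Lemma opnorm_has_inf T : has_inf [set M | 0 <= M /\ bounded_by (opr T) M].
Proof.
have [M [M0 HM _]] := bounded_by_max T.
by split; [exists M|exists 0 => N []].
Qed.

Lemma opnorm_ge0 T : 0 <= opnorm T.
Proof. by apply: lb_le_inf => [|N []//]; case: (opnorm_has_inf T). Qed.

Lemma opnormP T : bounded_by (opr T) (opnorm T).
Proof.
move=> x; have [x0|x0] := eqVneq (rnorm x) 0.
  by rewrite x0 mulr0 (rnorm_eq0 x0) -(scale0r (0 : H)) opr_linearZ scale0r rnorm0.
have xp : 0 < rnorm x by rewrite lt_def x0 rnorm_ge0.
rewrite -ler_pdivrMr//; apply: lb_le_inf; first by case: (opnorm_has_inf T).
by move=> M [M0 HM]; rewrite ler_pdivrMr.
Qed.

Lemma opnorm_le T M : 0 <= M -> bounded_by (opr T) M -> opnorm T <= M.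
Proof. by move=> M0 HM; apply: ge_inf => //; exists 0 => N []. Qed.

Fact opnorm_eq0 T : opnorm T = 0 -> T = 0.
Proof.
move=> T0; apply: opr_ext => x; apply: rnorm_small0 => e e1.
by rewrite (le_trans (opnormP T x))// T0 mul0r ltW.
Qed.
Fact opnormD S T : opnorm (S + T) <= opnorm S + opnorm T.
Proof.
apply: opnorm_le => [|x]; first by rewrite addr_ge0 ?opnorm_ge0.
rewrite mulrDl; apply: (le_trans (rnormD _ _)).
by rewrite lerD ?opnormP.
Qed.
Fact opnormM S T : opnorm (S * T) <= opnorm S * opnorm T.
Proof.
apply: opnorm_le => [|x]; first by rewrite mulr_ge0 ?opnorm_ge0.
rewrite -mulrA; apply: (le_trans (opnormP S _)).
by rewrite ler_wpM2l ?opnorm_ge0// opnormP.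
Qed.
Fact opnormZ (k : cplx R) T : (opnorm (k *: T))%:C%C = `|k| * (opnorm T)%:C%C :> cplx R.
Proof.
suff H1 l S : opnorm (l *: S) <= rnorm l * opnorm S.
  rewrite -rnormE -rmorphM; congr (_%:C%C); apply/eqP; rewrite eq_le H1 /=.
  have [->|k0] := eqVneq k 0; first by rewrite rnorm0 mul0r opnorm_ge0.
  have kp : 0 < rnorm k.
    by rewrite lt_def rnorm_ge0 andbT; apply: contra_neq k0; exact: rnorm_eq0.
  have := H1 k^-1 (k *: T); rewrite scalerA mulVf// scale1r.
  by rewrite -(ler_pM2l kp) mulrA -rnormM mulfV// rnorm1 mul1r.
apply: opnorm_le => [|x]; first by rewrite mulr_ge0 ?opnorm_ge0 ?rnorm_ge0.
by rewrite rnormZ -mulrA ler_wpM2l ?rnorm_ge0// opnormP.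
Qed.

(** [|T* x|^2 = <T T* x, x> <= |T| |T* x| |x|]. *)
Lemma opnorm_str_le T : opnorm (str T) <= opnorm T.
Proof.
apply: opnorm_le => [|x]; first exact: opnorm_ge0.
have [y0|y0] := eqVneq (rnorm (adj T x)) 0.
  by rewrite [rnorm _]y0 mulr_ge0 ?opnorm_ge0 ?rnorm_ge0.
have yp : 0 < rnorm (adj T x) by rewrite lt_def y0 rnorm_ge0.
rewrite -(ler_pM2l yp) -expr2.
have -> : rnorm (adj T x) ^+ 2 = rnorm (dot (adj T x) (adj T x)).
  by rewrite dot_rnorm rnorm_real ger0_norm ?exprn_ge0 ?rnorm_ge0.
rewrite -opr_adj (le_trans (cauchy_schwarz _ _))//.
by rewrite mulrA ler_wpM2r ?rnorm_ge0// mulrC opnormP.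
Qed.

Fact opnorm_star T : opnorm (star T * T) = opnorm T ^+ 2.
Proof.
apply/eqP; rewrite eq_le; apply/andP; split.
  rewrite (le_trans (opnormM _ _))// expr2 ler_wpM2r ?opnorm_ge0//.
  exact: opnorm_str_le.
set N := opnorm (star T * T); have N0 : 0 <= N by exact: opnorm_ge0.
rewrite -[N]sqr_sqrtr// (@ler_pXn2r _ 2) ?nnegrE ?opnorm_ge0 ?sqrtr_ge0//.
apply: opnorm_le => [|x]; first exact: sqrtr_ge0.
rewrite -(@ler_pXn2r _ 2) ?nnegrE ?mulr_ge0 ?sqrtr_ge0 ?rnorm_ge0//.
rewrite exprMn sqr_sqrtr//.
have -> : rnorm (opr T x) ^+ 2 = rnorm (dot (opr T x) (opr T x)).
  by rewrite dot_rnorm rnorm_real ger0_norm ?exprn_ge0 ?rnorm_ge0.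
rewrite opr_adj (le_trans (cauchy_schwarz _ _))// mulrC expr2 mulrA.
by rewrite ler_wpM2r ?rnorm_ge0//; exact: (opnormP (star T * T) x).
Qed.

(** A sequence of operators that is Cauchy for the norm converges pointwise, and
    the pointwise limit is then a limit for the norm. *)
Lemma uniform_limit_linear (f : nat -> H -> H) : (forall n, linear (f n)) ->
  (forall e : R, 0 < e -> exists N, forall m n, (N <= m)%N -> (N <= n)%N ->
     bounded_by (fun x => f m x - f n x) e) ->
  exists2 T, linear T & forall e : R, 0 < e -> exists N, forall n, (N <= n)%N ->
    bounded_by (fun x => f n x - T x) e.
Proof.
move=> fl fc.
have ex x : exists l, hlim (f^~ x) l.
  apply: cauchy_hlim => e e1.
  have x1 : 0 < rnorm x + 1 by have := rnorm_ge0 x; lra.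
  have [N HN] := fc _ (divr_gt0 e1 x1); exists N => m n Nm Nn.
  apply: (le_lt_trans (HN m n Nm Nn x)).
  by rewrite mulrAC ltr_pdivrMr// ltr_pM2l//; lra.
have [T TP] := choice ex.
have Tu (e : R) : 0 < e -> exists N, forall n, (N <= n)%N ->
    bounded_by (fun x => f n x - T x) e.
  move=> e1; have [N HN] := fc e e1; exists N => n Nn x.
  apply: le_of_eps => d d0; have [M HM] := TP x d d0.
  have := HN n (maxn N M) Nn (leq_maxl _ _) x.
  have := HM (maxn N M) (leq_maxr _ _).
  have := rnorm_split (f (maxn N M) x) (f n x) (T x); lra.
exists T => // k x y.
apply/eqP; rewrite -subr_eq0; apply/eqP/rnorm_small0 => e e1.
pose C := rnorm (k *: x + y) + (rnorm k * rnorm x + rnorm y) + 1.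
have C0 : 0 < C.
  have := rnorm_ge0 (k *: x + y); have := rnorm_ge0 y.
  have := mulr_ge0 (rnorm_ge0 k) (rnorm_ge0 x); rewrite /C; lra.
have [N /(_ N (leqnn N)) HN] := Tu _ (divr_gt0 e1 C0).
have -> : T (k *: x + y) - (k *: T x + T y) =
    (k *: (f N x - T x) + (f N y - T y)) - (f N (k *: x + y) - T (k *: x + y)).
  by rewrite scalerBr [X in _ = X - _]addrACA -opprD -fl opprB [RHS]addrC addrA subrK.
apply: (le_trans (rnormD _ _)); rewrite rnormN.
have := rnormD (k *: (f N x - T x)) (f N y - T y); rewrite rnormZ.
have := HN x; have := HN y; have := HN (k *: x + y).
have := ler_wpM2l (rnorm_ge0 k) (HN x).
have : e / C * C = e by rewrite divfK// gt_eqF.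
rewrite {2}/C; set c := e / C; set a := rnorm (k *: x + y); set b := rnorm x.
have c0 : 0 <= c by rewrite divr_ge0// ltW.
have := rnorm_ge0 k; set K := rnorm k; set d := rnorm y.
nra.
Qed.

Fact opnorm_complete (u : nat -> L) :
  (forall e, 0 < e -> exists N, forall m n, (N <= m)%N -> (N <= n)%N ->
       opnorm (u m - u n) < e) ->
  exists l, (fun n => opnorm (u n - l)) @ \oo --> 0.
Proof.
move=> uc.
have [T Tl Tu] : exists2 T, linear T & forall e : R, 0 < e -> exists N,
    forall n, (N <= n)%N -> bounded_by (fun x => opr (u n) x - T x) e.
  apply: uniform_limit_linear => [n|e e1]; first exact: opr_linear.
  have [N HN] := uc e e1; exists N => m n Nm Nn x.
  apply: (le_trans (opnormP (u m - u n) x)).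
  by rewrite ler_wpM2r ?rnorm_ge0// ltW// HN.
have [S Sl Su] : exists2 S, linear S & forall e : R, 0 < e -> exists N,
    forall n, (N <= n)%N -> bounded_by (fun x => adj (u n) x - S x) e.
  apply: uniform_limit_linear => [n|e e1]; first exact: adj_linear.
  have [N HN] := uc e e1; exists N => m n Nm Nn x.
  apply: (le_trans (opnormP (str (u m - u n)) x)).
  rewrite ler_wpM2r ?rnorm_ge0// (le_trans (opnorm_str_le _))// ltW//.
  exact: HN.
have bd (f : H -> H) (n : nat) (g : H -> H) : (exists M, bounded_by g M) ->
    bounded_by (fun x => g x - f x) 1 -> exists M, bounded_by f M.
  move=> [M HM] H1; exists (M + 1) => x.
  have -> : f x = g x - (g x - f x) by rewrite opprB addrC subrK.
  apply: (le_trans (rnormD _ _)); rewrite rnormN mulrDl; apply: lerD; first exact: HM.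
  exact: H1.
have TP : adjointable (T, S).
  split=> //=.
  - have [N HN] := Tu 1 ltr01.
    exact: (bd _ N _ (opr_bounded (u N)) (HN N (leqnn N))).
  - have [N HN] := Su 1 ltr01.
    exact: (bd _ N _ (adj_bounded (u N)) (HN N (leqnn N))).
  - move=> x y; apply/eqP; rewrite -subr_eq0; apply/eqP/rnorm_small0 => e e1.
    pose C := rnorm x * rnorm y + 1.
    have C0 : 0 < C by rewrite ltr_wpDl// mulr_ge0 ?rnorm_ge0.
    have e2 : 0 < e / C / 2 by rewrite !divr_gt0.
    have [N HN] := Tu _ e2; have [M HM] := Su _ e2.
    set n := maxn N M.
    have -> : dot (T x) y - dot x (S y) =
       dot x (adj (u n) y - S y) - dot (opr (u n) x - T x) y.
      by rewrite dotBr dotBl opr_adj opprB [RHS]addrC addrA subrK.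
    apply: (le_trans (rnormD _ _)); rewrite rnormN.
    have h1 := HN n (leq_maxl _ _) x; have h2 := HM n (leq_maxr _ _) y.
    have := cauchy_schwarz x (adj (u n) y - S y).
    have := cauchy_schwarz (opr (u n) x - T x) y.
    have := ler_wpM2l (rnorm_ge0 x) h2; have := ler_wpM2r (rnorm_ge0 y) h1.
    have CE : e / C * C = e by rewrite divfK// gt_eqF.
    have c0 : 0 < e / C by rewrite divr_gt0.
    move: CE; rewrite {2}/C; set c := e / C in c0 *.
    set a := rnorm x; set b := rnorm y; nra.
exists (to_set TP : L); apply/cvgrPdist_lt => e e1.
have [N HN] := Tu _ (divr_gt0 e1 (ltr0n _ 2)); exists N => // n /= Nn.
rewrite sub0r normrN ger0_norm ?opnorm_ge0//.
apply: (@le_lt_trans _ _ (e / 2)); last lra.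
apply: opnorm_le; first by rewrite divr_ge0// ltW.
exact: HN.
Qed.

HB.instance Definition _ := isCStarAlgebra.Build R L
  opnorm_eq0 opnormD opnormZ opnormM opnorm_star opnorm_complete.

End Operators.

(** * Irreducible representations *)

Section Irrep.
Context (R : realType) (A : starAlgType R) (p : irrep A).
Local Notation H := (irrep_space p).
Implicit Types (a b c d : A) (x y : H).

Lemma irrep_linear a : linear (p a). Proof. by case: (irrepP p) => /(_ a)[]. Qed.
Lemma irrep_continuous a : continuous (p a).
Proof. by case: (irrepP p) => /(_ a)[]. Qed.
Lemma irrepL (k : cplx R) a b x : p (k *: a + b) x = k *: p a x + p b x.
Proof. by case: (irrepP p) => _ + _ _; apply. Qed.
Lemma irrepM a b x : p (a * b) x = p a (p b x).
Proof. by case: (irrepP p). Qed.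
Lemma irrepS a x y : dot (p a x) y = dot x (p (star a) y).
Proof. by case: (irrepP p) => _ _ _; apply. Qed.

Lemma irrep_vD a x y : p a (x + y) = p a x + p a y.
Proof. by have := irrep_linear a 1 x y; rewrite !scale1r. Qed.
Lemma irrep_v0 a : p a 0 = 0. Proof. exact: linear_at0 (irrep_linear a). Qed.
Lemma irrep_vZ a k x : p a (k *: x) = k *: p a x.
Proof. by have := irrep_linear a k x 0; rewrite irrep_v0 !addr0. Qed.
Lemma irrep_vB a x y : p a (x - y) = p a x - p a y.
Proof. by rewrite irrep_vD -scaleN1r irrep_vZ scaleN1r. Qed.

Lemma irrepD a b x : p (a + b) x = p a x + p b x.
Proof. by have := irrepL 1 a b x; rewrite !scale1r. Qed.
Lemma irrep0 x : p 0 x = 0.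
Proof. by apply: (addrI (p 0 x)); rewrite -irrepD !addr0. Qed.
Lemma irrepZ k a x : p (k *: a) x = k *: p a x.
Proof. by have := irrepL k a 0 x; rewrite irrep0 !addr0. Qed.
Lemma irrepB a b x : p (a - b) x = p a x - p b x.
Proof. by rewrite irrepD -scaleN1r irrepZ scaleN1r. Qed.

Lemma closed_ker (K : hilbertType R) (f : H -> K) : continuous f ->
  closed [set y | f y = 0].
Proof.
move=> fc; rewrite [X in closed X](_ : _ = f @^-1` [set 0]); last by [].
apply: preimage_closed; first by move=> y _; exact: fc.
exact/accessible_closed_set1/hausdorff_accessible/norm_hausdorff.
Qed.

(** The kernel of a central element is invariant, so that it is trivial or the
    whole space. *)
Lemma irrep_central c : (forall a x, p c (p a x) = p a (p c x)) ->
  (forall x, p c x = 0) \/ (forall x, p c x = 0 -> x = 0).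
Proof.
move=> cC; have [_ pI] := irrep_irr p.
have [| |W0|WT] := pI [set y | p c y = 0].
- split=> [|k x y /= Wx Wy|]; first exact: irrep_v0.
    by rewrite irrep_vD irrep_vZ Wx Wy scaler0 addr0.
  exact/closed_ker/irrep_continuous.
- by move=> a x /= Wx; rewrite cC Wx irrep_v0.
- by right=> x /= cx; have : [set y | p c y = 0] x by []; rewrite W0.
- by left=> x; have : [set y | p c y = 0] x by rewrite WT.
Qed.

Lemma irrep_prime c d : (forall a, c * a = a * c) -> c * d = 0 ->
  (forall x, p c x = 0) \/ (forall x, p d x = 0).
Proof.
move=> cC cd; have [|c0|c0] := irrep_central (c := c); [|by left|right=> x].
  by move=> a x; rewrite -!irrepM cC.
by apply: c0; rewrite -irrepM cd irrep0.
Qed.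

(** [p 1] is a central idempotent, and it is not zero. *)
Lemma irrep1 x : p 1 x = x.
Proof.
have [|c0|c0] := irrep_central (c := 1).
- by move=> a y; rewrite -!irrepM mulr1 mul1r.
- have [[a [y ay]] _] := irrep_irr p.
  by case: ay; rewrite -[a]mul1r irrepM c0.
- apply/esym/eqP; rewrite -subr_eq0; apply/eqP/c0.
  by rewrite irrep_vB -irrepM mulr1 subrr.
Qed.

Lemma irrep_neq0 : exists x : H, x <> 0.
Proof. by have [[a [x ax]] _] := irrep_irr p; exists (p a x). Qed.

Definition irrep_vec : H := sval (cid irrep_neq0).
Lemma irrep_vecP : irrep_vec <> 0. Proof. exact: svalP (cid irrep_neq0). Qed.

Fact irrep_adjointable a : adjointable (p a, p (star a)).
Proof.
split=> /=; [exact: irrep_linear|exact: irrep_linear| | |exact: irrepS].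
  have [M _ HM] := continuous_bounded_by (irrep_linear a) (irrep_continuous (a := a)).
  by exists M.
have [M _ HM] := continuous_bounded_by (irrep_linear (star a)) (irrep_continuous (a
    := star a)).
by exists M.
Qed.

Definition irrep_op a : operators irrep_vecP := to_set (irrep_adjointable a).

Lemma irrep_opE a x : opr (irrep_op a) x = p a x. Proof. by []. Qed.

Lemma irrep_op_starhom : starhom irrep_op.
Proof.
split=> [k a b||a].
- by apply: opr_ext => x; exact: irrepL.
- by split=> [|a b]; apply: opr_ext => x; [exact: irrep1|exact: irrepM].
- by apply: opr_ext.
Qed.

Lemma irrep_op_eq0 a : irrep_op a = 0 <-> forall x, p a x = 0.
Proof.
split=> [a0 x|a0]; last by apply: opr_ext.
by rewrite -irrep_opE a0.
Qed.

End Irrep.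

Section Equivalence.
Context (R : realType) (A : starAlgType R).
Implicit Types p q r : irrep A.

Lemma unitary_equiv_refl p : unitary_equiv p p.
Proof. by exists id; split=> // y; exists y. Qed.

Lemma unitary_equiv_sym p q : unitary_equiv p q -> unitary_equiv q p.
Proof.
move=> [W [Wl Wd Ws Wa]]; have [V VK] := choice Ws.
have Winj x y : W x = W y -> x = y.
  move=> Wxy; apply/eqP; rewrite -subr_eq0; apply/eqP/dot_inj => z.
  by rewrite dotBr -!Wd Wxy subrr.
exists V; split=> [k x y|x y|y|a x].
- by apply: Winj; rewrite Wl !VK.
- by rewrite -Wd !VK.
- by exists (W y); apply: Winj; rewrite VK.
- by apply: Winj; rewrite VK Wa VK.
Qed.

Lemma unitary_equiv_trans p q r :
  unitary_equiv p q -> unitary_equiv q r -> unitary_equiv p r.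
Proof.
move=> [W [Wl Wd Ws Wa]] [V [Vl Vd Vs Va]]; exists (V \o W); split=> /=.
- by move=> k x y /=; rewrite Wl Vl.
- by move=> x y; rewrite Vd Wd.
- by move=> y; have [z <-] := Vs y; have [x <-] := Ws z; exists x.
- by move=> a x; rewrite Wa Va.
Qed.

Lemma spec_classP p q : spec_class p = spec_class q <-> unitary_equiv p q.
Proof.
split=> [/(congr1 (fun c => sval c q)) /= ->|pq]; first exact: unitary_equiv_refl.
apply: eq_exist => /=; apply/funext => r; rewrite propeqE; split.
  by apply: unitary_equiv_trans; exact: unitary_equiv_sym.
exact: unitary_equiv_trans.
Qed.

Lemma spec_class_surj (c : spectrum A) : exists p, c = spec_class p.
Proof. by case: c => S [p Sp]; exists p; exact: eq_exist. Qed.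

Lemma spec_ker_class p a : spec_ker (spec_class p) a <-> forall x, p a x = 0.
Proof.
split=> [|pa q]; first by apply; exact: unitary_equiv_refl.
move=> /= [W [Wl _ Ws Wa]] y; have [x <-] := Ws y.
by rewrite -Wa pa; exact: linear_at0.
Qed.

Lemma irrep_ker_equiv p q a : unitary_equiv p q ->
  (forall x, p a x = 0) -> forall x, q a x = 0.
Proof. by move=> /spec_classP pq; rewrite -spec_ker_class pq spec_ker_class. Qed.

End Equivalence.

Section Descent.
Context (R : realType) (A B : starAlgType R) (f : starEpi A B).

(** The quotient acts through arbitrary lifts, with the same invariant
    subspaces. *)
Lemma irrep_descend (p : irrep A) : (forall a, f a = 0 -> forall x, p a x = 0) ->
  exists q : irrep B, unitary_equiv p (irrep_pull f q).
Proof.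
move=> fp; have [g gK] := choice (starEpi_surj f).
have fh := starEpi_hom f.
have eqf a b : f a = f b -> p a = p b.
  move=> ab; apply/funext => x; apply/eqP; rewrite -subr_eq0 -irrepB.
  by apply/eqP/fp; rewrite (starhomB fh) ab subrr.
have rep : representation (fun b x => p (g b) x).
  split=> [b|k a b x|a b x|a x y].
  - by split; [exact: irrep_linear|exact: irrep_continuous].
  - rewrite -irrepL (eqf (g (k *: a + b)) (k *: g a + g b))//.
    by rewrite (starhomD fh) (starhomZ fh) !gK.
  - by rewrite -irrepM (eqf (g (a * b)) (g a * g b))// (starhomM fh) !gK.
  - rewrite irrepS (eqf (star (g a)) (g (star a)))//.
    by rewrite (starhomS fh) !gK.
have gf a : p (g (f a)) = p a by apply: eqf; rewrite gK.
have irr : irreducible (fun b x => p (g b) x).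
  have [[a [x ax]] pI] := irrep_irr p; split; first by exists (f a), x; rewrite gf.
  by move=> W Wc Wi; apply: pI => // b y Wy; rewrite -gf; exact: Wi.
exists (Irrep rep irr), id; split=> [//|//|y|a x]; first by exists y.
by rewrite /= gf.
Qed.

Lemma unitary_equiv_pull (p q : irrep B) :
  unitary_equiv (irrep_pull f p) (irrep_pull f q) <-> unitary_equiv p q.
Proof.
split=> -[W [Wl Wd Ws Wa]]; exists W; split=> //.
  by move=> b x; have [a <-] := starEpi_surj f b; exact: (Wa a x).
by move=> a x; exact: (Wa (f a) x).
Qed.

End Descent.

(** * Averages over conjugation by a unitary *)

Section Expi.
Context (R : realType).
Implicit Types s t : R.

Lemma expiD s t : expi (s + t) = expi s * expi t.
Proof.
rewrite /expi mulrDr cosD sinD; apply/eqP; rewrite eq_complex /=.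
by rewrite eqxx /= addrC; apply/eqP; congr (_ + _); rewrite mulrC.
Qed.

Lemma expi0 : expi (0 : R) = 1.
Proof. by rewrite /expi mulr0 cos0 sin0. Qed.

Lemma expi1 : expi (1 : R) = 1.
Proof. by rewrite /expi mulr1 mulr_natl cos2pi sin2pi. Qed.

Lemma rnorm_expi t : rnorm (expi t) = 1.
Proof. by rewrite /rnorm norm_expi. Qed.

Lemma expi_neq0 t : expi t != 0.
Proof. by rewrite -normr_eq0 norm_expi oner_eq0. Qed.

Lemma expiN t : expi (- t) = (expi t)^-1.
Proof.
by apply: (mulIf (expi_neq0 t)); rewrite -expiD addNr expi0 mulVf ?expi_neq0.
Qed.

Lemma expiXn t n : expi t ^+ n = expi (t * n%:R).
Proof.
elim: n => [|n IH]; first by rewrite mulr0 expi0.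
by rewrite exprS IH -expiD -natr1 mulrDr mulr1 addrC.
Qed.

Lemma expiXz t (m : int) : expi t ^ m = expi (t * m%:~R).
Proof.
case: m => n; first by rewrite -exprnP expiXn.
by rewrite NegzE -exprnN expiXn mulrNz mulrN expiN.
Qed.

Lemma expi_eq1 t : expi t = 1 -> exists m : int, t = m%:~R.
Proof.
move=> t1; exists (Num.floor t); apply/eqP; rewrite -subr_eq0; apply/eqP.
set f := t - _.
have f0 : 0 <= f by rewrite subr_ge0 floor_le.
have f1 : f < 1 by have := floorD1_gt t; rewrite intrD /f; lra.
have : expi f = 1.
  by rewrite expiD t1 expiN -[_%:~R]mul1r -expiXz expi1 exp1rz invr1 mulr1.
move=> /(congr1 (@complex.Re R)) /= cf.
have pi0 := pi_gt0 R.
have [fh|fh] := leP (2 * f) 1.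
  have : 2 * pi * f = 0.
    apply: cos_inj; rewrite ?cos0 ?cf// in_itv /=; nra.
  by move=> /eqP; rewrite !mulf_eq0 pnatr_eq0 /= gt_eqF//= => /eqP.
have : pi *+ 2 - 2 * pi * f = 0.
  apply: cos_inj; rewrite ?cos0 ?in_itv /=; [nra|nra|].
  by rewrite addrC cosD2pi cosN.
rewrite -mulr_natl; nra.
Qed.

Lemma expi_irrational (theta : R) (m : int) :
  irrational theta -> expi theta ^ m = 1 -> m = 0.
Proof.
move=> irr; rewrite expiXz => /expi_eq1[k km].
apply: contrapT => m0; apply: irr.
have m0' : (m%:~R : R) != 0 by rewrite intr_eq0; exact/eqP.
exists (k%:Q / m%:Q) => //.
by rewrite fmorph_div /= !ratr_int -km mulfK.
Qed.

End Expi.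

Section Multiplier.
Context (R : realType) (A : cstarAlgType R) (w : A) (wU : unitary w).

(** Sums of geometric progressions with ratio [z <> 1] on the circle stay
    bounded, so that their averages tend to [0]. *)
Lemma geometric_average (z : cplx R) (e : R) : rnorm z = 1 -> 0 < e ->
  \forall N \near \oo, rnorm ((z == 1)%:R * N.+1%:R - \sum_(j < N.+1) z ^+ j) <=
    e * N.+1%:R.
Proof.
move=> z1 e0.
have [->|zn1] := eqVneq z 1.
  apply: nearW => N; rewrite mul1r.
  under eq_bigr do rewrite expr1n.
  by rewrite sumr_const card_ord subrr rnorm0 mulr_ge0 ?ltW.
have zp : 0 < rnorm (z - 1).
  rewrite lt_def rnorm_ge0 andbT; apply: contra_neq zn1 => /rnorm_eq0/eqP.
  by rewrite subr_eq0 => /eqP.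
near=> N; rewrite mul0r sub0r rnormN -(ler_pM2l zp) -rnormM -subrX1.
apply: (le_trans (rnormD _ _)); rewrite rnormN rnorm1.
have -> : rnorm (z ^+ N.+1) = 1.
  by elim: (N.+1) => [|n IH]; rewrite ?rnorm1// exprS rnormM z1 IH mul1r.
rewrite mulrA -ler_pdivrMl ?mulr_gt0//; apply: (@le_trans _ _ N%:R); last by
    rewrite ler_nat.
near: N; exact: nbhs_infty_ger.
Unshelve. all: by end_near. Qed.

Context (I T : finType) (x : I -> A) (mu : I -> cplx R) (c nu : T -> cplx R).
Context (mu1 : forall i, rnorm (mu i) = 1) (nu1 : forall t, rnorm (nu t) = 1).
Context (wx : forall i, w * x i * star w = mu i *: x i).

Definition kernel_value (j : nat) : cplx R := \sum_t c t * nu t ^+ j.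

(** The limit of the averages over [j] of [kernel_value j * m ^+ j]. *)
Definition multiplier (m : cplx R) : cplx R := \sum_t c t * (nu t * m == 1)%:R.

Lemma conj_power j i : w ^+ j * x i * star w ^+ j = mu i ^+ j *: x i.
Proof.
elim: j => [|j IH]; first by rewrite !expr0 mul1r mulr1 scale1r.
rewrite exprS [star w ^+ _]exprSr !mulrA -[w * _ * x i]mulrA.
rewrite -(mulrA w) IH -scalerAr -scalerAl wx scalerA.
by rewrite exprSr.
Qed.

(** For a nonnegative kernel the averages of the absolute values are those of
    the kernel itself, with limit [multiplier 1]. *)
Lemma average_nonneg_kernel : (forall j, 0 <= kernel_value j) ->
  multiplier 1 = 1 ->
  forall e, 0 < e -> \forall N \near \oo,
     \sum_(j < N.+1) rnorm (kernel_value j) <= (1 + e) * N.+1%:R.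
Proof.
move=> K0 m1 e e0.
pose C := \sum_t rnorm (c t) + 1.
have C0 : 0 < C by rewrite ltr_wpDl// sumr_ge0// => t _; exact: rnorm_ge0.
pose close (t : T) (N : nat) : Prop :=
  rnorm ((nu t == 1)%:R * N.+1%:R - \sum_(j < N.+1) nu t ^+ j) <= e / C * N.+1%:R.
have : \forall N \near \oo, forall t, close t N.
  apply: (@filter_forall nat _ close (nbhs \oo) _) => t.
  by apply: geometric_average; rewrite // divr_gt0.
apply: filterS => N HN.
have Np : 0 < N.+1%:R :> R by [].
have -> : \sum_(j < N.+1) rnorm (kernel_value j) =
    rnorm (\sum_(j < N.+1) kernel_value j).
  apply: (@complexI R); rewrite rnormE ger0_norm ?sumr_ge0// rmorph_sum /=.
  by apply: eq_bigr => j _; rewrite rnormE ger0_norm.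
have SE : \sum_(j < N.+1) kernel_value j = \sum_t c t * \sum_(j < N.+1) nu t ^+ j.
  by rewrite exchange_big; apply: eq_bigr => t _ /=; rewrite mulr_sumr.
have E : (N.+1%:R : cplx R) = \sum_t c t * ((nu t == 1)%:R * N.+1%:R).
  transitivity (multiplier 1 * N.+1%:R); first by rewrite m1 mul1r.
  rewrite /multiplier mulr_suml; apply: eq_bigr => t _.
  by rewrite mulr1 mulrA.
have -> : \sum_(j < N.+1) kernel_value j =
    N.+1%:R - \sum_t c t * ((nu t == 1)%:R * N.+1%:R - \sum_(j < N.+1) nu t ^+ j).
  under [X in _ - X]eq_bigr do rewrite mulrBr.
  by rewrite sumrB -SE -E opprB addrC subrK.
apply: (le_trans (rnormD _ _)); rewrite rnormN mulrDl mul1r; apply: lerD.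
  by rewrite -(rmorph_nat (@real_complex R)) rnorm_real ger0_norm.
apply: (@le_trans _ _ (\sum_t rnorm (c t) * (e / C * N.+1%:R))).
  elim/big_rec2: _ => [|t a b _ ab]; first by rewrite rnorm0.
  apply: (le_trans (rnormD _ _)); apply: lerD => //.
  by rewrite rnormM ler_wpM2l ?rnorm_ge0//; exact: HN.
rewrite -mulr_suml !mulrA ler_wpM2r// ler_pdivrMr// mulrC.
by rewrite ler_wpM2l ?ltW// /C ltrDl.
Qed.

(** If the averages of [|kernel_value|] tend to at most [1], then averaging the
    conjugates of [\sum_i x i] by the powers of [w] with weights [kernel_value]
    does not increase the norm.  In the limit only the resonant terms
    [nu t * mu i = 1] survive. *)
Lemma multiplier_contractive :
  (forall e, 0 < e -> \forall N \near \oo,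
     \sum_(j < N.+1) rnorm (kernel_value j) <= (1 + e) * N.+1%:R) ->
  cnorm (\sum_i multiplier (mu i) *: x i) <= cnorm (\sum_i x i).
Proof.
move=> avg; set X := \sum_i x i; set D := \sum_i multiplier _ *: _.
pose C := \sum_i \sum_t rnorm (c t) * cnorm (x i).
have C0 : 0 <= C.
  by apply: sumr_ge0 => i _; apply: sumr_ge0 => t _; rewrite mulr_ge0 ?rnorm_ge0
      ?cnorm_ge0.
suff H e : 0 < e -> cnorm D <= cnorm X + e * (cnorm X + C).
  apply: le_of_eps => e e0.
  have E0 : 0 < cnorm X + C + 1 by have := cnorm_ge0 X; lra.
  apply: (le_trans (H _ (divr_gt0 e0 E0))); rewrite lerD2l.
  by rewrite mulrAC ler_pdivrMr// ler_wpM2l ?ltW//; lra.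
move=> e0.
pose close (it : I * T) (N : nat) : Prop :=
  rnorm ((nu it.2 * mu it.1 == 1)%:R * N.+1%:R -
         \sum_(j < N.+1) (nu it.2 * mu it.1) ^+ j) <= e * N.+1%:R.
have [N [HN1 HN2]] : exists N, \sum_(j < N.+1) rnorm (kernel_value j) <=
    (1 + e) * N.+1%:R /\ forall it, close it N.
  apply: (@filter_ex _ \oo); apply: filterI; first exact: avg.
  apply: (@filter_forall nat _ close (nbhs \oo) _) => it; apply: geometric_average
      => //.
  by rewrite rnormM mu1 nu1 mulr1.
pose S := \sum_(j < N.+1) kernel_value j *: (w ^+ j * X * star w ^+ j).
have Np : 0 < N.+1%:R :> R by [].
have SN : cnorm S <= (1 + e) * N.+1%:R * cnorm X.
  apply: (le_trans (cnorm_sum _ _)).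
  apply: (@le_trans _ _ ((\sum_(j < N.+1) rnorm (kernel_value j)) * cnorm X)).
    rewrite mulr_suml; apply: ler_sum => j _; rewrite cnormZr.
    rewrite ler_wpM2l ?rnorm_ge0// cnorm_unitaryr ?cnorm_unitaryl//.
      exact: unitaryX.
    by apply/unitaryX/unitary_star.
  by rewrite ler_wpM2r ?cnorm_ge0.
have SE : S = \sum_i \sum_t (c t * \sum_(j < N.+1) (nu t * mu i) ^+ j) *: x i.
  rewrite /S; under eq_bigr => j _.
    rewrite mulr_sumr mulr_suml scaler_sumr.
    under eq_bigr => i _ do rewrite conj_power scalerA mulr_suml scaler_suml.
    over.
  rewrite exchange_big; apply: eq_bigr => i _ /=.
  rewrite exchange_big; apply: eq_bigr => t _ /=.
  rewrite mulr_sumr scaler_suml; apply: eq_bigr => j _.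
  by rewrite exprMn mulrA.
have SD : cnorm ((N.+1%:R : cplx R) *: D - S) <= e * N.+1%:R * C.
  rewrite SE /D scaler_sumr -sumrB /C mulr_sumr.
  apply: (le_trans (cnorm_sum _ _)); apply: ler_sum => i _.
  rewrite scalerA /multiplier mulr_sumr scaler_suml -sumrB.
  rewrite mulr_sumr; apply: (le_trans (cnorm_sum _ _)); apply: ler_sum => t _.
  rewrite -scalerBl cnormZr mulrCA -mulrBr rnormM (mulrC (N.+1%:R)).
  rewrite [leRHS]mulrA ler_wpM2r ?cnorm_ge0// [leLHS]mulrC ler_wpM2r ?rnorm_ge0//.
  exact: (HN2 (i, t)).
rewrite -(ler_pM2l Np).
have -> : N.+1%:R * cnorm D = cnorm ((N.+1%:R : cplx R) *: D).
  by rewrite cnormZr -(rmorph_nat (@real_complex R)) rnorm_real ger0_norm.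
have -> : (N.+1%:R : cplx R) *: D = ((N.+1%:R : cplx R) *: D - S) + S by rewrite subrK.
apply: (le_trans (cnormD _ _)); nra.
Qed.

End Multiplier.

(** * Simplicity of the irrational rotation algebra *)

Section IntegerPowers.
Context (R : realType) (A : starAlgType R).
Implicit Types (u v : A) (m n : int).

Definition upow u m : A :=
  match m with Posz n => u ^+ n | Negz n => star u ^+ n.+1 end.

Lemma upow0 u : upow u 0 = 1. Proof. by []. Qed.
Lemma upow1 u : upow u 1 = u. Proof. by []. Qed.

Lemma upowS u m : unitary u -> upow u (1 + m) = u * upow u m.
Proof.
move=> [u1 u2]; case: m => [n|[|n]].
- by rewrite -intS /= exprS.
- by rewrite NegzE subrr /= expr1 u2.
- have -> : 1 + Negz n.+1 = Negz n by rewrite !NegzE (intS n.+1) opprD addNKr.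
  by rewrite /= [in RHS]exprS mulrA u2 mul1r.
Qed.

Lemma upowP u m : unitary u -> upow u (-1 + m) = star u * upow u m.
Proof.
move=> uu; have -> : upow u m = u * upow u (-1 + m).
  by rewrite -upowS// addrA subrr add0r.
by rewrite mulrA uu.1 mul1r.
Qed.

Lemma upowD u m n : unitary u -> upow u (m + n) = upow u m * upow u n.
Proof.
move=> uu; elim/int_rect: m => [|m IH|m IH].
- by rewrite add0r mul1r.
- by rewrite intS -addrA !upowS// IH mulrA.
- by rewrite intS opprD -addrA !upowP// IH mulrA.
Qed.

Lemma upow_unitary u m : unitary u -> unitary (upow u m).
Proof.
by move=> uu; case: m => n; apply: unitaryX => //; exact: unitary_star.
Qed.

Lemma upow_star u m : unitary u -> star (upow u m) = upow u (- m).
Proof.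
move=> uu; have [_ p] := upow_unitary m uu.
by rewrite -[LHS]mul1r -(upow0 u) -(addNr m) upowD// -mulrA p mulr1.
Qed.

Lemma upow_comm (k : cplx R) u v m : k != 0 -> unitary u ->
  v * u = k *: (u * v) -> v * upow u m = k ^ m *: (upow u m * v).
Proof.
move=> k0 uu vu; elim/int_rect: m => [|m IH|m IH].
- by rewrite expr0z scale1r mulr1 mul1r.
- rewrite intS upowS// mulrA vu -scalerAl -[u * v * _]mulrA IH -scalerAr scalerA mulrA.
  by rewrite exprSz.
- have vuS : v * star u = k^-1 *: (star u * v).
    rewrite -[v in RHS]mulr1 -uu.2 (mulrA v) vu -scalerAl -scalerAr scalerA.
    by rewrite mulVf// scale1r !mulrA uu.1 mul1r.
  rewrite intS opprD upowP// mulrA vuS -scalerAl -[star u * v * _]mulrA IH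
      -scalerAr scalerA mulrA.
  by rewrite expfzDr.
Qed.

Lemma upow_comm2 (k : cplx R) u v m n : k != 0 -> unitary u -> unitary v ->
  v * u = k *: (u * v) ->
  upow v n * upow u m = k ^ (m * n) *: (upow u m * upow v n).
Proof.
move=> k0 uu vv vu; have km0 : k ^ m != 0 by rewrite expfz_neq0.
have := upow_comm m k0 uu vu.
move=> /(congr1 (fun x => (k ^ m)^-1 *: x)); rewrite scalerA mulVf// scale1r => H.
rewrite (upow_comm (u := v) (v := upow u m) n _ vv (esym H)) ?invr_eq0//.
by rewrite scalerA exprz_inv exprz_exp -expfzDr// mulrN subrr expr0z scale1r.
Qed.

End IntegerPowers.

Section FejerKernel.
Context (R : realType) (theta : R) (thetaP : irrational theta) (M : nat).
Local Notation lam := (expi theta).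
Local Notation T := ('I_M.+1 * 'I_M.+1)%type.

Definition fejer_weight (t : T) : cplx R := (M.+1%:R^-1)%:C%C.
Definition fejer_point (t : T) : cplx R := lam ^ (t.1%:Z - t.2%:Z).

(** The Cesaro weight [max 0 (1 - |m| / (M + 1))], as a count of the pairs
    [(k, l)] with [k - l + m = 0]. *)
Definition fejer (m : int) : cplx R :=
  multiplier fejer_weight fejer_point (lam ^ m).

Lemma expi_eq (m n : int) : (lam ^ m == lam ^ n) = (m == n).
Proof.
apply/eqP/eqP => [mn|->//]; apply/eqP; rewrite -subr_eq0; apply/eqP.
apply: (expi_irrational thetaP).
by rewrite expfzDr ?expi_neq0// mn -expfzDr ?expi_neq0// subrr expr0z.
Qed.

Lemma rnorm_expiXz (m : int) : rnorm (lam ^ m) = 1.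
Proof. by rewrite expiXz rnorm_expi. Qed.

Lemma fejerE m : fejer m =
  \sum_(t : T) (M.+1%:R^-1)%:C%C * ((t.1%:Z - t.2%:Z + m == 0) : nat)%:R.
Proof.
apply: eq_bigr => t _; rewrite /fejer_weight /fejer_point -expfzDr ?expi_neq0//.
by rewrite -(expr0z lam) expi_eq.
Qed.

(** The Fejer kernel is the squared modulus of a Dirichlet kernel. *)
Lemma fejer_kernel_ge0 j : 0 <= kernel_value fejer_weight fejer_point j.
Proof.
pose D := \sum_(k < M.+1) expi (theta * k%:R * j%:R).
have -> : kernel_value fejer_weight fejer_point j = (M.+1%:R^-1)%:C%C * (D * D^*).
  rewrite /D rmorph_sum /= mulr_suml mulr_sumr /kernel_value.
  under [RHS]eq_bigr do rewrite !mulr_sumr.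
  rewrite pair_bigA /=; apply: eq_bigr => -[k l] _; congr (_ * _).
  have conjE t : (expi t)^* = expi (- t) :> cplx R.
    rewrite expiN; apply: (mulfI (expi_neq0 t)).
    by rewrite rnorm_unit ?rnorm_expi// mulfV ?expi_neq0.
  rewrite /fejer_point /= conjE -expiD expiXz expiXn; congr expi.
  by rewrite rmorphB /= -!pmulrn; ring.
by rewrite mulr_ge0 -?normCK ?exprn_ge0// lecR invr_ge0.
Qed.

Lemma count_ltn n p : (\sum_(k < n) (k < p)%N <= p)%N.
Proof.
suff -> : (\sum_(k < n) (k < p)%N = minn n p)%N by exact: geq_minr.
elim: n => [|n IH]; first by rewrite big_ord0 min0n.
rewrite big_ord_recr /= IH.
have [np|pn] := ltnP n p; first by rewrite (minn_idPl np) addn1.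
by rewrite (minn_idPr (leqW pn)) addn0.
Qed.

Local Notation hit m k l := ((k : nat)%:Z - (l : nat)%:Z + m == 0)%R.

Lemma hit_count (m : int) (k : 'I_M.+1) :
  (\sum_(l < M.+1) hit m k l = [exists l : 'I_M.+1, hit m k l])%N.
Proof.
case: existsP => [[l0 /eqP l0P]|H]; last first.
  rewrite big1// => l _; apply/eqP; rewrite eqb0; apply/negP => kl.
  by apply: H; exists l.
rewrite (bigD1 l0)//= l0P eqxx big1 ?addn0// => l ll0.
apply/eqP; rewrite eqb0; apply: contra_neq ll0 => kl; apply: val_inj => /=.
have : (k : nat)%:Z - l%:Z + m = (k : nat)%:Z - l0%:Z + m by rewrite kl l0P.
by move=> /addIr /addrI /oppr_inj [].
Qed.

(** For a given [k] there is at most one [l] with [k - l + m = 0], and there is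
    none only when [k] is within [|m|] of one end of the range. *)
Lemma miss_count (m : int) :
  (\sum_(k < M.+1) ~~ [exists l : 'I_M.+1, hit m k l] <= `|m|%N)%N.
Proof.
case: m => p /=; last first.
  apply: leq_trans (count_ltn M.+1 p.+1); apply: leq_sum => k _.
  case: existsP => //= H; rewrite lt0b ltnNge; apply/negP => pk; apply: H.
  have lP : (k - p.+1 < M.+1)%N by rewrite (leq_ltn_trans (leq_subr _ _)).
  exists (Ordinal lP) => /=; rewrite NegzE -subzn//; apply/eqP; ring.
apply: leq_trans (count_ltn M.+1 p).
rewrite (reindex_inj rev_ord_inj) /=; apply: leq_sum => k _.
case: existsP => //= H; rewrite lt0b ltnNge; apply/negP => pk; apply: H.
have lP : (M - k + p < M.+1)%N.
  by rewrite ltnS addnBAC ?leq_ord// leq_subLR addnC leq_add2r.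
exists (Ordinal lP) => /=; rewrite subSS PoszD; apply/eqP; ring.
Qed.

Lemma fejer_near1 (m : int) : rnorm (fejer m - 1) <= `|m|%N%:R / M.+1%:R.
Proof.
have -> : fejer m - 1 = - ((M.+1%:R^-1 *
    (\sum_(k < M.+1) ~~ [exists l : 'I_M.+1, hit m k l])%N%:R)%:C%C).
  rewrite fejerE -(pair_bigA _ (fun k l : 'I_M.+1 => (M.+1%:R^-1)%:C%C * (hit m k l
      : nat)%:R)) /=.
  under eq_bigr do rewrite -mulr_sumr -natr_sum hit_count.
  rewrite -mulr_sumr -natr_sum rmorphM rmorph_nat; apply/eqP.
  rewrite subr_eq addrC -subr_eq opprK -mulrDr -natrD -big_split /=.
  under eq_bigr do rewrite addnC addn_negb.
  rewrite sum1_card card_ord -(rmorph_nat (@real_complex R)) -rmorphM.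
  by rewrite mulVf ?rmorph1// pnatr_eq0.
rewrite rnormN rnorm_real ger0_norm ?mulr_ge0 ?invr_ge0//.
by rewrite mulrC ler_wpM2r ?invr_ge0// ler_nat miss_count.
Qed.

Lemma fejer0 : fejer 0 = 1.
Proof.
apply/eqP; rewrite -subr_eq0; apply/eqP/rnorm_eq0/eqP.
by rewrite eq_le rnorm_ge0 andbT (le_trans (fejer_near1 0))// mul0r.
Qed.

End FejerKernel.

Section Monomials.
Context (R : realType) (t : R) (A : cstarAlgType R) (u v : A).
Context (uv : rotation_pair t u v).
Local Notation lam := (expi t).

Definition monom (m n : int) : A := upow u m * upow v n.

Definition lpoly (I : finType) (c : I -> cplx R) (m n : I -> int) : A :=
  \sum_i c i *: monom (m i) (n i).

Let uU : unitary u. Proof. by case: uv. Qed.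
Let vU : unitary v. Proof. by case: uv. Qed.
Let vu : v * u = lam *: (u * v). Proof. by case: uv. Qed.

Lemma monom_unitary m n : unitary (monom m n).
Proof. by apply: unitaryM; exact: upow_unitary. Qed.

Lemma monom_conj_v m n : v * monom m n * star v = lam ^ m *: monom m n.
Proof.
rewrite /monom mulrA (upow_comm m (expi_neq0 t) uU vu) -!scalerAl; congr (_ *: _).
rewrite -!mulrA; congr (_ * _); rewrite mulrA -(upowS n vU) addrC upowD// upow1.
by rewrite -mulrA vU.2 mulr1.
Qed.

Lemma monom_conj_u m n : u * monom m n * star u = lam ^ (- n) *: monom m n.
Proof.
have := upow_comm2 1 n (expi_neq0 t) uU vU vu; rewrite upow1 mul1r => vnu.
have uvn : u * upow v n = lam ^ (- n) *: (upow v n * u).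
  by rewrite vnu scalerA -expfzDr ?expi_neq0// addNr expr0z scale1r.
rewrite /monom mulrA -(upowS m uU) addrC upowD// upow1 -(mulrA (upow u m) u).
by rewrite uvn -scalerAr -scalerAl -!mulrA uU.2 mulr1.
Qed.

Lemma monom_mul m n m' n' :
  monom m n * monom m' n' = lam ^ (m' * n) *: monom (m + m') (n + n').
Proof.
rewrite /monom mulrA -[upow u m * _ * _]mulrA (upow_comm2 m' n (expi_neq0 t) uU vU vu).
by rewrite !upowD// -!scalerAr -!scalerAl !mulrA.
Qed.

Lemma monom_star m n : star (monom m n) = lam ^ (m * n) *: monom (- m) (- n).
Proof.
rewrite /monom starM !upow_star// (upow_comm2 _ _ (expi_neq0 t) uU vU vu).
by rewrite mulrNN.
Qed.

Lemma cnorm_monom m n : cnorm (monom m n) = 1.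
Proof. exact/cnorm_unitary/monom_unitary. Qed.

(** Conjugation by [v] isolates the powers of [u], and then conjugation by [u]
    those of [v]. *)
Lemma lpoly_multiplier (T S : finType) (c1 nu1 : T -> cplx R) (c2 nu2 : S -> cplx R)
    (I : finType) (c : I -> cplx R) (m n : I -> int) :
  (forall x, rnorm (nu1 x) = 1) -> (forall x, rnorm (nu2 x) = 1) ->
  (forall e, 0 < e -> \forall N \near \oo,
     \sum_(j < N.+1) rnorm (kernel_value c1 nu1 j) <= (1 + e) * N.+1%:R) ->
  (forall e, 0 < e -> \forall N \near \oo,
     \sum_(j < N.+1) rnorm (kernel_value c2 nu2 j) <= (1 + e) * N.+1%:R) ->
  cnorm (lpoly (fun i => multiplier c2 nu2 (lam ^ (- n i)) *
                         (multiplier c1 nu1 (lam ^ m i) * c i)) m n) <=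
  cnorm (lpoly c m n).
Proof.
move=> nu11 nu21 K1 K2.
have lam1 (k : int) : rnorm (lam ^ k) = 1 by rewrite expiXz rnorm_expi.
have := @multiplier_contractive R A u uU I S
  (fun i => (multiplier c1 nu1 (lam ^ m i) * c i) *: monom (m i) (n i))
  (fun i => lam ^ (- n i)) c2 nu2 (fun i => lam1 _) nu21 _ K2.
rewrite /lpoly; under eq_bigr do rewrite scalerA.
move=> /(_ _)/le_trans; apply.
  by move=> i; rewrite -scalerAr -scalerAl monom_conj_u !scalerA mulrC.
have := @multiplier_contractive R A v vU I T
  (fun i => c i *: monom (m i) (n i))
  (fun i => lam ^ (m i)) c1 nu1 (fun i => lam1 _) nu11 _ K1.
under eq_bigr do rewrite scalerA.
apply=> i; by rewrite -scalerAr -scalerAl monom_conj_v !scalerA mulrC.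
Qed.

End Monomials.

Lemma upow_hom (R : realType) (A B : starAlgType R) (h : A -> B) (u : A) m :
  starhom h -> h (upow u m) = upow (h u) m.
Proof. by move=> hh; case: m => n /=; rewrite (starhomX hh) ?(starhomS hh). Qed.

Lemma lpoly_hom (R : realType) (A B : cstarAlgType R) (h : A -> B) (u v : A)
    (I : finType) (c : I -> cplx R) (m n : I -> int) :
  starhom h -> h (lpoly u v c m n) = lpoly (h u) (h v) c m n.
Proof.
move=> hh; rewrite (starhom_sum hh); apply: eq_bigr => i _.
by rewrite (starhomZ hh) /monom (starhomM hh) !(upow_hom _ _ hh).
Qed.

Section Simplicity.
Context (R : realType) (theta : R) (thetaP : irrational theta).
Context (A : rotationAlgebra theta).
Local Notation lam := (expi theta).
Local Notation U := (ra_U A).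
Local Notation V := (ra_V A).

Lemma lpoly_dense (a : A) (e : R) : 0 < e ->
  exists (I : finType) (c : I -> cplx R) (m n : I -> int),
    cnorm (a - lpoly U V c m n) < e.
Proof.
have UV := ra_rel A.
pose Q := [set q : A | exists (I : finType) (c : I -> cplx R) (m n : I -> int),
  q = lpoly U V c m n].
have Q_monom k m n : Q (k *: monom U V m n).
  by exists unit, (fun=> k), (fun=> m), (fun=> n); rewrite /lpoly big_const
      card_unit /= addr0.
have QD x y : Q x -> Q y -> Q (x + y).
  move=> [I [c [m [n ->]]]] [J [d [k [l ->]]]].
  exists (I + J)%type, (fun s => match s with inl i => c i | inr j => d j end),
    (fun s => match s with inl i => m i | inr j => k j end),
    (fun s => match s with inl i => n i | inr j => l j end).
  by rewrite /lpoly big_sumType.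
have Q0 : Q 0 by have := Q_monom 0 0 0; rewrite scale0r.
have Q_sum (I : finType) (F : I -> A) : (forall i, Q (F i)) -> Q (\sum_i F i).
  by move=> QF; apply: big_ind.
have QZ k x : Q x -> Q (k *: x).
  move=> [I [c [m [n ->]]]]; rewrite scaler_sumr; apply: (Q_sum) => i.
  by rewrite scalerA.
have Q1 : Q 1 by have := Q_monom 1 0 0; rewrite /monom !upow0 mulr1 scale1r.
suff H : forall b : A, [set b | forall e, 0 < e -> exists2 q, Q q & cnorm (b - q) <
    e] b.
  by move=> e0; have [q [I [c [m [n ->]]]] ?] := H a e e0; exists I, c, m, n.
apply: rotationAlgebra_ind.
- apply: closure_star_subalgebra => //.
  + by move=> k x y Qx Qy; apply: QD => //; exact: QZ.
  + move=> x y [I [c [m [n ->]]]] [J [d [k [l ->]]]].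
    rewrite mulr_suml; apply: (Q_sum) => i; rewrite mulr_sumr; apply: (Q_sum) => j.
    by rewrite -scalerAl -scalerAr (monom_mul UV) !scalerA.
  + move=> x [I [c [m [n ->]]]].
    rewrite (big_morph _ (@starD R A) (@star0 R A)); apply: (Q_sum) => i.
    by rewrite starZ (monom_star UV) scalerA.
- move=> d d0; exists U; last by rewrite subrr cnorm0.
  by have := Q_monom 1 1 0; rewrite /monom upow0 upow1 mulr1 scale1r.
- move=> d d0; exists V; last by rewrite subrr cnorm0.
  by have := Q_monom 1 0 1; rewrite /monom upow0 upow1 mul1r scale1r.
Qed.

Context (B : cstarAlgType R) (h : A -> B) (hh : starhom h).

Definition cesaro (M : nat) (I : finType) (c : I -> cplx R) (m n : I -> int)
    (i : I) : cplx R :=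
  fejer theta M (- n i) * (fejer theta M (m i) * c i).

(** The Fejer kernel is nonnegative with mean value [1]. *)
Lemma cesaro_contractive M (I : finType) (c : I -> cplx R) (m n : I -> int) :
  cnorm (lpoly U V (cesaro M c m n) m n) <= cnorm (lpoly U V c m n).
Proof.
apply: (lpoly_multiplier (ra_rel A)).
- by move=> x; exact: rnorm_expiXz.
- by move=> x; exact: rnorm_expiXz.
- apply: average_nonneg_kernel => [t|j|]; [exact: rnorm_expiXz|exact:
    fejer_kernel_ge0|].
  exact: (fejer0 thetaP).
- apply: average_nonneg_kernel => [t|j|]; [exact: rnorm_expiXz|exact:
    fejer_kernel_ge0|].
  exact: (fejer0 thetaP).
Qed.

(** The terms selected by two resonance conditions are multiples of a single
    monomial. *)
Lemma resonant_sum (D : cstarAlgType R) (u v : D) (I : finType)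
    (c : I -> cplx R) (m n : I -> int) (a b : int) :
  lpoly u v (fun i => (a + m i == 0)%:R * ((b - n i == 0)%:R * c i)) m n =
  (\sum_i ((a + m i == 0)%:R * ((b - n i == 0)%:R * c i))) *: monom u v (- a) b.
Proof.
rewrite scaler_suml; apply: eq_bigr => i _.
case: eqP => [am|]; last by rewrite !mul0r !scale0r.
case: eqP => [bn|]; last by rewrite !mul0r mulr0 !scale0r.
have -> : m i = - a by apply/eqP; rewrite -subr_eq0 opprK addrC am.
by have -> : n i = b by apply/eqP; rewrite eq_sym -subr_eq0 bn.
Qed.

(** A Fourier coefficient is the average of the element against a character. *)
Lemma coefficient_le (I : finType) (c : I -> cplx R) (m n : I -> int) (a b : int) :
  rnorm (\sum_i ((a + m i == 0)%:R * ((b - n i == 0)%:R * c i))) <=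
  cnorm (h (lpoly U V c m n)).
Proof.
have hUV := rotation_pair_comp (ra_rel A) hh.
rewrite (lpoly_hom _ _ _ _ _ hh).
have K (k : int) : forall e, 0 < e -> \forall N \near \oo,
     \sum_(j < N.+1) rnorm (kernel_value (fun _ : unit => 1) (fun=> lam ^ k) j) <=
         (1 + e) * N.+1%:R.
  move=> e e0; apply: nearW => N.
  under eq_bigr => j _.
    rewrite /kernel_value big_const card_unit /= addr0 mul1r.
    rewrite expiXz expiXn rnorm_expi; over.
  by rewrite sumr_const card_ord ler_peMl// lerDl ltW.
have := lpoly_multiplier hUV c m n (fun=> rnorm_expiXz theta _) (fun=> rnorm_expiXz
    theta _) (K a) (K b).
apply: le_trans.
have E (k l : int) : multiplier (fun _ : unit => 1) (fun=> lam ^ k) (lam ^ l) = (k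
    + l == 0)%:R.
  rewrite /multiplier big_const card_unit /= addr0 mul1r -expfzDr ?expi_neq0//.
  by rewrite -(expr0z lam) expi_eq.
rewrite /lpoly; under [X in _ <= cnorm X]eq_bigr do rewrite !E mulrCA.
by rewrite [X in cnorm X](resonant_sum (h U) (h V)) cnormZr (cnorm_monom hUV) mulr1.
Qed.

Lemma cesaro_cvg (I : finType) (c : I -> cplx R) (m n : I -> int) (e : R) :
  0 < e -> exists M,
  cnorm (lpoly U V c m n - lpoly U V (cesaro M c m n) m n) <= e.
Proof.
move=> e0.
pose K := \sum_i (`|n i|%N%:R * (1 + `|m i|%N%:R) + `|m i|%N%:R) * rnorm (c i) + 1 : R.
have K0 : 0 < K.
  rewrite ltr_wpDl// sumr_ge0// => i _.
  by rewrite mulr_ge0 ?rnorm_ge0// addr_ge0// mulr_ge0// addr_ge0.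
have [M _ MP] := nbhs_infty_ger (K / e).
exists M; have {MP} := MP M (leqnn M).
rewrite /= ler_pdivrMr// => KM.
have Mp : 0 < M.+1%:R :> R by [].
rewrite -sumrB; apply: (le_trans (cnorm_sum _ _)).
apply: (@le_trans _ _ (K / M.+1%:R)); last first.
  rewrite ler_pdivrMr// mulrC (le_trans KM)// ler_wpM2r ?ltW//.
  by rewrite ltr_nat.
rewrite /K mulrDl -[X in X <= _]addr0; apply: lerD; last by rewrite divr_ge0.
rewrite mulr_suml; apply: ler_sum => i _.
rewrite -scalerBl cnormZr (cnorm_monom (ra_rel A)) mulr1 /cesaro.
set f := fejer theta M (- n i); set g := fejer theta M (m i).
have -> : c i - f * (g * c i) = - ((f - 1) * g + (g - 1)) * c i by ring.
rewrite rnormM rnormN mulrAC ler_wpM2r ?rnorm_ge0//.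
have f1 : rnorm (f - 1) <= `|n i|%N%:R / M.+1%:R.
  by have := fejer_near1 thetaP M (- n i); rewrite abszN.
have g1 : rnorm (g - 1) <= `|m i|%N%:R / M.+1%:R by exact: fejer_near1.
have gb : rnorm g <= 1 + `|m i|%N%:R.
  rewrite -[g](subrK 1) addrC (le_trans (rnormD _ _))// rnorm1 lerD2l.
  by rewrite (le_trans g1)// ler_pdivrMr// ler_peMr// ler1n.
apply: (le_trans (rnormD _ _)); rewrite [leRHS]mulrDl; apply: lerD => //.
rewrite rnormM mulrAC; apply: ler_pM; rewrite ?rnorm_ge0//.
Qed.

(** A Cesaro mean involves a fixed finite number of Fourier coefficients. *)
Lemma cesaro_bound M : exists2 C, 0 < C & forall (I : finType)
    (c : I -> cplx R) (m n : I -> int),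
  cnorm (lpoly U V (cesaro M c m n) m n) <= C * cnorm (h (lpoly U V c m n)).
Proof.
pose T := ('I_M.+1 * 'I_M.+1)%type.
pose w : cplx R := (M.+1%:R^-1)%:C%C.
exists (\sum_(s : T) \sum_(t : T) rnorm (w * w) + 1) => [|I c m n].
  rewrite ltr_wpDl// sumr_ge0// => s _; rewrite sumr_ge0// => t _.
  exact: rnorm_ge0.
apply: (@le_trans _ _ (\sum_(s : T) \sum_(t : T) rnorm (w * w) * cnorm (h (lpoly U
    V c m n)))); last first.
  under eq_bigr do rewrite -mulr_suml.
  by rewrite -mulr_suml ler_wpM2r ?cnorm_ge0// lerDl.
pose g (s t : T) i : cplx R := (t.1%:Z - t.2%:Z + m i == 0)%:R *
    ((s.1%:Z - s.2%:Z - n i == 0)%:R * c i).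
have -> : lpoly U V (cesaro M c m n) m n =
    \sum_(s : T) \sum_(t : T) (w * w) *: lpoly U V (g s t) m n.
  have coef i : cesaro M c m n i = \sum_(s : T) \sum_(t : T) w * w * g s t i.
    rewrite /cesaro !fejerE// mulr_suml; apply: eq_bigr => s _.
    rewrite mulr_suml mulr_sumr; apply: eq_bigr => t _; rewrite /g /w; ring.
  rewrite /lpoly; under eq_bigr => i _.
    rewrite coef scaler_suml; under eq_bigr do rewrite scaler_suml.
    over.
  rewrite exchange_big; apply: eq_bigr => s _ /=.
  rewrite exchange_big; apply: eq_bigr => t _ /=.
  by rewrite scaler_sumr; apply: eq_bigr => i _; rewrite scalerA.
apply: (le_trans (cnorm_sum _ _)); apply: ler_sum => s _.
apply: (le_trans (cnorm_sum _ _)); apply: ler_sum => t _.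
rewrite cnormZr ler_wpM2l ?rnorm_ge0//.
apply: le_trans (coefficient_le c m n (t.1%:Z - t.2%:Z) (s.1%:Z - s.2%:Z)).
have -> : lpoly U V (g s t) m n = (\sum_i g s t i) *:
    monom U V (- (t.1%:Z - t.2%:Z)) (s.1%:Z - s.2%:Z).
  exact: resonant_sum.
by rewrite cnormZr (cnorm_monom (ra_rel A)) mulr1.
Qed.

(** If [h a = 0], approximate [a] by a polynomial, then that polynomial by its
    Cesaro means; these are controlled by Fourier coefficients, hence by the
    norm of the image under [h], which is small. *)
Theorem rotationAlgebra_simple (a : A) : h a = 0 -> a = 0.
Proof.
move=> ha; apply: cnorm_small0 => e e0.
(* The final estimate adds [|a - p|], [|p - cesaro p|], [|p - p'|], counted twice,
   and [|cesaro p'|]. *)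
have d0 : 0 < e / 5 by rewrite divr_gt0.
have [I [c [m [n ap]]]] := lpoly_dense a d0; set p := lpoly U V c m n in ap.
have [M pM] : exists M, cnorm (p - lpoly U V (cesaro M c m n) m n) <= e / 5.
  exact: cesaro_cvg.
have [C C0 HC] := cesaro_bound M.
have [J [c' [m' [n' ap']]]] := lpoly_dense a (divr_gt0 d0 (ltr_wpDl (ltW C0)
    (@ltr01 R))).
set p' := lpoly U V c' m' n' in ap'.
have C1 : 0 < C + 1 by lra.
have dC : e / 5 / (C + 1) <= e / 5 by rewrite ler_pdivrMr// ler_peMr ?ltW//; lra.
have pp : cnorm (lpoly U V (cesaro M c m n) m n - lpoly U V (cesaro M c' m' n') m'
    n') <=
    cnorm (p - p').
  pose cc (s : I + J) := match s with inl i => c i | inr j => - c' j end.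
  pose mm (s : I + J) := match s with inl i => m i | inr j => m' j end.
  pose nn (s : I + J) := match s with inl i => n i | inr j => n' j end.
  have := cesaro_contractive M cc mm nn.
  rewrite /lpoly !big_sumType /= => le; rewrite /p /p' /lpoly -!sumrN.
  under [X in cnorm (_ + X) <= _]eq_bigr do rewrite -scaleNr.
  under [X in _ <= cnorm (_ + X)]eq_bigr do rewrite -scaleNr.
  apply: le_trans le; rewrite le_eqVlt; apply/orP; left; apply/eqP.
  by congr (cnorm (_ + _)); apply: eq_bigr => j _; rewrite /cesaro /= !mulrN.
have p'M : cnorm (lpoly U V (cesaro M c' m' n') m' n') <= e / 5.
  apply: (le_trans (HC _ _ _ _)); rewrite -/p'.
  have -> : h p' = - h (a - p') by rewrite (starhomB hh) ha sub0r opprK.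
  rewrite cnormN; have := starhom_contractive hh (a - p').
  move: ap'; rewrite ltr_pdivlMr//; have := cnorm_ge0 (h (a - p')); nra.
have -> : a = (a - p) + (p - lpoly U V (cesaro M c m n) m n) +
   (lpoly U V (cesaro M c m n) m n - lpoly U V (cesaro M c' m' n') m' n') +
   lpoly U V (cesaro M c' m' n') m' n' by rewrite !addrA !subrK.
have := cnorm_split a p p'; rewrite (cnormBC p a).
have := cnormD ((a - p) + (p - lpoly U V (cesaro M c m n) m n) +
   (lpoly U V (cesaro M c m n) m n - lpoly U V (cesaro M c' m' n') m' n'))
   (lpoly U V (cesaro M c' m' n') m' n').
have := cnormD ((a - p) + (p - lpoly U V (cesaro M c m n) m n))
   (lpoly U V (cesaro M c m n) m n - lpoly U V (cesaro M c' m' n') m' n').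
have := cnormD (a - p) (p - lpoly U V (cesaro M c m n) m n).
lra.
Qed.

End Simplicity.

(** * Algebras of continuous functions *)

Section RealContinuity.
Context (R : realType).

Lemma near_rnorm_lt (z : cplx R) (e : R) : 0 < e ->
  \forall y \near z, rnorm (z - y) < e.
Proof.
move=> e0; have e0C : 0 < e%:C%C :> cplx R by rewrite ltcR.
have H := @cvgr_dist_lt _ _ _ (nbhs z) (nbhs_filter z) id z cvg_id _ e0C.
by apply: filterS H => y; rewrite -rnormE ltcR.
Qed.

(** Convergence in [cplx R], tested with real epsilons. *)
Lemma cvg_rnorm (T : Type) (F : set_system T) (FF : Filter F) (f : T -> cplx R)
    (l : cplx R) :
  (forall e : R, 0 < e -> \forall t \near F, rnorm (l - f t) < e) -> f @ F --> l.
Proof.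
move=> H; apply/(@cvgrPdist_lt _ _ _ F) => e e0.
have eE : (complex.Re e)%:C%C = e by apply: RRe_real; exact: gtr0_real.
have e0' : 0 < complex.Re e by rewrite -ltcR eE.
by apply: filterS (H _ e0') => t; rewrite -eE -rnormE ltcR.
Qed.

Lemma rnorm_continuous : continuous (@rnorm R (cplx R)).
Proof.
move=> z; apply/(@cvgrPdist_lt _ _ _ (nbhs z)) => e e0.
apply: filterS (near_rnorm_lt z e0) => y; apply: le_lt_trans.
have := rnormD (z - y) y; have := rnormD (y - z) z; rewrite !subrK (rnormBC y z).
by rewrite ler_norml; lra.
Qed.

Lemma real_complex_continuous : continuous (fun r : R => r%:C%C : cplx R).
Proof.
move=> r; apply: cvg_rnorm => e e0.
have H := @cvgr_dist_lt _ _ _ (nbhs r) (nbhs_filter r) id r cvg_id _ e0.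
apply: filterS H => y.
by rewrite -(rnorm_real (r - y)) rmorphB.
Qed.

Context (X : ptopologicalType).

Definition cfun_real (u : X -> R) (uc : continuous u) : cfun R X :=
  mkcts (fun x => @continuous_comp _ _ _ u _ x (uc x)
    (@real_complex_continuous (u x))).

Lemma cfun_realE u uc x : @cfun_real u uc x = (u x)%:C%C.
Proof. by []. Qed.

Lemma cfun_rnorm_continuous (f : cfun R X) : continuous (fun x => rnorm (f x)).
Proof.
move=> x; apply: (@continuous_comp X (cplx R) R (fun x => f x) (@rnorm R (cplx R)) x).
  exact: cts_fun.
exact: rnorm_continuous.
Qed.

Definition cfun_norm (f : cfun R X) : cfun R X :=
  cfun_real (@cfun_rnorm_continuous f).

Lemma star_mul_norm (f : cfun R X) : star f * f = cfun_norm f * cfun_norm f.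
Proof.
apply/continuousEP => x /=.
have -> : (star f * f) x = (f x)^* * f x by [].
have -> : (cfun_norm f * cfun_norm f) x = (rnorm (f x))%:C%C * (rnorm (f x))%:C%C by [].
by rewrite mulrC -normCK -rnormE expr2.
Qed.

Lemma cfun_real_star u uc : star (@cfun_real u uc) = cfun_real uc.
Proof. by apply/continuousEP => x; exact: conjC_real. Qed.

(** As for C*-algebras, with the square root [sqrt (1 - u^2)] of functions. *)
Lemma cfun_real_contractive (A : cstarAlgType R) (j : cfun R X -> A)
    (jh : starhom j) (u : X -> R) (uc : continuous u) (M : R) :
  0 <= M -> (forall x, `|u x| <= M) -> cnorm (j (cfun_real uc)) <= M.
Proof.
move=> M0 uM; apply: le_of_eps => e e0; set N := M + e.
have N0 : 0 < N by rewrite ltr_wpDl.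
pose v x := u x / N.
have vc : continuous v by move=> x; apply: cvgM; [exact: uc|exact: cvg_cst].
have v1 x : `|v x| <= 1.
  rewrite normrM normfV (gtr0_norm N0) ler_pdivrMr// mul1r.
  by rewrite (le_trans (uM x))// lerDl ltW.
pose w x := Num.sqrt (1 - v x * v x).
have wc : continuous w.
  move=> x; apply: (@continuous_comp _ _ _ (fun x => 1 - v x * v x)); last exact:
      sqrt_continuous.
  by apply: cvgB; [exact: cvg_cst|apply: cvgM; exact: vc].
have vw : cfun_real vc * cfun_real vc + cfun_real wc * cfun_real wc = 1.
  apply/continuousEP => x.
  transitivity ((v x)%:C%C * (v x)%:C%C + (w x)%:C%C * (w x)%:C%C : cplx R) => //.
  rewrite -!rmorphM -rmorphD /= -(expr2 (w x)) sqr_sqrtr; last first.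
    by rewrite subr_ge0 -expr2 -real_normK ?num_real// expr_le1.
  by rewrite addrC subrK.
have vwC : cfun_real vc * cfun_real wc = cfun_real wc * cfun_real vc.
  by apply/continuousEP => x; exact: mulrC.
have := starhom_real_part jh (cfun_real_star vc) (cfun_real_star wc) vwC vw.
have -> : cfun_real vc = (N^-1)%:C%C *: cfun_real uc.
  apply/continuousEP => x; rewrite cfun_realE /v mulrC rmorphM; by [].
rewrite (starhomZ jh) cnormZr rnorm_real ger0_norm ?invr_ge0; last exact: ltW.
by rewrite mulrC ler_pdivrMr// mul1r.
Qed.

Lemma cfun_contractive (A : cstarAlgType R) (j : cfun R X -> A)
    (jh : starhom j) (f : cfun R X) (M : R) :
  0 <= M -> (forall x, rnorm (f x) <= M) -> cnorm (j f) <= M.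
Proof.
move=> M0 fM; rewrite -(@ler_pXn2r _ 2) ?nnegrE ?cnorm_ge0//.
rewrite -cnorm_star -(starhomS jh) -(starhomM jh) star_mul_norm (starhomM jh).
have H : cnorm (j (cfun_norm f)) <= M.
  apply: (cfun_real_contractive jh) => // x.
  by rewrite ger0_norm ?rnorm_ge0.
by rewrite (le_trans (cnormM _ _))// expr2 ler_pM ?cnorm_ge0.
Qed.

Context (Xc : compact [set: X]).

(** Otherwise finitely many [|f|^2] with [f] in the ideal add up to a function
    without zeros, which is invertible. *)
Lemma ideal_common_zero (J : set (cfun R X)) :
  (forall f g, J f -> J g -> J (f + g)) -> (forall f g, J f -> J (g * f)) ->
  J 0 -> ~ J 1 -> exists x, forall f, J f -> f x = 0.
Proof.
move=> ID IM I0 I1; apply: contrapT => nx; apply: I1.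
have ex x : exists f, J f /\ f x <> 0.
  apply: contrapT => H; apply: nx; exists x => f If.
  by apply: contrapT => fx; apply: H; exists f.
have [F FP] := choice ex.
have := Xc; rewrite compact_cover => cov.
have [|x _|D _ Dcov] := cov X setT (fun x => [set y | F x y != 0]).
- move=> x _; apply: (@open_comp _ _ (F x) [set z | z != 0]).
    by move=> y _; exact: cts_fun.
  have -> : [set z : cplx R | z != 0] = ~` [set 0].
    by apply/seteqP; split=> z /eqP.
  apply: closed_openC.
  exact/accessible_closed_set1/hausdorff_accessible/norm_hausdorff.
- by exists x => //=; apply/eqP; case: (FP x).
pose g : cfun R X := \sum_(x <- finmap.enum_fset D) star (F x) * F x.
have Ig : J g by apply: big_ind => // x _; apply: IM; case: (FP x).
have gE y : g y = \sum_(x <- finmap.enum_fset D) `|F x y| ^+ 2.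
  have ev : {morph (fun f : cfun R X => f y : cplx R) : f h / f + h >-> f + h} by [].
  rewrite /g (big_morph (fun f : cfun R X => f y : cplx R) ev (erefl _)).
  apply: eq_bigr => x _; rewrite normCK mulrC; by [].
have g0 y : g y != 0.
  have [x xD Fxy] := Dcov y I.
  rewrite gE psumr_neq0 => [|i _]; last by rewrite exprn_ge0.
  by apply/hasP; exists x => //=; rewrite exprn_gt0// normr_gt0.
have gVc : continuous (fun y => (g y)^-1 : cplx R).
  by move=> y; apply: cvgV => //; exact: cts_fun.
have -> : 1 = (mkcts gVc : cfun R X) * g; last exact: IM.
apply/continuousEP => y; symmetry; exact: (mulVf (g0 y)).
Qed.

(** A common zero [x] of the kernel is a point where the representation is
    concentrated: for [f x = 0], the positive parts of [|f| - e] and [e - |f|]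
    have product [0], and the latter does not vanish at [x]. *)
Lemma prime_character (A : cstarAlgType R) (j : cfun R X -> A) (jh : starhom j) :
  (forall f g, f * g = 0 -> j f = 0 \/ j g = 0) ->
  exists x, forall f, j f = (f x : cplx R) *: 1.
Proof.
move=> jP; have [|||j1|x xP] := @ideal_common_zero [set f | j f = 0].
- by move=> f g /= f0 g0; rewrite (starhomD jh) f0 g0 addr0.
- by move=> f g /= f0; rewrite (starhomM jh) f0 mulr0.
- exact: starhom0.
- by have := @oner_neq0 A; rewrite -(starhom1 jh) j1 eqxx.
exists x => f; suff zero (g : cfun R X) : g x = 0 -> j g = 0.
  apply/eqP; rewrite -subr_eq0 -(starhom1 jh) -(starhomZ jh) -(starhomB jh).
  apply/eqP/zero; rewrite [LHS](_ : _ = f x - f x * 1)//.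
  by rewrite mulr1 subrr.
move=> gx; apply: cnorm_small0 => e e0.
pose t (y : X) : R := rnorm (g y) - e.
have tc : continuous t.
  by move=> y; apply: cvgB; [exact: cfun_rnorm_continuous|exact: cvg_cst].
pose u (y : X) : R := t y + `|t y|; pose v (y : X) : R := `|t y| - t y.
have uc : continuous u.
  by move=> y; apply: cvgD; [exact: tc|apply: cvg_norm; exact: tc].
have vc : continuous v.
  by move=> y; apply: cvgB; [apply: cvg_norm; exact: tc|exact: tc].
have uv : cfun_real uc * cfun_real vc = 0.
  apply/continuousEP => y; transitivity ((u y)%:C%C * (v y)%:C%C : cplx R) => //.
  have : `|t y| * `|t y| = t y * t y by rewrite -expr2 real_normK ?num_real.
  by rewrite -rmorphM /= /u /v => tt; rewrite (_ : _ * _ = 0)//; ring: tt.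
have u0 : j (cfun_real uc) = 0.
  case: (jP _ _ uv) => // /xP /(@complexI R); rewrite /v /t gx rnorm0 sub0r normrN.
  rewrite gtr0_norm// opprK => ee.
  by move: e0; rewrite -(pmulrn_lgt0 _ (ltn0Sn 1)) mulr2n ee ltxx.
pose d (y : X) : R := rnorm (g y) - u y / 2.
have dc : continuous d.
  move=> y; apply: cvgB; first exact: cfun_rnorm_continuous.
  by apply: cvgM; [exact: uc|exact: cvg_cst].
have nE : cfun_norm g = cfun_real dc + (2^-1)%:C%C *: cfun_real uc.
  apply/continuousEP => y.
  transitivity ((d y)%:C%C + (2^-1)%:C%C * (u y)%:C%C : cplx R) => //.
  rewrite -rmorphM -rmorphD /=; congr (_%:C%C); rewrite /d; lra.
have jn : cnorm (j (cfun_norm g)) <= e.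
  rewrite nE (starhomD jh) (starhomZ jh) u0 scaler0 addr0.
  apply: (cfun_real_contractive jh); first exact: ltW.
  move=> y; rewrite /d /u /t; have := rnorm_ge0 (g y).
  by case: (ger0P (rnorm (g y) - e)) => h1 h2; rewrite ler_norml; lra.
rewrite -(@ler_pXn2r _ 2) ?nnegrE ?cnorm_ge0//; last exact: ltW.
rewrite -cnorm_star -(starhomS jh) -(starhomM jh) star_mul_norm (starhomM jh).
by rewrite (le_trans (cnormM _ _))// expr2 ler_pM ?cnorm_ge0.
Qed.

End RealContinuity.

(** * Subsets of the complex plane *)

Section Subtypes.
Context (T : topologicalType) (K : set T).
Local Notation v := (set_val : K -> T).

Lemma sub_nbhsP (x : K) (U : set K) :
  nbhs x U <-> exists2 V, nbhs (v x) V & v @^-1` V `<=` U.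
Proof.
split=> [|[V xV VU]]; last first.
  have vc : continuous v by exact: initial_continuous.
  by apply: filterS VU _; exact: vc.
rewrite nbhsE => -[W [[V Vo VW] Wx] WU]; exists V.
  by exists V => //; split=> //; move: Wx; rewrite -VW.
by rewrite VW.
Qed.

(** A property of points of [K] is turned into one of points of [T], which can
    be fed to the covering form of compactness. *)
Lemma sub_compact (C : set T) : C `<=` K -> compact C -> compact (v @^-1` C).
Proof.
move=> CK /compact_near_coveringP Cc; apply/compact_near_coveringP.
move=> I F P FF HP.
pose P' (i : I) (t : T) := forall k : K, v k = t -> P i k.
have : \near F, C `<=` P' F.
  apply: Cc => x Cx; pose k0 : K := to_set (CK x Cx).
  have [[A B] [/= A0 FB AB]] := HP k0 Cx.
  have [V V0 VA] := (sub_nbhsP k0 A).1 A0.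
  exists (V, B) => //= -[y i] [/= Vy Bi] k ky.
  by apply: (AB (k, i)); split=> //=; apply: VA; rewrite /= ky.
by apply: filterS => i HC k Ck; exact: (HC (v k) Ck k erefl).
Qed.

End Subtypes.

Section SubBalls.
Context (F : numDomainType) (T : pseudoMetricType F) (K : set T).
Local Notation v := (set_val : K -> T).

Lemma sub_ballP (x : K) (U : set K) :
  nbhs x U <-> exists2 e : F, 0 < e & forall y, ball (v x) e (v y) -> U y.
Proof.
split=> [/sub_nbhsP[V + VU]|[e e0 eU]].
  by move=> /nbhs_ballP[e /= e0 eV]; exists e => // y xy; apply: VU; exact: eV.
by apply/sub_nbhsP; exists (ball (v x) e) => //; exact: nbhsx_ballx.
Qed.

Lemma sub_closedP (Y : set K) : closed Y <->
  forall x, (forall e : F, 0 < e -> exists2 y, Y y & ball (v x) e (v y)) -> Y x.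
Proof.
split=> [Yc x xY|H x xY].
  apply: Yc => U /sub_ballP[e e0 eU]; have [y Yy xy] := xY e e0.
  by exists y; split=> //; exact: eU.
apply: H => e e0.
have [y [Yy xy]] : Y `&` [set y | ball (v x) e (v y)] !=set0.
  by apply: xY; apply/sub_ballP; exists e.
by exists y.
Qed.
End SubBalls.

Section PlaneSubsets.
Context (R : realType) (K : set (cplx R)).
Local Notation v := (set_val : K -> cplx R).

Lemma cplx_eps (e : cplx R) : 0 < e -> exists2 d : R, 0 < d & d%:C%C = e.
Proof.
move=> e0; have eE : (complex.Re e)%:C%C = e by apply: RRe_real; exact: gtr0_real.
by exists (complex.Re e) => //; rewrite -ltcR eE.
Qed.

Lemma plane_ball (z y : cplx R) (d : R) : ball z d%:C%C y <-> rnorm (z - y) < d.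
Proof. by rewrite -ball_normE /= -rnormE ltcR. Qed.

Lemma plane_nbhsP (x : K) (U : set K) : nbhs x U <->
  exists2 d : R, 0 < d & forall y, rnorm (v x - v y) < d -> U y.
Proof.
split=> [/sub_ballP[e e0 eU]|[d d0 dU]].
  have [d d0 de] := cplx_eps e0; exists d => // y xy.
  by apply: eU; rewrite -de; exact/plane_ball.
apply/sub_ballP; exists d%:C%C; first by rewrite ltcR.
by move=> y /plane_ball; exact: dU.
Qed.

Lemma plane_closedP (Y : set K) : closed Y <->
  forall x, (forall e : R, 0 < e -> exists2 y, Y y & rnorm (v x - v y) < e) -> Y x.
Proof.
split=> [/sub_closedP Yc x xY|H].
  apply: Yc => e e0; have [d d0 <-] := cplx_eps e0; have [y Yy xy] := xY d d0.
  by exists y => //; exact/plane_ball.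
apply/sub_closedP => x xY; apply: H => e e0.
have [|y Yy xy] := xY e%:C%C; first by rewrite ltcR.
by exists y => //; exact/plane_ball.
Qed.

Lemma plane_continuousP (f : K -> cplx R) : continuous f <->
  forall x (e : R), 0 < e -> exists2 d : R, 0 < d &
    forall y, rnorm (v x - v y) < d -> rnorm (f x - f y) < e.
Proof.
split=> [fc x e e0|H x].
  have /plane_nbhsP[d d0 dU] : nbhs x [set y | rnorm (f x - f y) < e].
    exact: (fc x _ (near_rnorm_lt (f x) e0)).
  by exists d.
apply: (@cvg_rnorm _ _ (nbhs x)) => e e0; have [d d0 dU] := H x e e0.
by apply/plane_nbhsP; exists d.
Qed.

Lemma plane_uniform (f : K -> cplx R) : compact K -> continuous f ->
  forall e : R, 0 < e -> exists2 d : R, 0 < d &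
    forall x y, rnorm (v x - v y) < d -> rnorm (f x - f y) < e.
Proof.
move=> Kc fc e e0.
have KTc : compact [set: K].
  rewrite [X in compact X](_ : _ = v @^-1` K); first exact: sub_compact.
  by apply/seteqP; split=> // x _; exact: set_valP.
have /compact_near_coveringP cov := KTc.
pose P (d : R) (x : K) := forall y, rnorm (v x - v y) < d -> rnorm (f x - f y) < e.
have e2 : 0 < e / 2 by rewrite divr_gt0.
have : \forall d \near (0 : R)^'+, [set: K] `<=` P d.
  apply: cov => x _; have [d d0 dU] := (plane_continuousP f).1 fc x _ e2.
  have d2 : 0 < d / 2 by rewrite divr_gt0.
  exists ([set y : K | rnorm (v x - v y) < d / 2], [set t | t < d / 2]).
    split=> /=; first by apply/plane_nbhsP; exists (d / 2).
    exact: nbhs_right_lt.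
  move=> [y t] [/= xy td] z yz.
  have xz : rnorm (v x - v z) < d by have := rnorm_split (v y) (v x) (v z); lra.
  have xy' : rnorm (v x - v y) < d by lra.
  have := dU _ xz; have := dU _ xy'.
  have := rnorm_split (f x) (f y) (f z); rewrite (rnormBC (f y) (f x)); lra.
move=> H; have [d [d0 dP]] : exists d : R, 0 < d /\ [set: K] `<=` P d.
  apply: (@filter_ex _ (0 : R)^'+); apply: filterI => //.
  exact: nbhs_right_gt.
by exists d => // x y; exact: dP.
Qed.

End PlaneSubsets.

Section DiskCompact.
Context (R : realType).

Lemma disk_set_compact : compact (disk_set R).
Proof.
pose h (p : R * R) : cplx R := p.1%:C%C + 'i%C * p.2%:C%C.
have hc : continuous h.
  move=> p; apply: cvgD.
    apply: (@continuous_comp _ _ _ (@fst R R) (fun r : R => r%:C%C : cplx R)).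
      exact: cvg_fst.
    exact: real_complex_continuous.
  apply: cvgM; first exact: cvg_cst.
  apply: (@continuous_comp _ _ _ (@snd R R) (fun r : R => r%:C%C : cplx R)).
    exact: cvg_snd.
  exact: real_complex_continuous.
apply: (@subclosed_compact _ _ (h @` (`[-1, 1] `*` `[-1, 1]))).
- rewrite [X in closed X](_ : _ = @rnorm R (cplx R) @^-1` [set r | r <= 1]).
    by apply: preimage_closed; [move=> z _; exact: rnorm_continuous|exact: closed_le].
  by apply/seteqP; split=> z /=; rewrite /disk_set /= -rnormE lecR.
- apply: continuous_compact; first exact/continuous_subspaceT.
  by apply: compact_setX; exact: segment_compact.
- move=> z; rewrite /disk_set /= -rnormE lecR => z1.
  exists (complex.Re z, complex.Im z); last by rewrite /h /= -complexE.
  have H (x : R) : `|x|%:C%C <= `|z| -> x \in `[-1, 1].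
    by rewrite -rnormE lecR in_itv /= -ler_norml => /le_trans; exact.
  by split; apply: H; [exact: cline_Re|exact: cline_Im].
Qed.

Lemma circle_set_compact (r : I01 R) : compact (circle_set r).
Proof.
apply: (subclosed_compact _ disk_set_compact); last exact: circle_disk.
rewrite [X in closed X](_ : _ = @rnorm R (cplx R) @^-1` [set set_val r]).
  apply: preimage_closed; first by move=> z _; exact: rnorm_continuous.
  exact/accessible_closed_set1/hausdorff_accessible/norm_hausdorff.
apply/seteqP; split=> z; rewrite /circle_set /= -rnormE; first by move/complexI.
by move=> ->.
Qed.

Lemma circle_compact (r : I01 R) : compact [set: circle r].
Proof.
rewrite [X in compact X](_ : _ = set_val @^-1` circle_set r).
  by apply: sub_compact => //; exact: circle_set_compact.
by apply/seteqP; split=> // x _; exact: set_valP.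
Qed.

End DiskCompact.

Section Radius.
Context (R : realType).

Lemma oc01_closedP (F : set (oc01 R)) : closed F <->
  forall r, (forall e : R, 0 < e ->
    exists2 s, F s & `|set_val r - set_val s| < e) -> F r.
Proof.
split=> [/sub_closedP Fc r rF|H].
  by apply: Fc => e /rF[s Fs rs]; exists s.
by apply/sub_closedP => r rF; apply: H => e /rF[s Fs rs]; exists s.
Qed.

Lemma oc01_compactP (X : set (oc01 R)) : compact X <->
  closed X /\ exists2 d : R, 0 < d & forall s, X s -> d <= set_val s.
Proof.
split=> [Xc|[Xc [d d0 dX]]].
  split; first exact: compact_closed (@oc01_hausdorff R) Xc.
  have /compact_near_coveringP cov := Xc.
  have : \forall d \near (0 : R)^'+, X `<=` [set s | d <= set_val s].
    apply: (cov R _ (fun d => [set s : oc01 R | d <= set_val s])) => s _.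
    have /andP[s0 _] := set_valP s.
    have s2 : 0 < set_val s / 2 by rewrite divr_gt0.
    exists ([set t : oc01 R | set_val s / 2 < set_val t], [set t | t < set_val s / 2]).
      split=> /=; last exact: nbhs_right_lt.
      apply/sub_ballP; exists (set_val s / 2) => // t st.
      have {}st : `|set_val s - set_val t| < set_val s / 2 by [].
      by move: st; rewrite ltr_distl /=; lra.
    by move=> [t d] /= [/= st ds]; lra.
  move=> H; have [d [d0 dX]] : exists d : R, 0 < d /\ X `<=` [set s | d <= set_val s].
    apply: (@filter_ex _ (0 : R)^'+); apply: filterI => //.
    exact: nbhs_right_gt.
  by exists d.
apply: (@subclosed_compact _ _ (set_val @^-1` `[d, 1]%classic)) => //.
  apply: sub_compact; last exact: segment_compact.
  move=> r /=; rewrite in_itv /= => /andP[dr r1].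
  by apply/andP; split=> //; exact: lt_le_trans dr.
move=> s Xs /=; rewrite in_itv /= dX//=.
by have /andP[] := set_valP s.
Qed.

Definition interval01 : Type := I01 R.
HB.instance Definition _ := Topological.on interval01.
HB.instance Definition _ := isPointed.Build interval01 (zero01 R).

Lemma interval01_compact : compact [set: interval01].
Proof.
rewrite [X in compact X](_ : _ = set_val @^-1` I01 R).
  apply: sub_compact => //.
  rewrite (_ : I01 R = `[0, 1]%classic); first exact: segment_compact.
  by apply/seteqP; split=> x; rewrite /I01 /= in_itv.
by apply/seteqP; split=> // x _; exact: set_valP.
Qed.

Lemma disk_radius_in (z : disk R) : I01 R (rnorm (set_val z)).
Proof.
have := set_valP z; rewrite /disk_set /= -rnormE lecR => z1.
by apply/andP; split=> //; exact: rnorm_ge0.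
Qed.

Lemma disk_val_continuous : continuous (set_val : disk R -> cplx R).
Proof. exact: set_val_cts. Qed.

Lemma disk_radius_continuous :
  continuous (fun z : disk R => to_set (disk_radius_in z) : interval01).
Proof.
apply: (@continuous_comp_initial _ _ _ set_val) => z.
apply: (@continuous_comp _ _ _ (set_val : disk R -> cplx R) (@rnorm R (cplx R))).
  exact: disk_val_continuous.
exact: rnorm_continuous.
Qed.

Definition disk_radius : continuousType (disk R) interval01 :=
  mkcts disk_radius_continuous.

Lemma interval_fun_continuous (G : R -> R) : continuous G ->
  continuous (fun t : interval01 => G (set_val t)).
Proof.
move=> Gc t; apply: (@continuous_comp _ _ _ (set_val : I01 R -> R) G).
  exact: initial_continuous.
exact: Gc.
Qed.

Definition interval_fun (G : R -> R) (Gc : continuous G) : cfun R interval01 :=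
  cfun_real (interval_fun_continuous Gc).

Definition radial (g : cfun R interval01) : cfun R (disk R) :=
  cfun_comp g disk_radius.

Lemma radial_starhom : starhom radial.
Proof. by split=> [k f g||f]; [|split=> [|f g]|]; apply/continuousEP. Qed.

Lemma radialE (G : R -> R) (Gc : continuous G) z :
  radial (interval_fun Gc) z = (G (rnorm (set_val z)))%:C%C.
Proof. by []. Qed.

Definition pos_part (x : R) : R := (x + `|x|) / 2.

Lemma pos_part_continuous : continuous pos_part.
Proof.
move=> x; apply: cvgM; last exact: cvg_cst.
apply: cvgD; first exact: cvg_id.
by apply: cvg_norm; exact: cvg_id.
Qed.

Lemma pos_part_comp_continuous (u : R -> R) :
  continuous u -> continuous (fun t => pos_part (u t)).
Proof.
move=> uc t; apply: (@continuous_comp R R R u pos_part); first exact: uc.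
exact: pos_part_continuous.
Qed.

Lemma pos_part_le0 x : x <= 0 -> pos_part x = 0.
Proof. by move=> x0; rewrite /pos_part ler0_norm// subrr mul0r. Qed.

Lemma pos_part_ge0 x : 0 <= x -> pos_part x = x.
Proof. by move=> x0; rewrite /pos_part ger0_norm//; lra. Qed.

Definition tent (r d t : R) : R := pos_part (1 - `|t - r| / d).

Lemma tent_continuous r d : continuous (tent r d).
Proof.
apply: pos_part_comp_continuous => t; apply: cvgB; first exact: cvg_cst.
apply: cvgM; last exact: cvg_cst.
by apply: cvg_norm; apply: cvgB; [exact: cvg_id|exact: cvg_cst].
Qed.

Lemma tent_center r d : tent r d r = 1.
Proof. by rewrite /tent subrr normr0 mul0r subr0 pos_part_ge0. Qed.

Lemma tent_out r d t : 0 < d -> d <= `|t - r| -> tent r d t = 0.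
Proof.
by move=> d0 dt; rewrite /tent pos_part_le0// subr_le0 ler_pdivlMr// mul1r.
Qed.

Lemma tent_bound r d t : 0 < d -> 0 <= tent r d t <= 1.
Proof.
move=> d0; rewrite /tent; have : 0 <= `|t - r| / d by rewrite divr_ge0// ltW.
set a := _ / d => a0; have [a1|a1] := leP a 1.
  by rewrite pos_part_ge0; lra.
by rewrite pos_part_le0; lra.
Qed.

Definition radial_tent r d := radial (interval_fun (@tent_continuous r d)).

Lemma radial_tentE r d z : radial_tent r d z = (tent r d (rnorm (set_val z)))%:C%C.
Proof. by []. Qed.

Lemma circle_rnorm (r : I01 R) (z : circle r) : rnorm (set_val z) = set_val r.
Proof. by apply: (@complexI R); rewrite rnormE; exact: (set_valP z). Qed.

Lemma cvg_mul (X : topologicalType) (f g : X -> cplx R) (x : X) :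
  {for x, continuous f} -> {for x, continuous g} ->
  {for x, continuous (fun y => f y * g y)}.
Proof. by move=> fc gc; apply: cvgM. Qed.

Lemma direction_cvg (X : ptopologicalType) (c : cfun R X) (x : X) (k : cplx R) :
  (c x : cplx R) != 0 ->
  (fun w => k * ((c w : cplx R) / `|c w|) : cplx R) @ x --> (k * ((c x : cplx R) /
      `|c x|) : cplx R).
Proof.
move=> x0; apply: cvgM; first exact: cvg_cst.
apply: cvgM; first exact: cts_fun.
apply: cvgV; first by rewrite normr_eq0.
by apply: cvg_norm; exact: cts_fun.
Qed.

(** The homogeneous extension [g (r z / |z|)] is discontinuous at [0]; a
    radial factor that vanishes near [0] repairs it. *)
Lemma circle_extend (r : I01 R) (g : cfun R (circle r)) :
  exists f : cfun R (disk R), cfun_comp f (circle_incl r) = g.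
Proof.
have [r0|r0] := eqVneq (set_val r) 0.
  exists ((g point : cplx R) *: (1 : cfun R (disk R))); apply/continuousEP => z.
  rewrite [LHS](_ : _ = (g point : cplx R) * 1)// mulr1; congr (g _); apply: val_inj.
  have E (w : circle r) : set_val w = 0 by apply: rnorm_eq0; rewrite circle_rnorm r0.
  by rewrite -[LHS]/(set_val _) -[RHS]/(set_val _) !E.
have rp : 0 < set_val r by rewrite lt_def r0; have /andP[] := set_valP r.
have retP (z : disk R) : circle_set r (if set_val z == 0 then (set_val r)%:C%C else
    (set_val r)%:C%C * (set_val z / `|set_val z|)).
  case: eqP => [_|/eqP z0]; first exact: circle_pt.
  rewrite /circle_set /= normrM normrM normfV normr_id mulfV ?normr_eq0// mulr1.
  by rewrite -rnormE rnorm_real gtr0_norm.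
pose ret z : circle r := to_set (retP z).
have retE z : set_val z != 0 :> cplx R ->
    set_val (ret z) = (set_val r)%:C%C * (set_val z / `|set_val z|) :> cplx R.
  move=> z0; transitivity (if set_val z == 0 then (set_val r)%:C%C else
    (set_val r)%:C%C * (set_val z / `|set_val z|) : cplx R) => //.
  by rewrite (negbTE z0).
have Gc : continuous (fun t : R => pos_part (2 * (t / set_val r) - 1)).
  apply: pos_part_comp_continuous => t; apply: cvgB; last exact: cvg_cst.
  apply: cvgM; first exact: cvg_cst.
  by apply: cvgM; [exact: cvg_id|exact: cvg_cst].
pose k := radial (interval_fun Gc).
pose f (z : disk R) : cplx R := (k z : cplx R) * g (ret z).
have fc : continuous f.
  move=> z; have [z0|z0] := eqVneq (set_val z) 0.
    apply: (@cvg_rnorm _ _ (nbhs z)) => e e0; apply/plane_nbhsP.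
    exists (set_val r / 2) => [|w]; first by rewrite divr_gt0.
    rewrite z0 sub0r rnormN => wr.
    have E (t : disk R) : rnorm (set_val t) < set_val r / 2 -> k t = 0.
      move=> tr; rewrite /k radialE pos_part_le0// subr_le0 mulrA ler_pdivrMr//
          mul1r; lra.
    by rewrite /f !E ?mul0r ?subrr ?rnorm0// z0 rnorm0 divr_gt0.
  apply: cvg_mul; first exact: cts_fun.
  apply: (@continuous_comp _ _ _ ret (fun w => g w : cplx R)); last exact: cts_fun.
  move=> U /plane_nbhsP[d d0 dU].
  have rc := @direction_cvg (disk R) (mkcts disk_val_continuous) z (set_val r)%:C%C z0.
  have nz : \forall w \near z, set_val w != 0 :> cplx R.
    apply/plane_nbhsP; exists (rnorm (set_val z)) => [|w].
      rewrite lt_def rnorm_ge0 andbT; apply: contra_neq z0; exact: rnorm_eq0.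
    by apply: contraTneq => ->; rewrite subr0 ltxx.
  have cl := rc _ (near_rnorm_lt _ d0).
  apply: filterS2 nz cl => w w0 /= zw; apply: dU.
  by rewrite !retE.
exists (mkcts fc); apply/continuousEP => z.
have zr := circle_rnorm z.
have E : set_val (circle_incl r z) = set_val z :> cplx R by [].
have zn0 : set_val z != 0 :> cplx R.
  by apply/eqP => z0; move: zr r0; rewrite z0 rnorm0 => <-; rewrite eqxx.
rewrite [LHS](_ : _ = f (circle_incl r z))// /f /k radialE E zr divff//
    pos_part_ge0; last lra.
rewrite mulr1 (_ : 2 - 1 = 1 :> R) ?mul1r; last lra.
congr (g _); apply: val_inj; apply: etrans (retE (circle_incl r z) zn0) _.
rewrite E -rnormE zr mulrCA mulfV ?mulr1//.
by rewrite -(rmorph0 (@real_complex R)) (inj_eq (@complexI R)).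
Qed.

End Radius.

(** * Irreducible representations of the crossed product *)

Lemma commutant_closed (R : realType) (A : cstarAlgType R) (S : set A) :
  (forall c, S c -> S (star c)) ->
  closed_star_subalgebra [set a | forall c, S c -> c * a = a * c].
Proof.
move=> SS; split=> /=.
- by move=> c _; rewrite mulr1 mul1r.
- by move=> k x y xc yc c Sc; rewrite mulrDr mulrDl -scalerAr -scalerAl xc ?yc.
- by move=> x y xc yc c Sc; rewrite mulrA xc// -mulrA yc// mulrA.
- by move=> x xc c Sc; rewrite -[c]starK -!starM xc//; exact: SS.
- move=> x xa c Sc; apply/eqP; rewrite -subr_eq0; apply/eqP/cnorm_small0 => e e0.
  have c1 : 0 < 2 * cnorm c + 1 by have := cnorm_ge0 c; lra.
  have [y yc xy] := xa _ (divr_gt0 e0 c1).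
  have -> : c * x - x * c = c * (x - y) - (x - y) * c.
    by rewrite mulrBr mulrBl (yc c Sc) opprB addrA subrK.
  apply: (le_trans (cnormB _ _)); move: xy; rewrite ltr_pdivlMr//.
  have := cnormM c (x - y); have := cnormM (x - y) c.
  have := cnorm_ge0 (x - y); nra.
Qed.

Lemma cfun_comp_starhom (R : realType) (X Y : ptopologicalType)
  (phi : continuousType X Y) : starhom (fun f : cfun R Y => cfun_comp f phi).
Proof. by split=> [k f g||f]; [|split=> [|f g]|]; apply/continuousEP. Qed.

Lemma cp_fun_starhom (R : realType) (X : ptopologicalType)
  (phi : continuousType X X) (A : crossedProduct R phi) : starhom (cp_fun A).
Proof. by case: (cp_cov A). Qed.

Section Radius.
Context (R : realType) (theta : R) (A : crossedProduct R (rot_disk theta)).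

Lemma radial_rot (g : cfun R (interval01 R)) :
  cfun_comp (radial g) (rot_disk theta) = radial g.
Proof.
apply/continuousEP => z; congr (g _); apply: val_inj.
transitivity (rnorm (expi theta * set_val z)) => //.
by rewrite rnormM rnorm_expi mul1r.
Qed.

Lemma radial_central (g : cfun R (interval01 R)) (a : A) :
  cp_fun A (radial g) * a = a * cp_fun A (radial g).
Proof.
have Ah := cp_fun_starhom A; have [_ [u1 u2] cov] := cp_cov A.
pose S := [set c : A | exists g, c = cp_fun A (radial g)].
suff : forall b, [set a | forall c, S c -> c * a = a * c] b.
  by move=> H; apply: (H a); exists g.
apply: crossedProduct_ind.
- apply: commutant_closed => _ [k ->]; exists (star k).
  by rewrite (starhomS (radial_starhom R)) (starhomS Ah).
- move=> f _ [k ->]; rewrite -!(starhomM Ah); congr (cp_fun A _).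
  by apply/continuousEP => z; exact: mulrC.
- move=> _ [k ->]; rewrite -{2}(radial_rot k) -cov.
  by rewrite !mulrA u2 mul1r.
Qed.

Context (p : irrep A).

(** The radial functions are central, hence act by scalars: they detect the
    circle on which [p] lives. *)
Lemma irrep_radius : exists r : I01 R, forall g : cfun R (interval01 R),
  irrep_op p (cp_fun A (radial g)) = (g r : cplx R) *: 1.
Proof.
have Ah := cp_fun_starhom A.
have jh : starhom (irrep_op p \o (cp_fun A \o @radial R)).
  apply: starhom_comp; first exact: irrep_op_starhom.
  by apply: starhom_comp; [exact: Ah|exact: radial_starhom].
have [|r rP] := @prime_character R (interval01 R) (@interval01_compact R)
  (operators (@irrep_vecP _ _ p)) _ jh; last by exists r.
move=> f g fg /=; rewrite !irrep_op_eq0; apply: irrep_prime; first exact: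
    radial_central.
by rewrite -(starhomM Ah) -(starhomM (radial_starhom R)) fg (starhom0
    (radial_starhom R)) (starhom0 Ah).
Qed.

Lemma nearest_on_circle (r : I01 R) (z : cplx R) :
  exists w : circle r, rnorm (z - set_val w) <= `|rnorm z - set_val r|.
Proof.
have /andP[r0 _] := set_valP r.
have [z0|z0] := eqVneq z 0.
  by exists point; rewrite z0 sub0r rnormN rnorm0 sub0r normrN rnorm_real.
have wP : circle_set r ((set_val r)%:C%C * (z / `|z|)).
  rewrite /circle_set /= normrM normrM normfV normr_id mulfV ?normr_eq0// mulr1.
  by rewrite -rnormE rnorm_real ger0_norm.
exists (to_set wP).
have -> : z - set_val (to_set wP) = (rnorm z - set_val r)%:C%C * (z / `|z|).
  rewrite rmorphB /= rnormE mulrBl [`|z| * _]mulrC divfK ?normr_eq0//.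
rewrite rnormM rnorm_real ler_piMr// /rnorm normrM normfV normr_id.
by rewrite mulfV ?normr_eq0.
Qed.

(** A radial tent function around the circle acts as the identity, while its
    product with [f] is uniformly small when the tent is narrow. *)
Lemma irrep_vanish (r : I01 R) (f : cfun R (disk R)) :
  (forall g : cfun R (interval01 R),
     irrep_op p (cp_fun A (radial g)) = (g r : cplx R) *: 1) ->
  cfun_comp f (circle_incl r) = 0 -> irrep_op p (cp_fun A f) = 0.
Proof.
move=> pr f0; apply: cnorm_small0 => e e0.
have jh : starhom (irrep_op p \o cp_fun A).
  by apply: starhom_comp; [exact: irrep_op_starhom|exact: cp_fun_starhom].
have [d d0 dU] := plane_uniform (@disk_set_compact R) (@cts_fun _ _ f) e0.
have -> : irrep_op p (cp_fun A f) =
    irrep_op p (cp_fun A (f * radial_tent (set_val r) d)).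
  rewrite [RHS](starhomM jh) /= pr.
  rewrite [X in X *: 1](_ : _ = (tent (set_val r) d (set_val r))%:C%C)//.
  by rewrite tent_center scale1r mulr1.
apply: (cfun_contractive jh); first exact: ltW.
move=> z; rewrite [X in rnorm X](_ : _ = (f z : cplx R) * radial_tent (set_val r) d
    z)//.
rewrite rnormM radial_tentE rnorm_real.
have /andP[t0 t1] := tent_bound (set_val r) (rnorm (set_val z)) d0.
have [dz|zd] := leP d `|rnorm (set_val z) - set_val r|.
  by rewrite tent_out// normr0 mulr0 ltW.
have [w zw] := nearest_on_circle r (set_val z).
have : rnorm ((f z : cplx R) - f (circle_incl r w)) < e.
  by apply: dU; exact: le_lt_trans zd.
have -> : f (circle_incl r w) = 0.
  by rewrite -[LHS]/(cfun_comp f (circle_incl r) w) f0.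
rewrite subr0 (ger0_norm t0) => fe.
have := rnorm_ge0 (f z : cplx R); nra.
Qed.

End Radius.

(** The values of [P] on functions depend only on the restrictions to the circle.
    As every function on the circle extends to the disk, they define a covariant
    pair, and the universal property of [B] factors [P] through [xi]. *)
Lemma restriction_kernel (R : realType) (theta : R)
    (A : crossedProduct R (rot_disk theta)) (r : I01 R)
    (B : crossedProduct R (rot_circle r theta)) (xi : starEpi A B)
    (xi_fun : forall f, xi (cp_fun A f) = cp_fun B (cfun_comp f (circle_incl r)))
    (xi_unitary : xi (cp_unitary A) = cp_unitary B)
    (D : cstarAlgType R) (P : A -> D) :
  starhom P ->
  (forall f, cfun_comp f (circle_incl r) = 0 -> P (cp_fun A f) = 0) ->
  forall a, xi a = 0 -> P a = 0.
Proof.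
move=> Ph P0 a xa.
have Ah := cp_fun_starhom A; have [_ uU cov] := cp_cov A.
have resh := cfun_comp_starhom R (circle_incl r).
have [ex exP] := choice (@circle_extend R r).
have eqP f g : cfun_comp f (circle_incl r) = cfun_comp g (circle_incl r) ->
    P (cp_fun A f) = P (cp_fun A g).
  move=> fg; apply/eqP; rewrite -subr_eq0 -(starhomB Ph) -(starhomB Ah).
  by apply/eqP/P0; rewrite (starhomB resh) fg subrr.
pose j g := P (cp_fun A (ex g)).
have jP g f : cfun_comp f (circle_incl r) = g -> j g = P (cp_fun A f).
  by move=> fg; apply: eqP; rewrite exP fg.
have cv : covariant (rot_circle r theta) j (P (cp_unitary A)).
  split.
  - split=> [k f g||f].
    + rewrite (jP _ (k *: ex f + ex g)); last first.
        by rewrite (starhomD resh) (starhomZ resh) !exP.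
      by rewrite (starhomD Ah) (starhomZ Ah) (starhomD Ph) (starhomZ Ph).
    + split=> [|f g]; first by rewrite (jP _ 1) ?(starhom1 resh)// (starhom1 Ah)
        (starhom1 Ph).
      rewrite (jP _ (ex f * ex g)) ?(starhomM resh) ?exP//.
      by rewrite (starhomM Ah) (starhomM Ph).
    + rewrite (jP _ (star (ex f))) ?(starhomS resh) ?exP//.
      by rewrite (starhomS Ah) (starhomS Ph).
  - exact: starhom_unitary.
  - move=> g; rewrite (jP (cfun_comp g (rot_circle r theta)) (cfun_comp (ex g)
      (rot_disk theta))).
      by rewrite /j -cov !(starhomM Ph) (starhomS Ph).
    rewrite -[in RHS](exP g); apply/continuousEP => z; congr (ex g _).
    exact: val_inj.
have [h [[hh hf hu] _]] := cp_univ B cv.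
have xih := starEpi_hom xi.
have E : forall b, h (xi b) = P b.
  apply: crossedProduct_ext => [|//|f|] /=.
  - exact: (starhom_comp hh xih).
  - by rewrite xi_fun hf; apply: jP.
  - by rewrite xi_unitary hu.
by rewrite -E xa (starhom0 hh).
Qed.

Section CfunIrrep.
Context (R : realType) (X : ptopologicalType) (Xc : compact [set: X]).

Lemma dot_continuous (H : hilbertType R) (y : H) :
  continuous (fun x : H => (dot x y : cplx R) : cline R).
Proof.
move=> x; apply: (@cvg_rnorm _ _ (nbhs x)) => e e0.
have y1 : 0 < (e / (rnorm y + 1))%:C%C :> cplx R.
  by rewrite ltcR divr_gt0//; have := rnorm_ge0 y; lra.
have := @cvgr_dist_lt _ _ _ (nbhs x) (nbhs_filter x) id x cvg_id _ y1.
apply: filterS => z; rewrite -rnormE ltcR => xz.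
rewrite -dotBl; apply: (le_lt_trans (cauchy_schwarz _ _)).
have y1' : 0 < rnorm y + 1 by have := rnorm_ge0 y; lra.
move: xz; rewrite ltr_pdivlMr//; have := rnorm_ge0 (x - z); nra.
Qed.

(** All operators being scalar, the representation space is a line. *)
Lemma cfun_irrep_eval (q : irrep (cfun R X)) :
  exists x : X, unitary_equiv q (eval_irrep R x).
Proof.
have [|x xP] := @prime_character R X Xc (operators (@irrep_vecP _ _ q)) _
    (irrep_op_starhom q).
  move=> f g fg; rewrite !irrep_op_eq0; apply: irrep_prime => // a.
  by apply/continuousEP => x; exact: mulrC.
have qE f v : q f v = (f x : cplx R) *: v by rewrite -irrep_opE xP.
exists x; apply: unitary_equiv_sym.
pose e0 := irrep_vec q; have e0P : e0 <> 0 by exact: irrep_vecP.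
have n0 : 0 < rnorm e0.
  by rewrite lt_def rnorm_ge0 andbT; apply/eqP => /rnorm_eq0.
pose e := ((rnorm e0)^-1)%:C%C *: e0.
have e1 : rnorm e = 1.
  by rewrite rnormZ rnorm_real ger0_norm ?invr_ge0 ?ltW// mulVf// gt_eqF.
have ee : dot e e = 1 by rewrite dot_rnorm e1 expr1n.
move: e e1 ee => e e1 ee; have [_ qI] := irrep_irr q.
pose W := [set v : irrep_space q | v - dot v e *: e = 0].
have WT : W = setT.
  have [| |W0|//] := qI W.
  - split=> [|k v w Wv Ww|].
    + by rewrite /W /= dot0l scale0r subrr.
    + rewrite /W /= dotDl dotZl scalerDl -scalerA opprD addrACA -scalerBr.
      by rewrite (_ : v - _ = 0)// (_ : w - _ = 0)// scaler0 addr0.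
    + apply: closed_ker => v; apply: cvgB; first exact: cvg_id.
      by apply: cvgZr_tmp; exact: dot_continuous.
  - by move=> f v Wv; rewrite /W /= qE dotZl -scalerA -scalerBr (_ : v - _ = 0)//
      scaler0.
  - have : W e by rewrite /W /= ee scale1r subrr.
    by rewrite W0 /= => e00; move: e1; rewrite e00 rnorm0 => /esym/eqP; rewrite
        oner_eq0.
exists (fun k : cline R => (k : cplx R) *: e); split.
- move=> k v w; transitivity ((k * (v : cplx R) + (w : cplx R)) *: e) => //.
  by rewrite scalerDl scalerA.
- by move=> k l; rewrite dotZl dotZr ee mulr1 /dot /= /cline_dot.
- move=> v; exists (dot v e : cplx R).
  have : W v by rewrite WT.
  by move=> /eqP; rewrite subr_eq0 => /eqP <-.
- by move=> f k; rewrite qE scalerA.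
Qed.

Lemma eval_irrep_inj (x y : X) : unitary_equiv (eval_irrep R x) (eval_irrep R y) ->
  forall f : cfun R X, f x = f y.
Proof.
move=> xy f.
have := irrep_ker_equiv (a := f - (f x : cplx R) *: 1) xy.
move=> /(_ _ (1 : cplx R)) /=; rewrite /eval_act.
have E z : (f - (f x : cplx R) *: 1) z = (f z : cplx R) - f x * 1 by [].
rewrite !E !mulr1 => H; apply/esym/eqP; rewrite -subr_eq0; apply/eqP.
rewrite -[LHS]mulr1; apply: H => v.
by rewrite subrr; exact: scale0r.
Qed.

End CfunIrrep.

(** * The field of rotation algebras over the radii *)

(** Closedness holds because *-homomorphisms are contractive, which makes the
    family equicontinuous. *)
Lemma pointwise_limit_subalgebra (R : realType) (A D : cstarAlgType R)
    (h : nat -> A -> D) (l : A -> D) :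
  (forall n, starhom (h n)) -> starhom l ->
  closed_star_subalgebra [set a | clim (fun n => h n a) (l a)].
Proof.
move=> hh lh; split=> /=.
- by move=> e e0; exists 0%N => n _; rewrite (starhom1 (hh n)) (starhom1 lh) subrr
    cnorm0.
- move=> k x y xl yl e e0.
  have k1 : 0 < rnorm k + 1 by have := rnorm_ge0 k; lra.
  have [N HN] := xl _ (divr_gt0 (divr_gt0 e0 (ltr0n _ 2)) k1).
  have [M HM] := yl _ (divr_gt0 e0 (ltr0n _ 2)).
  exists (maxn N M) => n; rewrite geq_max => /andP[/HN xn /HM yn].
  rewrite (starhomD (hh n)) (starhomZ (hh n)) (starhomD lh) (starhomZ lh).
  rewrite opprD addrACA -scalerBr; apply: (le_lt_trans (cnormD _ _)).
  rewrite cnormZr; move: xn; rewrite ltr_pdivlMr//.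
  have := cnorm_ge0 (h n x - l x); nra.
- move=> x y xl yl e e0.
  have y1 : 0 < cnorm y + 1 by have := cnorm_ge0 y; lra.
  have x1 : 0 < cnorm x + 1 by have := cnorm_ge0 x; lra.
  have [N HN] := xl _ (divr_gt0 (divr_gt0 e0 (ltr0n _ 2)) y1).
  have [M HM] := yl _ (divr_gt0 (divr_gt0 e0 (ltr0n _ 2)) x1).
  exists (maxn N M) => n; rewrite geq_max => /andP[/HN xn /HM yn].
  rewrite (starhomM (hh n)) (starhomM lh).
  have -> : h n x * h n y - l x * l y = (h n x - l x) * h n y + l x * (h n y - l y).
    by rewrite mulrBl mulrBr addrA subrK.
  apply: (le_lt_trans (cnormD _ _)).
  have := cnormM (h n x - l x) (h n y); have := cnormM (l x) (h n y - l y).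
  have := starhom_contractive (hh n) y; have := starhom_contractive lh x.
  move: xn yn; rewrite !ltr_pdivlMr//.
  have := cnorm_ge0 (h n x - l x); have := cnorm_ge0 (h n y - l y).
  have := cnorm_ge0 (l x); have := cnorm_ge0 (h n y); nra.
- move=> x xl e /xl[N HN]; exists N => n /HN.
  by rewrite (starhomS (hh n)) (starhomS lh) -starB cnormS.
- move=> x xa e e0.
  have [y yl xy] := xa _ (divr_gt0 e0 (ltr0n _ 4)).
  have [N HN] := yl _ (divr_gt0 e0 (ltr0n _ 4)).
  exists N => n /HN yn.
  have := cnorm_split (h n y) (h n x) (l x); have := cnorm_split (l y) (h n y) (l x).
  have := starhom_contractive (hh n) (x - y); have := starhom_contractive lh (x - y).
  rewrite (starhomB (hh n)) (starhomB lh) (cnormBC (l y) (l x)); lra.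
Qed.

Section Scaling.
Context (R : realType).

Lemma scale_in (t : oc01 R) (s : I01 R) (z : circle (of_oc01 t)) :
  circle_set s ((set_val s / set_val t)%:C%C * set_val z).
Proof.
have /andP[t0 _] := set_valP t; have /andP[s0 _] := set_valP s.
rewrite /circle_set /= -rnormE rnormM rnorm_real circle_rnorm.
have -> : set_val (of_oc01 t) = set_val t by [].
by rewrite ger0_norm ?divfK ?gt_eqF// divr_ge0// ltW.
Qed.

Lemma scale_continuous (t : oc01 R) (s : I01 R) :
  continuous (fun z : circle (of_oc01 t) => to_set (scale_in s z) : circle s).
Proof.
apply: lift_cts.
exact: (@cts_fun _ _ ((set_val s / set_val t)%:C%C *: circle_coord (of_oc01 t))).
Qed.

Definition scale (t : oc01 R) (s : I01 R) :
  continuousType (circle (of_oc01 t)) (circle s) := mkcts (@scale_continuous t s).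

Lemma scaleE (t : oc01 R) (s : I01 R) z :
  set_val (scale t s z) = (set_val s / set_val t)%:C%C * set_val z :> cplx R.
Proof. by []. Qed.

Lemma scale_dist (t : oc01 R) (s r : I01 R) (z : circle (of_oc01 t)) :
  rnorm (set_val (scale t s z) - set_val (scale t r z) : cplx R) =
  `|set_val s - set_val r|.
Proof.
have /andP[t0 _] := set_valP t.
rewrite !scaleE -mulrBl -rmorphB /= rnormM rnorm_real circle_rnorm.
have -> : set_val (of_oc01 t) = set_val t by [].
by rewrite -mulrBl normrM normfV (gtr0_norm t0) divfK ?gt_eqF.
Qed.

End Scaling.

Section Field.
Context (R : realType) (theta : R).
Context (A : crossedProduct R (rot_disk theta)).
Context (B : forall r : I01 R, crossedProduct R (rot_circle r theta)).
Context (Atheta : rotationAlgebra theta).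
Context (xi : forall r : I01 R, starEpi A (B r)).
Context (xi_fun : forall r f,
  xi r (cp_fun A f) = cp_fun (B r) (cfun_comp f (circle_incl r))).
Context (xi_unitary : forall r, xi r (cp_unitary A) = cp_unitary (B r)).
Context (alpha : forall r : oc01 R, starEpi (B (of_oc01 r)) Atheta).
Context (alpha_inj : forall r, injective (alpha r)).
Context (alpha_unitary : forall r,
  alpha r (cp_unitary (B (of_oc01 r))) = ra_U Atheta).
Context (alpha_fun : forall r,
  alpha r (cp_fun (B (of_oc01 r)) (circle_coord (of_oc01 r))) =
  ((set_val r)%:C%C : cplx R) *: ra_V Atheta).

(** Two radii are compared through the scaling of the circles; the comparison is
    the identity of the rotation algebra, because it fixes its generators.  This
    determines [alpha s] on all continuous functions. *)
Lemma alpha_scale (s t : oc01 R) (g : cfun R (circle (of_oc01 s))) :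
  alpha s (cp_fun (B (of_oc01 s)) g) =
  alpha t (cp_fun (B (of_oc01 t)) (cfun_comp g (scale t (of_oc01 s)))).
Proof.
have /andP[s0 _] := set_valP s; have /andP[t0 _] := set_valP t.
set Bs := B (of_oc01 s); set Bt := B (of_oc01 t).
have Bth := cp_fun_starhom Bt; have Bsh := cp_fun_starhom Bs.
have [_ uU cov] := cp_cov Bt.
have sch := cfun_comp_starhom R (scale t (of_oc01 s)).
have ah := starEpi_hom (alpha s); have bh := starEpi_hom (alpha t).
have cv : covariant (rot_circle (of_oc01 s) theta)
    (fun g => cp_fun Bt (cfun_comp g (scale t (of_oc01 s)))) (cp_unitary Bt).
  split=> //; first exact: (starhom_comp Bth sch).
  move=> f; rewrite cov; congr (cp_fun Bt _).
  apply/continuousEP => z; congr (f _); apply: val_inj.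
  transitivity ((set_val s / set_val t)%:C%C * (expi theta * set_val z) : cplx R) => //.
  transitivity (expi theta * ((set_val s / set_val t)%:C%C * set_val z) : cplx R) => //.
  by rewrite mulrCA.
have [k [[kh kf ku] _]] := cp_univ Bs cv.
have [inv invK] := choice (starEpi_surj (alpha s)).
have invh : starhom inv.
  split=> [c x y||x].
  - by apply: (@alpha_inj s); rewrite (starhomD ah) (starhomZ ah) !invK.
  - split=> [|x y]; apply: (@alpha_inj s); first by rewrite invK (starhom1 ah).
    by rewrite (starhomM ah) !invK.
  - by apply: (@alpha_inj s); rewrite (starhomS ah) !invK.
have invE b : inv (alpha s b) = b by apply: (@alpha_inj s); rewrite invK.
have E : forall x, alpha t (k (inv x)) = x.
  have := @rotationAlgebra_ext R theta Atheta Atheta (alpha t \o (k \o inv)) id.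
  apply=> //.
  - exact: (starhom_comp bh (starhom_comp kh invh)).
  - by rewrite /= -(alpha_unitary s) invE ku alpha_unitary.
  - rewrite /=; have -> : ra_V Atheta = ((set_val s)^-1)%:C%C *:
        alpha s (cp_fun Bs (circle_coord (of_oc01 s))).
      rewrite alpha_fun scalerA -rmorphM /= mulVf ?gt_eqF// rmorph1.
      by rewrite scale1r.
    rewrite -(starhomZ ah) invE (starhomZ kh) (starhomZ bh) (starhomZ ah) kf.
    have -> : cfun_comp (circle_coord (of_oc01 s)) (scale t (of_oc01 s)) =
       (set_val s / set_val t)%:C%C *: circle_coord (of_oc01 t).
      exact/continuousEP.
    rewrite (starhomZ Bth) (starhomZ bh) !alpha_fun !scalerA; congr (_ *: _).
    by rewrite -!rmorphM /= mulrA divfK ?gt_eqF.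
by rewrite -[LHS]E invE kf.
Qed.

Definition radius_hom (s : oc01 R) : starEpi A Atheta :=
  starEpi_comp (alpha s) (xi (of_oc01 s)).

Lemma radius_hom_radial (s : oc01 R) (g : cfun R (interval01 R)) :
  radius_hom s (cp_fun A (radial g)) = (g (of_oc01 s) : cplx R) *: 1.
Proof.
rewrite /radius_hom /= xi_fun.
have -> : cfun_comp (radial g) (circle_incl (of_oc01 s)) =
    (g (of_oc01 s) : cplx R) *: 1.
  apply/continuousEP => z; transitivity ((g (of_oc01 s) : cplx R) * 1) => //.
  rewrite mulr1; congr (g _); apply: val_inj; exact: circle_rnorm.
by rewrite (starhomZ (cp_fun_starhom _)) (starhom1 (cp_fun_starhom _))
  (starhomZ (starEpi_hom _)) (starhom1 (starEpi_hom _)).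
Qed.

(** Convergence holds on a closed *-subalgebra, and on functions it is their
    uniform continuity on the disk.  The radius [r] may be [0]; the circle of
    radius [t] serves to compare all radii. *)
Lemma radius_hom_limit (t : oc01 R) (s : nat -> oc01 R) (r : I01 R)
    (h : A -> Atheta) :
  starhom h -> h (cp_unitary A) = ra_U Atheta ->
  (forall f, h (cp_fun A f) = alpha t (cp_fun (B (of_oc01 t))
     (cfun_comp (cfun_comp f (circle_incl r)) (scale t r)))) ->
  (forall e, 0 < e -> exists N, forall n, (N <= n)%N ->
     `|set_val (s n) - set_val r| < e) ->
  forall a, clim (fun n => radius_hom (s n) a) (h a).
Proof.
move=> hh hU hf sr.
apply: (@crossedProduct_ind _ _ _ _ [set a | clim (fun n => radius_hom (s n) a) (h a)]).
- apply: pointwise_limit_subalgebra => // n; exact: starEpi_hom.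
- move=> f e e0.
  have e2 : 0 < e / 2 by rewrite divr_gt0.
  have [d d0 dU] := plane_uniform (@disk_set_compact R) (@cts_fun _ _ f) e2.
  have [N HN] := sr d d0; exists N => n Nn.
  rewrite hf /radius_hom /= xi_fun (alpha_scale t).
  have jh : starhom (alpha t \o cp_fun (B (of_oc01 t))).
    by apply: starhom_comp; [exact: starEpi_hom|exact: cp_fun_starhom].
  rewrite -(starhomB jh); apply: (@le_lt_trans _ _ (e / 2)); last by lra.
  apply: (cfun_contractive jh); first exact: ltW.
  move=> z; apply/ltW/dU.
  by rewrite [X in X < _](scale_dist (of_oc01 (s n)) r z); exact: HN.
- move=> e e0; exists 0%N => n _.
  by rewrite hU /radius_hom /= xi_unitary alpha_unitary subrr cnorm0.
Qed.

End Field.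

(** * The fibre over the centre of the disk *)

Section EvalOp.
Context (R : realType) (X : ptopologicalType).

Fact cline1_neq0 : (1 : cplx R) <> 0 :> cline R.
Proof. exact/eqP/oner_neq0. Qed.

(** Evaluation at [x], as a scalar operator; all points act on the same line. *)
Definition eval_op (x : X) (f : cfun R X) : operators cline1_neq0 :=
  to_set (irrep_adjointable (eval_irrep R x) f).

Lemma eval_op_starhom x : starhom (eval_op x).
Proof.
split=> [k f g||f].
- apply: opr_ext => v; transitivity (eval_irrep R x (k *: f + g) v) => //.
  by rewrite irrepL.
- split=> [|f g]; apply: opr_ext => v.
    by transitivity (eval_irrep R x 1 v) => //; rewrite irrep1.
  by transitivity (eval_irrep R x (f * g) v) => //; rewrite irrepM.
- by apply: opr_ext.
Qed.
End EvalOp.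

Section ZeroFibre.
Context (R : realType) (theta : R).
Context (B0 : crossedProduct R (rot_circle (zero01 R) theta)).

Lemma circle0_fun (f : cfun R (circle (zero01 R))) : f = (f point : cplx R) *: 1.
Proof.
apply/continuousEP => z; transitivity ((f point : cplx R) * 1) => //.
rewrite mulr1; congr (f _); apply: val_inj.
have E (w : circle (zero01 R)) : set_val w = 0 :> cplx R.
  by apply: rnorm_eq0; rewrite circle_rnorm.
by rewrite -[LHS]/(set_val _) -[RHS]/(set_val _) !E.
Qed.

Lemma zero_fibre_fun (D : starAlgType R) (h : B0 -> D) f : starhom h ->
  h (cp_fun B0 f) = (f point : cplx R) *: 1.
Proof.
move=> hh; have Bh := cp_fun_starhom B0.
by rewrite {1}(circle0_fun f) (starhomZ Bh) (starhom1 Bh) (starhomZ hh) (starhom1 hh).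
Qed.

Lemma zero_fibre_ext (D : cstarAlgType R) (h1 h2 : B0 -> D) :
  starhom h1 -> starhom h2 -> h1 (cp_unitary B0) = h2 (cp_unitary B0) ->
  forall b, h1 b = h2 b.
Proof.
by move=> H1 H2 HU; apply: crossedProduct_ext => // f; rewrite !zero_fibre_fun.
Qed.

Lemma zero_fibre_univ (D : cstarAlgType R) (w : D) : unitary w ->
  exists2 h : B0 -> D, starhom h & h (cp_unitary B0) = w.
Proof.
move=> wU; pose j (f : cfun R (circle (zero01 R))) : D := (f point : cplx R) *: 1.
have cv : covariant (rot_circle (zero01 R) theta) j w.
  split=> //.
  - split=> [k f g||f]; rewrite /j.
    + rewrite scalerA -scalerDl; exact: erefl.
    + split=> [|f g]; first exact: scale1r.
      by rewrite -scalerAl mul1r scalerA.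
    + by rewrite starZ star1.
  - move=> f; rewrite /j -scalerAr mulr1 -scalerAl wU.1.
    congr (_ *: _); rewrite [in RHS](circle0_fun f); symmetry; exact: mulr1.
by have [h [[hh _ hU] _]] := cp_univ B0 cv; exists h.
Qed.

Context (beta : starEpi B0 (cfun R (circle (one01 R)))).
Context (beta_inj : injective beta).
Context (beta_unitary : beta (cp_unitary B0) = circle_coord (one01 R)).
Context (Atheta : rotationAlgebra theta).

Let chi (w : circle (one01 R)) := eval_op w \o beta.

Lemma chi_starhom w : starhom (chi w).
Proof. by apply: starhom_comp; [exact: eval_op_starhom|exact: starEpi_hom]. Qed.

Lemma chi_eq0 w b : chi w b = 0 <-> (beta b w = 0 :> cplx R).
Proof.
split=> [/(congr1 (fun T => opr T ((1 : cplx R) : cline R)))|b0].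
  by move=> H; rewrite -[LHS]mulr1; exact: H.
apply: opr_ext => v; transitivity ((beta b w : cplx R) *: v) => //.
by rewrite b0; exact: scale0r.
Qed.

Lemma chi_unitary w : chi w (cp_unitary B0) = (set_val w : cplx R) *: 1.
Proof. by apply: opr_ext => v; rewrite /chi /= beta_unitary. Qed.

Lemma circle1_rnorm (w : circle (one01 R)) : rnorm (set_val w : cplx R) = 1.
Proof. by rewrite circle_rnorm. Qed.

(** The kernel of [z |-> ra_U Atheta] is an ideal of functions on the circle; it
    has a common zero, and it is invariant under rotations because
    [ra_U |-> k ra_U], [ra_V |-> ra_V] is an automorphism of [Atheta]. *)
Lemma zero_fibre_faithful (h : B0 -> Atheta) : starhom h ->
  h (cp_unitary B0) = ra_U Atheta ->
  forall b, h b = 0 -> beta b = 0.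
Proof.
move=> hh hU.
have bh := starEpi_hom beta.
have [|||[b []]|w0 w0P] := @ideal_common_zero R _ (@circle_compact R (one01 R))
  [set g | exists b, beta b = g /\ h b = 0].
- move=> _ _ [b [<- b0]] [c [<- c0]]; exists (b + c).
  by rewrite (starhomD bh) (starhomD hh) b0 c0 addr0.
- move=> _ g [b [<- b0]]; have [c <-] := starEpi_surj beta g; exists (c * b).
  by rewrite (starhomM bh) (starhomM hh) b0 mulr0.
- by exists 0; rewrite (starhom0 bh) (starhom0 hh).
- rewrite -(starhom1 bh) => /beta_inj ->; rewrite (starhom1 hh) => /eqP.
  by rewrite oner_eq0.
move=> b hb; apply/continuousEP => w.
apply/(chi_eq0 w b).
have w0n : (set_val w0 : cplx R) != 0.
  by apply/eqP => E; have := circle1_rnorm w0; rewrite E rnorm0 => /esym/eqP;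
      rewrite oner_eq0.
pose k := (set_val w : cplx R) / set_val w0.
have k1 : rnorm k = 1.
  have : rnorm (k * set_val w0) = 1 by rewrite divfK// circle1_rnorm.
  by rewrite rnormM circle1_rnorm mulr1.
have [_ uU _] := cp_cov B0.
have [kap kaph kapU] := zero_fibre_univ (unitaryZ k1 uU).
have rot : rotation_pair theta (k *: ra_U Atheta) (ra_V Atheta).
  have [U1 V1 VU] := ra_rel Atheta; split=> //; first exact: unitaryZ.
  by rewrite -scalerAr VU -scalerAl !scalerA mulrC.
have [tau [[tauh tauU _] _]] := ra_univ Atheta rot.
have htau : h (kap b) = tau (h b).
  apply: (zero_fibre_ext (h1 := h \o kap) (h2 := tau \o h)).
  - exact: starhom_comp.
  - exact: starhom_comp.
  - by rewrite /= kapU (starhomZ hh) hU tauU.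
have chiE : chi w0 (kap b) = chi w b.
  apply: (zero_fibre_ext (h1 := chi w0 \o kap) (h2 := chi w)).
  - exact: (starhom_comp (chi_starhom w0) kaph).
  - exact: chi_starhom.
  - rewrite [LHS]/= kapU (starhomZ (chi_starhom w0)) !chi_unitary scalerA.
    by rewrite divfK.
rewrite -chiE; apply/chi_eq0; apply: w0P; exists (kap b); split=> //.
by rewrite htau hb (starhom0 tauh).
Qed.

End ZeroFibre.

(** * The spectrum of the crossed product of the disk *)

Section Spectrum.
Context (R : realType) (theta : R) (thetaP : irrational theta).
Context (A : crossedProduct R (rot_disk theta)).
Context (B : forall r : I01 R, crossedProduct R (rot_circle r theta)).
Context (Atheta : rotationAlgebra theta).
Context (xi : forall r : I01 R, starEpi A (B r)).
Context (xi_fun : forall r f,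
  xi r (cp_fun A f) = cp_fun (B r) (cfun_comp f (circle_incl r))).
Context (xi_unitary : forall r, xi r (cp_unitary A) = cp_unitary (B r)).
Context (alpha : forall r : oc01 R, starEpi (B (of_oc01 r)) Atheta).
Context (alpha_inj : forall r, injective (alpha r)).
Context (alpha_unitary : forall r,
  alpha r (cp_unitary (B (of_oc01 r))) = ra_U Atheta).
Context (alpha_fun : forall r,
  alpha r (cp_fun (B (of_oc01 r)) (circle_coord (of_oc01 r))) =
  ((set_val r)%:C%C : cplx R) *: ra_V Atheta).
Context (beta : starEpi (B (zero01 R)) (cfun R (circle (one01 R)))).
Context (beta_inj : injective beta).
Context (beta_unitary : beta (cp_unitary (B (zero01 R))) = circle_coord (one01 R)).

Local Notation rho_ := (radius_hom xi alpha).

Definition pos_class (rho : irrep Atheta) (r : oc01 R) : spectrum A :=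
  spec_class (irrep_pull (starEpi_comp (alpha r) (xi (of_oc01 r))) rho).

Definition zero_class (w : circle (one01 R)) : spectrum A :=
  spec_class (irrep_pull (starEpi_comp beta (xi (zero01 R))) (eval_irrep R w)).

(** The kernel does not depend on [rho], by simplicity. *)
Lemma pos_class_ker rho r a : spec_ker (pos_class rho r) a <-> rho_ r a = 0.
Proof.
rewrite spec_ker_class; split=> [a0|a0 x /=].
  apply: (rotationAlgebra_simple thetaP (irrep_op_starhom rho)).
  exact/irrep_op_eq0.
by rewrite [alpha r _](_ : _ = 0)// irrep0.
Qed.

Lemma zero_class_ker w a :
  spec_ker (zero_class w) a <-> beta (xi (zero01 R) a) w = 0 :> cplx R.
Proof.
rewrite spec_ker_class; split=> [/(_ (1 : cplx R)) H|H x].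
  by rewrite -[LHS]mulr1; exact: H.
by rewrite /= /eval_act H; exact: scale0r.
Qed.

Lemma zero_hom_radial (g : cfun R (interval01 R)) w :
  beta (xi (zero01 R) (cp_fun A (radial g))) w = g (zero01 R) :> cplx R.
Proof.
rewrite xi_fun (zero_fibre_fun _ (starEpi_hom beta)).
transitivity ((g (zero01 R) : cplx R) * 1); last by rewrite mulr1.
congr (_ * _); congr (g _); apply: val_inj.
exact: (circle_rnorm (point : circle (zero01 R))).
Qed.

Lemma idR_continuous : continuous (@id R).
Proof. by move=> x; exact: cvg_id. Qed.

(** The function [|z|] acts by the radius, which is thus an invariant of the
    class. *)
Definition modulus_minus (t : R) : A :=
  cp_fun A (radial (interval_fun idR_continuous)) - (t%:C%C : cplx R) *: 1.

Lemma pos_class_radius rho r t :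
  spec_ker (pos_class rho r) (modulus_minus t) <-> set_val r = t.
Proof.
have h := starEpi_hom (rho_ r).
rewrite pos_class_ker (starhomB h) (radius_hom_radial xi_fun) (starhomZ h) (starhom1 h).
rewrite -scalerBl; split=> [/eqP|<-]; last by rewrite subrr scale0r.
have -> : interval_fun idR_continuous (of_oc01 r) = (set_val r)%:C%C by [].
rewrite scaler_eq0 oner_eq0 orbF subr_eq0 => /eqP; exact: complexI.
Qed.

Lemma zero_class_radius w t :
  spec_ker (zero_class w) (modulus_minus t) <-> t = 0.
Proof.
have h : starhom (beta \o xi (zero01 R)).
  by apply: starhom_comp; exact: starEpi_hom.
rewrite zero_class_ker [beta _](starhomB h) (starhomZ h) (starhom1 h) /=.
rewrite [LHS](_ : _ = (beta (xi (zero01 R) (cp_fun A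
   (radial (interval_fun idR_continuous)))) w : cplx R) - t%:C%C * 1)//.
rewrite zero_hom_radial mulr1.
have -> : interval_fun idR_continuous (zero01 R) = 0 by [].
rewrite sub0r; split=> [/eqP|->]; last by rewrite oppr0.
by rewrite oppr_eq0 => /eqP/(@complexI R).
Qed.

Lemma pos_class_inj rho r rho' r' : pos_class rho r = pos_class rho' r' ->
  r = r' /\ spec_class rho = spec_class rho'.
Proof.
move=> E; have rr : r = r'.
  apply: val_inj; apply/(pos_class_radius rho r (set_val r')).
  by rewrite E pos_class_radius.
move: E; rewrite rr => /spec_classP/unitary_equiv_pull/spec_classP.
by split.
Qed.

Lemma pos_zero_class rho r w : pos_class rho r <> zero_class w.
Proof.
move=> E; have /andP[r0 _] := set_valP r.
have := (pos_class_radius rho r (set_val r)).2 erefl.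
rewrite E zero_class_radius => rE.
by have : (0 : R) < 0; [rewrite -{2}rE|rewrite ltxx].
Qed.

Lemma zero_class_inj w w' : zero_class w = zero_class w' -> w = w'.
Proof.
move=> /spec_classP/unitary_equiv_pull/eval_irrep_inj H.
by apply: val_inj; exact: (H (circle_coord (one01 R))).
Qed.

Lemma pos_class_congr rho rho' r :
  spec_class rho = spec_class rho' -> pos_class rho r = pos_class rho' r.
Proof. by move=> /spec_classP rr; apply/spec_classP/unitary_equiv_pull. Qed.

(** The kernel of the restriction to the circle found by [irrep_radius] is
    killed, and the fibre is [Atheta] or the algebra of functions on a circle. *)
Lemma class_cases (c : spectrum A) :
  (exists rho r, c = pos_class rho r) \/ (exists w, c = zero_class w).
Proof.
have [p ->] := spec_class_surj c; have [r rP] := irrep_radius p.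
have xik a : xi r a = 0 -> irrep_op p a = 0.
  apply: (restriction_kernel (xi_fun r) (xi_unitary r) (irrep_op_starhom p)).
  by move=> f; exact: irrep_vanish.
have [r0|r0] := eqVneq (set_val r) 0.
  right; have rE : r = zero01 R by apply: val_inj; exact: r0.
  subst r.
  have [q pq] : exists q, unitary_equiv p (irrep_pull (starEpi_comp beta (xi
      (zero01 R))) q).
    apply: irrep_descend => a /= ba; apply/irrep_op_eq0/xik; apply: beta_inj.
    by rewrite ba (starhom0 (starEpi_hom beta)).
  have [w qw] := cfun_irrep_eval (@circle_compact R (one01 R)) q.
  exists w; apply/spec_classP; apply: unitary_equiv_trans pq _.
  exact/unitary_equiv_pull.
left; have rP' : oc01 R (set_val r).
  have /andP[r1 r2] := set_valP r; apply/andP; split=> //.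
  by rewrite lt_def r0.
pose s : oc01 R := to_set rP'.
have rE : of_oc01 s = r by exact: val_inj.
have {}xik a : xi (of_oc01 s) a = 0 -> irrep_op p a = 0 by rewrite rE; exact: xik.
have [q pq] : exists q, unitary_equiv p (irrep_pull (starEpi_comp (alpha s) (xi
    (of_oc01 s))) q).
  apply: irrep_descend => a /= ba; apply/irrep_op_eq0/xik; apply: (@alpha_inj s).
  by rewrite ba (starhom0 (starEpi_hom _)).
by exists q, s; exact/spec_classP.
Qed.

Lemma cp_tent_pos (s : oc01 R) c d :
  rho_ s (cp_fun A (radial_tent c d)) = (tent c d (set_val s))%:C%C *: 1.
Proof. exact: (radius_hom_radial xi_fun). Qed.

Lemma cp_tent_zero c d w :
  beta (xi (zero01 R) (cp_fun A (radial_tent c d))) w = (tent c d 0)%:C%C :> cplx R.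
Proof. exact: zero_hom_radial. Qed.

Lemma pos_limit (F : set (oc01 R)) (r : oc01 R) (a : A) :
  (forall s, F s -> rho_ s a = 0) ->
  (forall e : R, 0 < e -> exists2 s, F s & `|set_val r - set_val s| < e) ->
  rho_ r a = 0.
Proof.
move=> Fa rF.
have ex n : exists s, F s /\ `|set_val r - set_val s| < n.+1%:R^-1.
  by have [|s Fs rs] := rF n.+1%:R^-1; [rewrite invr_gt0|exists s].
have [s sP] := choice ex.
have lim : clim (fun n => rho_ (s n) a) (rho_ r a).
  apply: (radius_hom_limit xi_fun xi_unitary alpha_inj alpha_unitary alpha_fun
    (t := r) (r := of_oc01 r)).
  - exact: starEpi_hom.
  - by rewrite /radius_hom /= xi_unitary alpha_unitary.
  - by move=> f; rewrite /radius_hom /= xi_fun (alpha_scale alpha_inj alpha_unitary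
      alpha_fun r).
  - move=> e e0; have [N _ HN] := near_infty_natSinv_lt (PosNum e0).
    exists N => n Nn; have [_] := sP n; rewrite distrC => /lt_trans; apply.
    exact: HN.
apply: (clim_uniq lim) => e e0; exists 0%N => n _.
by rewrite Fa ?subrr ?cnorm0//; case: (sP n).
Qed.

(** The limit homomorphism factors through the fibre over [0], in which it is
    faithful. *)
Lemma zero_limit (F : set (oc01 R)) (a : A) :
  (forall s, F s -> rho_ s a = 0) ->
  (forall e : R, 0 < e -> exists2 s, F s & set_val s < e) ->
  beta (xi (zero01 R) a) = 0.
Proof.
move=> Fa rF.
have ex n : exists s, F s /\ set_val s < n.+1%:R^-1.
  by have [|s Fs rs] := rF n.+1%:R^-1; [rewrite invr_gt0|exists s].
have [s sP] := choice ex.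
have [U1 _ _] := ra_rel Atheta.
have [h hh hU] := zero_fibre_univ (B (zero01 R)) U1.
apply: (zero_fibre_faithful beta_inj beta_unitary hh hU).
have lim : clim (fun n => rho_ (s n) a) (h (xi (zero01 R) a)).
  apply: (radius_hom_limit xi_fun xi_unitary alpha_inj alpha_unitary alpha_fun
    (t := s 0%N) (r := zero01 R) (h := h \o xi (zero01 R))).
  - by apply: starhom_comp => //; exact: starEpi_hom.
  - by rewrite /= xi_unitary hU.
  - move=> f; rewrite /= xi_fun (zero_fibre_fun _ hh).
    set g := cfun_comp f _.
    have sch := cfun_comp_starhom R (scale (s 0%N) (zero01 R)).
    rewrite {2}(circle0_fun g) (starhomZ sch) (starhom1 sch).
    rewrite (starhomZ (cp_fun_starhom _)) (starhom1 (cp_fun_starhom _)).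
    by rewrite (starhomZ (starEpi_hom _)) (starhom1 (starEpi_hom _)).
  - move=> e e0; have [N _ HN] := near_infty_natSinv_lt (PosNum e0).
    exists N => n Nn; have [_] := sP n; have /andP[sn0 _] := set_valP (s n).
    have -> : set_val (zero01 R) = 0 by [].
    rewrite subr0 gtr0_norm// => /lt_trans; apply.
    exact: HN.
apply: (clim_uniq lim) => e e0; exists 0%N => n _.
by rewrite Fa ?subrr ?cnorm0//; case: (sP n).
Qed.

(** Functions and lifts of functions on the circle separate points from closed
    sets: the closed sets of the target are closed for the hull-kernel topology. *)
Lemma hk_closed_target (T : target R (spectrum Atheta) -> Prop)
    (Q : spectrum A -> Prop) :
  (forall rho r, Q (pos_class rho r) <-> T (inr (spec_class rho, r))) ->
  (forall w, Q (zero_class w) <-> T (inl w)) ->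
  target_closed T -> hk_closed Q.
Proof.
move=> Qpos Qzero Tc c cQ.
have kerQ a : (forall rho r, T (inr (spec_class rho, r)) -> rho_ r a = 0) ->
    (forall w, T (inl w) -> beta (xi (zero01 R) a) w = 0 :> cplx R) -> spec_ker c a.
  move=> Ha Hb; apply: cQ => d; case: (class_cases d) => [[rho [r ->]]|[w ->]].
    by move=> /Qpos/Ha ra; exact/pos_class_ker.
  by move=> /Qzero/Hb wa; exact/zero_class_ker.
(* Both kinds of closed sets are described by two closed sets of parameters. *)
have [Y [F [Yc Fc TE]]] : exists Y F, [/\ closed Y, closed F & T = target_set Y F].
  case: Tc => [[F [Fc ->]]|[Y [X [Yc Xc ->]]]].
    by exists setT, F; split=> //; exact: closedT.
  by exists Y, X; split=> //; exact: compact_closed (@oc01_hausdorff R) Xc.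
case: (class_cases c) => [[rho [r cE]]|[w cE]]; rewrite cE.
  apply/Qpos; apply: contrapT => Tr.
  have /andP[r0 _] := set_valP r.
  have [d [d0 dr dF]] : exists d : R, [/\ 0 < d, d <= set_val r &
      forall s, F s -> d <= `|set_val s - set_val r|].
    apply: contrapT => nd; apply: Tr; rewrite TE /=.
    apply: ((oc01_closedP F).1 Fc r) => e e0.
    apply: contrapT => ne; apply: nd; exists (Num.min e (set_val r)).
    split; first by rewrite lt_min e0.
      by rewrite ge_min lexx orbT.
    move=> s Fs; rewrite ge_min; apply/orP; left; rewrite leNgt; apply/negP => se.
    by apply: ne; exists s; rewrite // distrC.
  have /pos_class_ker : spec_ker (pos_class rho r) (cp_fun A (radial_tent (set_val
      r) d)).
    rewrite -cE; apply: kerQ => [rho' s|w _].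
      move=> Ts; have Fs : F s by rewrite TE in Ts.
      rewrite cp_tent_pos tent_out ?scale0r//.
      exact: dF.
    by rewrite cp_tent_zero tent_out// sub0r normrN gtr0_norm.
  rewrite cp_tent_pos tent_center => /eqP.
  by rewrite scaler_eq0 !oner_eq0.
apply/Qzero; apply: contrapT => Tw.
(* The set of radii is compact, as [inl w] would otherwise belong to [T]. *)
have [X0 [Y0 [Y0c X0c TE0]]] : exists X Y, [/\ closed Y, compact X & T = target_set
    Y X].
  case: Tc => [[G [_ TG]]|[Y' [X [? ? ?]]]]; last by exists X, Y'.
  by exfalso; apply: Tw; rewrite TG.
have [_ [d d0 dX]] := (oc01_compactP X0).1 X0c.
have [e e0 eY] : exists2 e : R, 0 < e & forall y, Y0 y -> e <= rnorm (set_val w -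
    set_val y : cplx R).
  apply: contrapT => ne; apply: Tw; rewrite TE0 /=.
  apply: ((plane_closedP Y0).1 Y0c w) => e e0.
  apply: contrapT => ny; apply: ne; exists e => // y Yy.
  by rewrite leNgt; apply/negP => wy; apply: ny; exists y.
pose g : cfun R (circle (one01 R)) := circle_coord (one01 R) - (set_val w : cplx R)
    *: 1.
have gE z : rnorm (g z : cplx R) = rnorm (set_val w - set_val z : cplx R).
  transitivity (rnorm (set_val z - set_val w * 1 : cplx R)) => //.
  by rewrite mulr1 rnormBC.
have kc : continuous (fun z => tent 0 e (rnorm (g z : cplx R))).
  move=> z; apply: (@continuous_comp (circle (one01 R)) R R (fun z => rnorm (g z :
      cplx R)) (tent 0 e)).
    exact: cfun_rnorm_continuous.
  exact: tent_continuous.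
pose k : cfun R (circle (one01 R)) := cfun_real kc.
have [b0 b0k] := starEpi_surj beta k; have [b bb0] := starEpi_surj (xi (zero01 R)) b0.
have bE : beta (xi (zero01 R) b) = k by rewrite bb0.
have zh : starhom (beta \o xi (zero01 R)) by apply: starhom_comp; exact: starEpi_hom.
have valE z : beta (xi (zero01 R) (cp_fun A (radial_tent 0 d) * b)) z =
    (tent 0 e (rnorm (g z : cplx R)))%:C%C :> cplx R.
  rewrite [beta _](starhomM zh) /= bE.
  transitivity ((beta (xi (zero01 R) (cp_fun A (radial_tent 0 d))) z : cplx R) * k
      z) => //.
  by rewrite cp_tent_zero tent_center rmorph1 mul1r.
have /zero_class_ker : spec_ker (zero_class w) (cp_fun A (radial_tent 0 d) * b).
  rewrite -cE; apply: kerQ => [rho' s|y].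
    move=> Ts; have Xs : X0 s by rewrite TE0 in Ts.
    rewrite (starhomM (starEpi_hom _)) cp_tent_pos tent_out.
    - by rewrite scale0r mul0r.
    - by [].
    - by rewrite subr0 (le_trans (dX _ Xs))// ler_norm.
  move=> Ty; have Yy : Y0 y by rewrite TE0 in Ty.
  rewrite valE gE tent_out//.
  by rewrite subr0 (le_trans (eY _ Yy))// ler_norm.
rewrite valE gE subrr rnorm0 tent_center => /eqP.
by rewrite rmorph1 oner_eq0.
Qed.

(** Conversely, a hull-kernel closed set contains with a class all those of the
    same radius, by simplicity; the limits of radii give the two forms. *)
Lemma target_closed_hk (T : target R (spectrum Atheta) -> Prop)
    (Q : spectrum A -> Prop) :
  (forall rho r, Q (pos_class rho r) <-> T (inr (spec_class rho, r))) ->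
  (forall w, Q (zero_class w) <-> T (inl w)) ->
  hk_closed Q -> target_closed T.
Proof.
move=> Qpos Qzero Qc.
pose F := [set r | exists rho, T (inr (spec_class rho, r))].
pose Y := [set w | T (inl w)].
have kerF a : Defs.kernel Q a -> forall s, F s -> rho_ s a = 0.
  by move=> Qa s [rho /Qpos/Qa/pos_class_ker].
have kerY a : Defs.kernel Q a -> forall w, Y w -> beta (xi (zero01 R) a) w = 0 :>
    cplx R.
  by move=> Qa w /Qzero/Qa/zero_class_ker.
have FT rho r : F r -> T (inr (spec_class rho, r)).
  move=> Fr; apply/Qpos/Qc => a Qa; apply/pos_class_ker; exact: kerF.
have TE : T = target_set Y F.
  apply/funext => -[w|[sg r]] //=; rewrite propeqE.
  have [rho ->] := spec_class_surj sg.
  by split=> [Tr|Fr]; [exists rho|exact: FT].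
have Fc : closed F.
  apply/oc01_closedP => r rF.
  have [rho _] : exists rho : irrep Atheta, True.
    by have [|s [rho _] _] := rF 1; [|exists rho].
  exists rho; apply/Qpos/Qc => a Qa; apply/pos_class_ker.
  by apply: pos_limit rF; exact: kerF.
have [F0|nF0] := pselect (forall e : R, 0 < e -> exists2 s, F s & set_val s < e).
  left; exists F; split=> //; rewrite TE; congr target_set.
  apply/seteqP; split=> // w _; apply/Qzero/Qc => a Qa; apply/zero_class_ker.
  by rewrite (zero_limit (kerF a Qa) F0).
right; exists Y, F; split=> //.
- apply/plane_closedP => w wY; apply/Qzero/Qc => a Qa; apply/zero_class_ker.
  apply: rnorm_small0 => e e0.
  have [d d0 dU] := (plane_continuousP _).1
    (@cts_fun _ _ (beta (xi (zero01 R) a))) w e e0.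
  have [y Yy wy] := wY d d0.
  by have := dU y wy; rewrite (kerY a Qa y Yy) subr0 => /ltW.
- apply/oc01_compactP; split=> //; apply: contrapT => nd; apply: nF0 => e e0.
  apply: contrapT => ne; apply: nd; exists e => // s Fs.
  by rewrite leNgt; apply/negP => se; apply: ne; exists s.
Qed.

End Spectrum.

Theorem proposition5p5 (R : realType) (theta : R) (thetaP : irrational theta)
    (A : crossedProduct R (rot_disk theta))
    (B : forall r : I01 R, crossedProduct R (rot_circle r theta))
    (Atheta : rotationAlgebra theta)
    (* xi r : the quotient map induced by restriction to the circle r *)
    (xi : forall r : I01 R, starEpi A (B r))
    (xi_fun : forall r f,
       xi r (cp_fun A f) = cp_fun (B r) (cfun_comp f (circle_incl r)))
    (xi_unitary : forall r, xi r (cp_unitary A) = cp_unitary (B r))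
    (* the identification of B r with Atheta for 0 < r *)
    (alpha : forall r : oc01 R, starEpi (B (of_oc01 r)) Atheta)
    (alpha_inj : forall r, injective (alpha r))
    (alpha_unitary : forall r,
       alpha r (cp_unitary (B (of_oc01 r))) = ra_U Atheta)
    (alpha_fun : forall r,
       alpha r (cp_fun (B (of_oc01 r)) (circle_coord (of_oc01 r))) =
       ((set_val r)%:C%C : cplx R) *: ra_V Atheta)
    (* the identification of B 0 with C(T) *)
    (beta : starEpi (B (zero01 R)) (cfun R (circle (one01 R))))
    (beta_inj : injective beta)
    (beta_unitary : beta (cp_unitary (B (zero01 R))) = circle_coord (one01 R)) :
  exists q : spectrum A -> target R (spectrum Atheta),
    [/\ forall (rho : irrep Atheta) (r : oc01 R),
          q (spec_class
               (irrep_pull (starEpi_comp (alpha r) (xi (of_oc01 r))) rho)) =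
          inr (spec_class rho, r),
        forall w : circle (one01 R),
          q (spec_class
               (irrep_pull (starEpi_comp beta (xi (zero01 R))) (eval_irrep R w))) =
          inl w
      & homeomorphism (jacobson A) (target_topology R (spectrum Atheta)) q].

Proof.
pose pos := pos_class xi alpha; pose zero := zero_class xi beta.
pose rel (c : spectrum A) (t : target R (spectrum Atheta)) :=
  (exists rho r, c = pos rho r /\ t = inr (spec_class rho, r)) \/
  (exists w, c = zero w /\ t = inl w).
have rel_pos rho r t : rel (pos rho r) t -> t = inr (spec_class rho, r).
  move=> [[rho' [r' [/(pos_class_inj thetaP xi_fun) [-> ->] ->]]]//|[w [E _]]].
  by case: (pos_zero_class thetaP xi_fun E).
have rel_zero w t : rel (zero w) t -> t = inl w.
  move=> [[rho' [r' [/esym E _]]]|[w' [/zero_class_inj -> ->]]//].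
  by case: (pos_zero_class thetaP xi_fun E).
have cases := class_cases xi_fun xi_unitary alpha_inj beta_inj.
have [q qP] : exists q : spectrum A -> target R (spectrum Atheta), forall c, rel c
    (q c).
  have [c|q qP] := @choice _ _ rel; last by exists q.
  case: (cases c) => [[rho [r E]]|[w E]].
    by exists (inr (spec_class rho, r)); left; exists rho, r.
  by exists (inl w); right; exists w.
have q_pos rho r : q (pos rho r) = inr (spec_class rho, r) by exact: rel_pos.
have q_zero w : q (zero w) = inl w by exact: rel_zero.
exists q; split=> //; split.
  have q_inj c c' : q c = q c' -> c = c'.
    case: (cases c) => [[rho [r ->]]|[w ->]]; case: (cases c') => [[rho' [r'
        ->]]|[w' ->]].
    - rewrite -/pos !q_pos => E; pose pr (t : target R (spectrum Atheta)) := if t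
        is inr sr then sr else (spec_class rho, r).
      have E1 : spec_class rho = spec_class rho' := congr1 (fun t => (pr t).1) E.
      have E2 : r = r' := congr1 (fun t => (pr t).2) E.
      by rewrite -E2; exact: pos_class_congr.
    - by rewrite -/pos -/zero q_pos q_zero.
    - by rewrite -/pos -/zero q_pos q_zero.
    - by rewrite -/zero !q_zero => -[->].
  have q_surj t : exists c, q c = t.
    case: t => [w|[sg r]]; first by exists (zero w).
    by have [rho ->] := spec_class_surj sg; exists (pos rho r).
  have [g gK] := choice q_surj.
  by exists g => // c; apply: q_inj.
move=> S; have Qpos rho r : S (q (pos rho r)) <-> S (inr (spec_class rho, r)).
  by rewrite q_pos.
have Qzero w : S (q (zero w)) <-> S (inl w) by rewrite q_zero.
split=> /=.
- exact: (hk_closed_target thetaP xi_fun xi_unitary alpha_inj beta_inj Qpos Qzero).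
- exact: (target_closed_hk thetaP xi_fun xi_unitary alpha_inj alpha_unitary alpha_fun
    beta_inj beta_unitary Qpos Qzero).
Qed.
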